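(* Let $g:\mathbb R^N\times\mathbb R\to\mathbb R$ be of class $C^1$, let $H$ satisfy $(h_H)$ and let $B$ satisfy $(h_B)$ with $\kappa=0$ (assumptions stated in the context). Let $u\in C^1(\mathbb R^N)$ be a weak solution of $$-\operatorname{div}\big(B'(H(\nabla u))\nabla H(\nabla u)\big)=g(x,u)\quad\text{in }\mathbb R^N .$$ Assume that $$B(H(\nabla u)),\quad G(x,u),\quad x\cdot\nabla_xG(x,u)\ \in L^1(\mathbb R^N).$$ Then $$\int_{\mathbb R^N}\Big[N\,G(x,u)+\big(x\cdot\nabla_xG(x,u)\big)\Big]\,dx=\int_{\mathbb R^N}\Big[N\,B(H(\nabla u))-B'(H(\nabla u))H(\nabla u)\Big]\,dx .$$
   Context: **Assumptions $(h_B)$ on $B:[0,+\infty)\to\mathbb R$.** (i) $B\in C^{3,\beta}_{loc}((0,+\infty))\cap C^1([0,+\infty))$ with $\beta\in(0,1)$; (ii) $B(0)=B'(0)=0$ and $B(t),B'(t),B''(t)>0$ for all $t\in(0,+\infty)$; (iii) there exist $p>1$, $\kappa\in[0,1]$, $\gamma>0$, $\Gamma>0$ such that for all $t>0$ $$\gamma(\kappa+t)^{p-2}t\le B'(t)\le\Gamma(\kappa+t)^{p-2}t,\qquad \gamma(\kappa+t)^{p-2}\le B''(t)\le\Gamma(\kappa+t)^{p-2}.$$ **Assumptions $(h_H)$ on $H:\mathbb R^N\to\mathbb R$.** (i) $H\in C^{3,\beta}_{loc}(\mathbb R^N\setminus\{0\})$ and $H(\xi)>0$ for all $\xi\in\mathbb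 R^N\setminus\{0\}$; (ii) $H(s\xi)=|s|H(\xi)$ for all $\xi\in\mathbb R^N\setminus\{0\}$ and $s\in\mathbb R$ (so $H(0)=0$); (iii) $H$ is uniformly elliptic, i.e. the set $\mathcal B_1^H=\{\xi\in\mathbb R^N: H(\xi)<1\}$ is uniformly convex, meaning that there exists $\Lambda>0$ such that $\langle D^2H(\xi)v,v\rangle\ge\Lambda|v|^2$ for all $\xi\in\partial\mathcal B_1^H$ and all $v\in\nabla H(\xi)^\bot$. **Weak solution.** $u\in C^1(\mathbb R^N)$ is a weak solution of the equation if $$\int_{\mathbb R^N} B'(H(\nabla u))\langle\nabla H(\nabla u),\nabla\varphi\rangle\,dx=\int_{\mathbb R^N} g(x,u)\varphi\,dx\qquad\forall\varphi\in C_c^\infty(\mathbb R^N).$$ Here $\nabla H(\nabla u)$ denotes the gradient of $H$ evaluated at $\nabla u$, and the vector $B'(H(\nabla u))\nabla H(\nabla u)$ is understood to be $0$ where $\nabla u=0$ (it extends continuously by $0$). **Notation.** $G(x,t)=\int_0^tg(x,s)\,ds$ and $G_{x_i}(x,t)=\int_0^t\frac{\partial g}{\partial x_i}(x,s)\,ds$ on $\mathbb R^N\times\mathbb R$; $\nabla_xG=(G_{x_1},\dots,G_{x_N})$, so that $x\cdot\nabla_xG(x,u)=\sum_{i=1}^Nx_iG_{x_i}(x,u(x))$ (partial gradient in $x$ only, evaluated at $t=u(x)$). *)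

(* Defs.v *)
From HB Require Import structures.
From mathcomp Require Import all_boot all_order all_algebra.
From mathcomp Require Import all_classical all_reals all_analysis.
Set Implicit Arguments.
Unset Strict Implicit.
Unset Printing Implicit Defensive.
Import Order.TTheory GRing.Theory Num.Theory.
Import numFieldNormedType.Exports.
Local Open Scope classical_set_scope.
Local Open Scope ring_scope.

Definition rV_display : measure_display -> measure_display.
Proof. exact. Qed.

(* The sigma-algebra on ['rV[R]_n] generated by the coordinate maps, i.e. the
   Borel sigma-algebra. *)
Section rV_measurable.
Context {R : realType} (n : nat).

Let coord (i : 'I_n) (x : 'rV[R]_n) : measurableTypeR R := x ord0 i.

Let rV_set0 : g_sigma_preimage coord set0.
Proof. exact: sigma_algebra0. Qed.

Let rV_setC A : g_sigma_preimage coord A -> g_sigma_preimage coord (~` A).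
Proof. exact: sigma_algebraC. Qed.

Let rV_bigcup (F : (set 'rV[R]_n)^nat) :
  (forall i, g_sigma_preimage coord (F i)) ->
  g_sigma_preimage coord (\bigcup_i (F i)).
Proof. exact: sigma_algebra_bigcup. Qed.

HB.instance Definition _ := @isMeasurable.Build (rV_display default_measure_display)
  'rV[R]_n (g_sigma_preimage coord) rV_set0 rV_setC rV_bigcup.

Lemma measurable_coord (i : 'I_n) :
  measurable_fun [set: 'rV[R]_n] (fun x : 'rV[R]_n => x ord0 i : measurableTypeR R).
Proof.
move=> _ Y mY; rewrite setTI; apply: sub_sigma_algebra => /=.
rewrite -bigcup_seq/=; exists i => /=; first by rewrite mem_index_enum.
by exists Y => //; rewrite setTI.
Qed.

Lemma measurable_fun_rV d (T : measurableType d) (f : T -> 'rV[R]_n) :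
  (forall i, measurable_fun setT (fun t => f t ord0 i : measurableTypeR R)) ->
  measurable_fun setT f.
Proof.
move=> mf _ A mA; rewrite setTI.
have := mA; rewrite /measurable/= => /(_ [set B | measurable (f @^-1` B)]).
apply; split.
  split=> [|B mB|F mF] /=.
  - by rewrite preimage_set0.
  - by rewrite setTD -preimage_setC; exact: measurableC.
  - by rewrite preimage_bigcup; exact: bigcupT_measurable.
move=> B; rewrite -bigcup_seq => -[i _ [C mC <-]] /=.
by have := mf i measurableT C mC; rewrite !setTI.
Qed.

End rV_measurable.

Definition rV_cons {R : realType} n (p : measurableTypeR R * 'rV[R]_n) :
  'rV[R]_n.+1 := row_mx (p.1 : R)%:M p.2.

Definition rV_uncons {R : realType} n (x : 'rV[R]_n.+1) :
  measurableTypeR R * 'rV[R]_n := (x ord0 ord0, \row_i x ord0 (lift ord0 i)).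

Section rV_cons.
Context {R : realType} (n : nat).

Lemma rV_cons0 (p : measurableTypeR R * 'rV[R]_n) : rV_cons p ord0 ord0 = p.1.
Proof.
rewrite /rV_cons (_ : (ord0 : 'I_n.+1) = lshift n (ord0 : 'I_1));
  last exact/val_inj.
by rewrite (row_mxEl (p.1)%:M) mxE mulr1n.
Qed.

Lemma rV_consS (p : measurableTypeR R * 'rV[R]_n) i :
  rV_cons p ord0 (lift ord0 i) = p.2 ord0 i.
Proof.
rewrite /rV_cons (_ : lift ord0 i = rshift 1 i); last exact/val_inj.
by rewrite (row_mxEr (p.1)%:M).
Qed.

Lemma rV_consK : cancel (@rV_cons R n) (@rV_uncons R n).
Proof.
move=> -[a x]; rewrite /rV_uncons rV_cons0; congr pair.
by apply/rowP => i; rewrite mxE rV_consS.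
Qed.

Lemma measurable_rV_cons : measurable_fun setT (@rV_cons R n).
Proof.
apply: measurable_fun_rV => i; case: (unliftP ord0 i) => [j|] ->.
  under eq_fun do rewrite rV_consS.
  exact: measurableT_comp (measurable_coord j) measurable_snd.
under eq_fun do rewrite rV_cons0.
exact: measurable_fst.
Qed.

Lemma measurable_rV_uncons : measurable_fun setT (@rV_uncons R n).
Proof.
apply: measurable_fun_pair => /=; first exact: measurable_coord.
apply: measurable_fun_rV => i.
by under eq_fun do rewrite mxE; exact: measurable_coord.
Qed.

End rV_cons.

Section lebesgue_rV_step.
Local Open Scope ereal_scope.
Context {R : realType} (n : nat).
Variable mu : {sigma_finite_measure set 'rV[R]_n -> \bar R}.

Definition lebesgue_rV_step : set 'rV[R]_n.+1 -> \bar R :=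
  pushforward (@lebesgue_measure R \x mu) (@rV_cons R n).

HB.instance Definition _ := Measure.copy lebesgue_rV_step
  (measure_function_pushforward__canonical__measure_function_Measure
     (@lebesgue_measure R \x mu) (@measurable_rV_cons R n)).

Let lebesgue_rV_step_sigma_finite : sigma_finite setT lebesgue_rV_step.
Proof.
have /sigma_finiteP[F [FT ndF mF]] := sigma_finiteT (@lebesgue_measure R).
have /sigma_finiteP[G [GT ndG mG]] := sigma_finiteT mu.
exists (fun k => @rV_uncons R n @^-1` (F k `*` G k)).
  apply/seteqP; split => // x _.
  have : [set: measurableTypeR R] (rV_uncons x).1 by [].
  have : [set: 'rV[R]_n] (rV_uncons x).2 by [].
  rewrite FT GT => -[k _ Gk] [l _ Fl]; exists (maxn k l) => //; split.
    by move: Fl; exact/subsetPset/ndF/leq_maxr.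
  by move: Gk; exact/subsetPset/ndG/leq_maxl.
move=> k; have [mFk Fkoo] := mF k; have [mGk Gkoo] := mG k; split.
  rewrite -[X in measurable X]setTI; apply: measurable_rV_uncons => //.
  exact: measurableX.
rewrite /lebesgue_rV_step /pushforward -comp_preimage.
rewrite (_ : _ \o _ = id) ?preimage_id//.
  by rewrite product_measure1E// lte_mul_pinfty// ge0_fin_numE.
by apply/funext => p /=; rewrite rV_consK.
Qed.

HB.instance Definition _ := Measure_isSigmaFinite.Build _ _ _
  lebesgue_rV_step lebesgue_rV_step_sigma_finite.

End lebesgue_rV_step.

(* The n-fold product of the Lebesgue measure on R. *)
Fixpoint lebesgue_rV (R : realType) (n : nat) :
    {sigma_finite_measure set 'rV[R]_n -> \bar R} :=
  match n with
  | 0 => \d_(0 : 'rV[R]_0)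
  | m.+1 => lebesgue_rV_step (lebesgue_rV R m)
  end.

Lemma lebesgue_rV_box (R : realType) n (A : 'I_n -> set (measurableTypeR R)) :
  (forall i, measurable (A i)) ->
  lebesgue_rV R n [set x : 'rV[R]_n | forall i, A i (x ord0 i)] =
  (\prod_(i < n) lebesgue_measure (A i))%E.
Proof.
elim: n A => [|n IH] A mA.
  by rewrite big_ord0 /= diracE mem_set//=; case.
rewrite big_ord_recl -IH// -product_measure1E//; last first.
  rewrite (_ : [set _ | _] = \bigcap_(i in [set: 'I_n])
      ((fun x : 'rV[R]_n => x ord0 i : measurableTypeR R) @^-1`
        A (lift ord0 i))); last first.
    by apply/seteqP; split => x Ax i => [_|]; exact: Ax.
  apply: fin_bigcap_measurable => // i _.
  by rewrite -[X in measurable X]setTI; exact: measurable_coord.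
rewrite /= /lebesgue_rV_step /pushforward; congr (_ _).
apply/seteqP; split => -[a x] /= Aax.
  split; first by have := Aax ord0; rewrite rV_cons0.
  by move=> i; have := Aax (lift ord0 i); rewrite rV_consS.
by move=> i; case: (unliftP ord0 i) => [j|] ->; rewrite ?rV_consS ?rV_cons0;
  [exact: Aax.2|exact: Aax.1].
Qed.

Section calculus.
Context {R : realType}.

Definition basis_rV n (i : 'I_n) : 'rV[R]_n := delta_mx ord0 i.

Definition dot n (x y : 'rV[R]_n) : R := \sum_i x ord0 i * y ord0 i.

Definition gradient n (f : 'rV[R]_n -> R) (x : 'rV[R]_n) : 'rV[R]_n :=
  \row_i 'D_(basis_rV i) f x.

Definition hessian n (f : 'rV[R]_n -> R) (x : 'rV[R]_n) : 'M[R]_n :=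
  \matrix_(i, j) 'D_(basis_rV j) (fun y => 'D_(basis_rV i) f y) x.

(* Iterated partial derivative along the directions listed in [s]. *)
Definition iter_derive (V : normedModType R) (s : seq V) (f : V -> R) : V -> R :=
  foldr (fun v h => 'D_v h) f s.

(* [E] is the set of coordinate directions of [V]: a function is of class C^k
   on the open set [Om] when its partial derivatives of order at most k exist
   and are continuous on [Om]. *)
Definition class_C (V : normedModType R) (E : set V) (k : nat) (Om : set V)
    (f : V -> R) : Prop :=
  forall s : seq V, (forall v, v \in s -> E v) ->
    ((size s <= k)%N -> forall x, Om x -> {for x, continuous (iter_derive s f)})
    /\ ((size s < k)%N -> forall v x, E v -> Om x ->
          derivable (iter_derive s f) x v).

(* The norm of ['rV[R]_n] is the sup norm; passing to the Euclidean one only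
   changes the constant [C]. *)
Definition locally_holder (V : normedModType R) (beta : R) (Om : set V)
    (f : V -> R) : Prop :=
  forall K : set V, compact K -> K `<=` Om ->
    exists C : R, forall x y, K x -> K y -> `|f x - f y| <= C * `|x - y| `^ beta.

Definition class_C_holder_loc (V : normedModType R) (E : set V) (k : nat)
    (beta : R) (Om : set V) (f : V -> R) : Prop :=
  class_C E k Om f /\
  forall s : seq V, (forall v, v \in s -> E v) -> size s = k ->
    locally_holder beta Om (iter_derive s f).

Definition dir_R : set R^o := [set 1].

Definition dir_rV n : set 'rV[R]_n := range (@basis_rV n).

Definition dir_rV_R n : set ('rV[R]_n * R^o)%type :=
  [set z | (dir_rV z.1 /\ z.2 = 0) \/ (z.1 = 0 /\ z.2 = 1)].

Definition test_function n (phi : 'rV[R]_n -> R) : Prop :=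
  (forall k, class_C (@dir_rV n) k setT phi) /\
  compact (closure [set x | phi x != 0]).

(* Difference quotients of [f] at [t] within [0, +oo), and the corresponding
   derivative: the ordinary one for [t > 0], the right one for [t = 0]. *)
Definition half_quotient (f : R -> R) (t : R) : set_system R :=
  (fun s => (f s - f t) / (s - t)) @ within [set s | 0 <= s] t^'.

Definition half_derive (f : R -> R) (t : R) : R := lim (half_quotient f t).

Definition class_C1_half (f : R -> R) : Prop :=
  (forall t, 0 <= t -> cvg (half_quotient f t)) /\
  {within `[0, +oo[, continuous (half_derive f)}.

Lemma half_deriveE (f : R -> R) (t : R) : 0 < t ->
  half_derive f t = derive1 f t.
Proof.
move=> t0; rewrite /half_derive /derive1; congr (lim _).
have q h : (f (t + h) - f t) / (t + h - t) = h^-1 *: (f (h + t) - f t).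
  by rewrite (addrC t h) addrK mulrC.
apply/seteqP; split => P; rewrite /half_quotient /within /dnbhs /=;
    rewrite /within /=; move=> /nbhs_ballP[e /= e0 eP]; apply/nbhs_ballP.
  exists (Num.min e t) => /=; first by rewrite lt_min e0.
  move=> h; rewrite /ball /= sub0r normrN lt_min => /andP[he ht] h0.
  rewrite -q; apply: eP.
  - by rewrite /ball /= opprD addNKr normrN.
  - by rewrite -subr_eq0 addrC addKr.
  - by move: ht; rewrite ltr_norml => /andP[+ _]; rewrite -subr_gt0 opprK addrC => /ltW.
exists e => //= x; rewrite /ball /= => xe xt _.
rewrite -[in (f x - f t)](subrK t x) -{2}(subrK t x).
rewrite /= addrK mulrC; apply: eP; last by rewrite subr_eq0.
by rewrite /ball /= sub0r opprB.
Qed.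

End calculus.

Section equation.
Context {R : realType}.

(* [B] is only relevant on [0, +oo). *)
Definition hyp_B (beta kappa : R) (B : R -> R) : Prop :=
  [/\ class_C_holder_loc dir_R 3 beta `]0, +oo[ (B : R^o -> R)
        /\ class_C1_half B,
      B 0 = 0 /\ half_derive B 0 = 0,
      forall t, 0 < t -> [/\ 0 < B t, 0 < half_derive B t & 0 < derive1n 2 B t] &
      0 <= kappa <= 1 /\
      exists p gamma Gamma : R, [/\ 1 < p, 0 < gamma, 0 < Gamma &
        forall t, 0 < t ->
          gamma * (kappa + t) `^ (p - 2) * t <= half_derive B t
            <= Gamma * (kappa + t) `^ (p - 2) * t /\
          gamma * (kappa + t) `^ (p - 2) <= derive1n 2 B t
            <= Gamma * (kappa + t) `^ (p - 2)]].

Definition frontier (T : topologicalType) (A : set T) : set T :=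
  closure A `\` A°.

Definition hyp_H (n : nat) (beta : R) (H : 'rV[R]_n -> R) : Prop :=
  [/\ class_C_holder_loc (@dir_rV R n) 3 beta [set xi | xi != 0] H
        /\ (forall xi, xi != 0 -> 0 < H xi),
      forall xi (s : R), xi != 0 -> H (s *: xi) = `|s| * H xi &
      exists2 Lambda : R, 0 < Lambda &
        forall xi v, frontier [set eta | H eta < 1] xi ->
          dot (gradient H xi) v = 0 ->
          Lambda * dot v v <= dot (v *m hessian H xi) v].

(* xi |-> B'(H(xi)) grad H(xi), extended by 0 at the origin. *)
Definition flux n (B : R -> R) (H : 'rV[R]_n -> R) (xi : 'rV[R]_n) : 'rV[R]_n :=
  if xi == 0 then 0 else half_derive B (H xi) *: gradient H xi.

Definition weak_solution n (B : R -> R) (H : 'rV[R]_n -> R)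
    (g : 'rV[R]_n -> R -> R) (u : 'rV[R]_n -> R) : Prop :=
  class_C (@dir_rV R n) 1 setT u /\
  forall phi, test_function phi ->
    (\int[lebesgue_rV R n]_x
       (dot (flux B H (gradient u x)) (gradient phi x))%:E =
     \int[lebesgue_rV R n]_x (g x (u x) * phi x)%:E)%E.

(* The oriented integral of [f] from 0 to [t]. *)
Definition integral0 (f : R -> R) (t : R) : R :=
  if 0 <= t then \int[@lebesgue_measure R]_(s in `[0, t]) f s
  else - \int[@lebesgue_measure R]_(s in `[t, 0]) f s.

Definition primitive n (g : 'rV[R]_n -> R -> R) (x : 'rV[R]_n) (t : R) : R :=
  integral0 (g x) t.

Definition grad_x_primitive n (g : 'rV[R]_n -> R -> R) (x : 'rV[R]_n) (t : R) :
    'rV[R]_n :=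
  \row_i integral0 (fun s => 'D_(basis_rV i) (fun y => g y s) x) t.

End equation.

(* Main.v *)
(** [F = B \o H] is convex, with gradient the flux [a]. Fix a cutoff [psi >= 0] and test
    the equation with [psi(x) (u(l x) - u(x))], which is only C1, so that no second
    derivatives of [u] are needed. Bounding [F(l grad u(l x))] from below by the tangent of
    [F] at [grad u(x)] and changing variables [y = l x] in the energy shows that
      [\int l^-N psi(y / l) F(l grad u(y)) dy
         + \int (u(l y) - u(y)) (a(grad u) . grad psi - g(y, u) psi) dy]
    is minimal at [l = 1]; its derivative there vanishes. The remaining term
    [\int psi g(x, u) (x . grad u)] is eliminated by differentiating
    [\int psi(x) G(l x, u(l x)) dx] at [l = 1], before and after the same change of
    variables. For the cutoffs [psi(x / k)] all terms, including
    [(x . grad u) (a(grad u) . grad psi)], are dominated by multiples of [F(grad u)],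
    [G] and [x . grad_x G], and dominated convergence as [k] tends to infinity
    concludes. *)
From HB Require Import structures.
Require Import Defs.
From mathcomp Require Import all_boot all_order all_algebra.
From mathcomp Require Import all_classical all_reals all_analysis.
From mathcomp Require Import measurable_realfun ring lra.
Import Order.TTheory GRing.Theory Num.Theory.
Import numFieldNormedType.Exports.
Local Open Scope classical_set_scope.
Local Open Scope ring_scope.
Set Implicit Arguments.
Unset Strict Implicit.
Unset Printing Implicit Defensive.

(** * Lebesgue measure on row vectors *)

(** The classical proof multiplies the equation by [x . grad u]. For [u] of class C1 this is merely
    continuous, and [a(grad u)] cannot be differentiated either. The difference [u(l x) - u(x)] can
    be tested with, but differentiating the tested equation in [l] would again call for second
    derivatives. Minimality avoids this: convexity gives one inequality, valid on both sides of
    [l = 1], and only the energy has to be differentiated. There the substitution moves [l] off the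
    point where [grad u] is evaluated, and homogeneity turns the density into
    [B (l * H (grad u y))], whose derivative at 1 is the term [B'(H) H] of the conclusion. The
    equation is given for smooth test functions, so mollification first extends it to C1 ones. In
    the final limit the factor [x] next to the gradient of [psi(x / k)] is harmless: that gradient
    carries [1 / k], and [|x| <= k] on the support. What remains is at most a multiple of
    [|grad u| |a(grad u)|], hence of [H B'(H)], and the doubling bound [t B'(t) <= C B(t)] controls
    it by the integrable [B(H)]. *)

Section rV_norm.
Context {R : realType} (n : nat).
Implicit Types x y : 'rV[R]_n.

Lemma coord_le_norm x i : `|x ord0 i| <= `|x|.
Proof.
rewrite [leRHS]/Num.norm /= mx_normrE; apply/bigmax_geP; right => /=.
by exists (ord0, i).
Qed.

Lemma norm_rV_le x e : 0 <= e -> (forall i, `|x ord0 i| <= e) -> `|x| <= e.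
Proof.
move=> e0 xe; rewrite [leLHS]/Num.norm /= mx_normrE; apply/bigmax_leP; split=> //.
by move=> [i j] _ /=; rewrite ord1.
Qed.

End rV_norm.

Section continuous_measurable.
Context {R : realType} (n : nat).

Let rnd k (x : 'rV[R]_n) : 'rV[R]_n :=
  \row_i ((Num.floor (k.+1%:R * x ord0 i))%:~R / k.+1%:R).

Let rnd_cvg x : rnd k x @[k --> \oo] --> x.
Proof.
apply/cvgrPdist_le => /= e e0; near=> k.
apply: norm_rV_le; first exact: ltW.
move=> i; rewrite !mxE.
set t := k.+1%:R * x ord0 i.
have -> : x ord0 i - (Num.floor t)%:~R / k.+1%:R =
    (t - (Num.floor t)%:~R) / k.+1%:R.
  by rewrite mulrBl /t mulrAC mulfV ?mul1r ?pnatr_eq0.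
have /andP[f1 f2] : (Num.floor t)%:~R <= t < (Num.floor t + 1)%:~R.
  by rewrite floor_le floorD1_gt.
rewrite ger0_norm; last by rewrite divr_ge0// subr_ge0.
apply: (@le_trans _ _ (k.+1%:R^-1)).
  by rewrite ler_pdivrMr ?ltr0n// mulVf ?pnatr_eq0// lerBlDl ltW//
    -[1 in X in _ + X]/(1%:~R) -intrD.
by apply: ltW; near: k; exact: (near_infty_natSinv_lt (PosNum e0)).
Unshelve. all: by end_near. Qed.

(* A continuous [f] is the pointwise limit of [f \o rnd k], and [rnd k] takes
   countably many values, each on a box. *)
Lemma continuous_rV_measurable (f : 'rV[R]_n -> R) :
  continuous f -> measurable_fun setT f.
Proof.
move=> cf; apply: (@measurable_fun_cvg _ _ _ _ (fun k => f \o rnd k)).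
  move=> k _ A mA; rewrite setTI.
  have -> : (f \o rnd k) @^-1` A =
      \bigcup_(z in [set z : 'rV[int]_n |
          A (f (\row_i ((z ord0 i)%:~R / k.+1%:R)))])
        \bigcap_(i in [set: 'I_n])
         ((fun x : 'rV[R]_n => x ord0 i : measurableTypeR R) @^-1`
           [set t : R | Num.floor (k.+1%:R * t) = z ord0 i]).
    apply/seteqP; split=> x /=.
      move=> Ax; exists (\row_i Num.floor (k.+1%:R * x ord0 i)) => /=.
        rewrite (_ : \row__ _ = rnd k x)//.
        by apply/rowP => i; rewrite !mxE.
      by move=> i _ /=; rewrite mxE.
    move=> [z /= Az xz]; rewrite (_ : rnd k x = \row_i ((z ord0 i)%:~R / k.+1%:R))//.
    by apply/rowP => i; rewrite !mxE (xz i).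
  rewrite bigcup_mkcond; apply: countable_bigcupT_measurable => // z.
  case: ifP => // _; apply: fin_bigcap_measurable => // i _.
  rewrite -[X in measurable X]setTI; apply: (measurable_coord i) => //.
  rewrite (_ : [set _ | _] =
    `[(z ord0 i)%:~R / k.+1%:R, ((z ord0 i + 1)%:~R) / k.+1%:R[%classic).
    exact: measurable_itv.
  apply/seteqP; split => t /=; rewrite in_itv/= ler_pdivrMr ?ltr0n//
      ltr_pdivlMr ?ltr0n// mulrC.
    by move=> <-; rewrite floor_le floorD1_gt.
  by move=> h; apply: floor_def.
by move=> x _; apply: (@cvg_comp _ _ _ (rnd ^~ x) f _ (nbhs x)); [exact: rnd_cvg|exact: cf].
Qed.

End continuous_measurable.

Section affine.
Context {R : realType}.
Implicit Types (l b : R).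
Local Open Scope ereal_scope.

Lemma measurable_affine l b :
  measurable_fun setT (fun a : measurableTypeR R => (l * a + b)%R : measurableTypeR R).
Proof. by apply: measurable_funD => //; apply: measurable_funM. Qed.

(** The measure [l] times the image of Lebesgue measure under [a |-> l a + b] gives every half-open
    interval its length, so by uniqueness it is Lebesgue measure. *)
Lemma ge0_integral_affine l b (f : measurableTypeR R -> \bar R) : (0 < l)%R ->
  measurable_fun setT f -> (forall x, 0 <= f x) ->
  l%:E * \int[@lebesgue_measure R]_a f (l * a + b)%R =
  \int[@lebesgue_measure R]_a f a.
Proof.
move=> l0 mf f0.
pose m1 := pushforward (@lebesgue_measure R)
  (fun a : measurableTypeR R => (l * a + b)%R : measurableTypeR R).
pose m : {measure set (measurableTypeR R) -> \bar R} :=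
  mscale (NngNum (ltW l0)) (measure_function_pushforward__canonical__measure_function_Measure
     (@lebesgue_measure R) (measurable_affine l b)).
have mE A : measurable A -> @lebesgue_measure R A = m A.
  apply: lebesgue_measure_unique => _ [[x y] _ <-] /=.
  rewrite /m /mscale /= /pushforward lebesgue_measure_itv/= lte_fin.
  have -> : (fun a : R => (l * a + b)%R) @^-1` `]x, y]%classic =
      `]((x - b) / l)%R, ((y - b) / l)%R]%classic.
    apply/seteqP; split => t /=; rewrite !in_itv/= ltr_pdivrMr// ler_pdivlMr//;
      rewrite ltrBlDr lerBrDr mulrC//.
  rewrite lebesgue_measure_itv/= lte_fin ltr_pM2r ?invr_gt0// ltrD2r.
  case: ifPn => xy; last by rewrite mule0.
  by rewrite -!EFinB -EFinM; congr EFin; field; rewrite gt_eqF.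
rewrite [RHS](eq_measure_integral m); last by move=> A mA _; exact: mE.
rewrite ge0_integral_mscale//= ge0_integral_pushforward//.
exact: measurable_affine.
Qed.

Lemma ge0_integral_rVS n (f : 'rV[R]_n.+1 -> \bar R) :
  measurable_fun setT f -> (forall x, 0 <= f x) ->
  \int[lebesgue_rV R n.+1]_x f x =
  \int[@lebesgue_measure R]_a \int[lebesgue_rV R n]_x f (rV_cons (a, x)).
Proof.
move=> mf f0.
rewrite (eq_measure_integral
  (measure_function_pushforward__canonical__measure_function_Measure
     (@lebesgue_measure R \x lebesgue_rV R n) (@measurable_rV_cons R n)))//.
rewrite (ge0_integral_pushforward (@measurable_rV_cons R n))//.
rewrite (@fubini_tonelli1 _ _ _ _ _ _ _ (f \o @rV_cons R n))//.
  exact: (measurableT_comp mf (@measurable_rV_cons R n)).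
by move=> x /=.
Qed.

Lemma measurable_rV_affine n l (b : 'rV[R]_n) :
  measurable_fun setT (fun x : 'rV[R]_n => l *: x + b)%R.
Proof.
apply: measurable_fun_rV => i; under eq_fun do rewrite !mxE.
by apply: measurable_funD => //; apply: measurable_funM => //; exact: measurable_coord.
Qed.

Lemma rV_cons_affine n l (b : 'rV[R]_n.+1) (a : R) x :
  (l *: rV_cons (a, x) + b = rV_cons
     ((l * a + b ord0 ord0)%R, l *: x + (rV_uncons b).2))%R.
Proof.
apply/rowP => i; rewrite [LHS]mxE [X in (X + _)%R]mxE; case: (unliftP ord0 i) => [j|] ->.
  by rewrite !rV_consS /= !mxE.
by rewrite !rV_cons0.
Qed.

(** Induction on [n] by Tonelli: the first coordinate contributes one factor [l], the remaining ones
    [l ^+ n]. *)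
Lemma ge0_integral_rV_affine n l (b : 'rV[R]_n) (f : 'rV[R]_n -> \bar R) :
  (0 < l)%R -> measurable_fun setT f -> (forall x, 0 <= f x) ->
  (l ^+ n)%:E * \int[lebesgue_rV R n]_x f (l *: x + b)%R =
  \int[lebesgue_rV R n]_x f x.
Proof.
move=> l0; elim: n b f => [|n IH] b f mf f0.
  by rewrite expr0 mul1e; apply: eq_integral => x _; congr f; apply/rowP => -[].
have mf' := measurableT_comp mf (@measurable_rV_affine n.+1 l b).
rewrite ge0_integral_rVS// ge0_integral_rVS//.
pose F (a : measurableTypeR R) := \int[lebesgue_rV R n]_x f (rV_cons (a, x)).
have mF : measurable_fun setT F.
  apply: (@measurable_fun_fubini_tonelli_F _ _ _ _ _ _ (f \o @rV_cons R n)) => //.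
    exact: (measurableT_comp mf (@measurable_rV_cons R n)).
  by move=> x /=.
rewrite -(@ge0_integral_affine l (b ord0 ord0) F)//; last first.
  by move=> x; exact: integral_ge0.
rewrite exprS EFinM -muleA; congr (_ * _).
rewrite -ge0_integralZl//; last 3 first.
- apply: (@measurable_fun_fubini_tonelli_F _ _ _ _ _ _
      ((f \o (fun x => l *: x + b)%R) \o @rV_cons R n)) => //.
    exact: (measurableT_comp mf' (@measurable_rV_cons R n)).
  by move=> x /=.
- by move=> x _; exact: integral_ge0.
- by rewrite lee_fin exprn_ge0// ltW.
apply: eq_integral => a _.
rewrite /F -[RHS](IH (rV_uncons b).2)//; last first.
  exact: (measurableT_comp mf (measurableT_comp (@measurable_rV_cons R n) (pair1_measurable _))).
congr (_ * _); apply: eq_integral => x _.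
by rewrite rV_cons_affine.
Qed.

End affine.

(** * Limits and derivatives of integrals over row vectors *)

Section integration.
Context {R : realType} (n : nat).
Local Notation mu := (lebesgue_rV R n).
Local Notation Int f := (Rintegral mu setT f).
Implicit Types (f g : 'rV[R]_n -> R).

(** One constant is both the bound and the radius of the box off which [f] vanishes, so that a
    single integrable function, depending on [M] alone, dominates a whole family. *)
Definition bbox (M : R) (f : 'rV[R]_n -> R) :=
  [/\ measurable_fun setT f, forall x, `|f x| <= M &
      forall x, M < `|x| -> f x = 0].

Let box (M : R) : set 'rV[R]_n := [set x | forall i, `[- M, M]%classic (x ord0 i)].

Let box_measurable M : measurable (box M).
Proof.
rewrite (_ : box M = \bigcap_(i in [set: 'I_n])
      ((fun x : 'rV[R]_n => x ord0 i : measurableTypeR R) @^-1` `[- M, M])).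
  apply: fin_bigcap_measurable => // i _.
  by rewrite -[X in measurable X]setTI; exact: measurable_coord.
by apply/seteqP; split => x xM i => [_|]; exact: xM.
Qed.

Let box_fin M : (mu (box M) < +oo)%E.
Proof.
rewrite (lebesgue_rV_box (A := fun=> `[- M, M]%classic))//.
rewrite lebesgue_measure_itv/=; case: ifPn => _.
  by rewrite -EFinB prodEFin ltry.
by apply: (@le_lt_trans _ _ (\prod_(i < n) (0%R)%:E)%E); rewrite // prodEFin ltry.
Qed.

Let boxN M x : ~ box M x -> M < `|x|.
Proof.
move=> xM; rewrite ltNge; apply/negP => xle; apply: xM => i /=.
by rewrite in_itv/= -ler_norml (le_trans (coord_le_norm _ _)).
Qed.

Let dom M : 'rV[R]_n -> R := (M \o* \1_(box M)).

Let dom_integrable M : mu.-integrable setT (EFin \o dom M).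
Proof.
rewrite (_ : _ \o _ = (fun x => M%:E * (EFin \o \1_(box M)) x)%E).
  apply: integrableZl => //; apply/integrableP; split.
    by apply/measurable_EFinP; exact: measurable_indic.
  under eq_integral do rewrite /= ger0_norm//.
  rewrite integral_indic// ?setIT; exact: box_fin.
by apply/funext => x /=; rewrite -EFinM mulrC.
Qed.

Lemma bbox_dom M f : bbox M f -> forall x, `|f x| <= dom M x.
Proof.
move=> [_ fM f0] x; rewrite /dom/= indicE; have [/set_mem xM|/negP xM] := boolP (x \in box M).
  by rewrite mul1r.
by rewrite mul0r f0 ?normr0//; apply: boxN => xM'; apply: xM; rewrite inE.
Qed.

Lemma bbox_ge0 M f : bbox M f -> 0 <= M.
Proof. by move=> [_ fM _]; exact: le_trans (fM 0). Qed.

Lemma bbox_integrable M f : bbox M f -> mu.-integrable setT (EFin \o f).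
Proof.
move=> bf; apply: (le_integrable measurableT _ _ (dom_integrable M)) => //=.
  by apply/measurable_EFinP; case: bf.
move=> x _; rewrite lee_fin (le_trans (bbox_dom bf x))//.
exact: ler_norm.
Qed.

Lemma Rintegral_dct (f_ : nat -> 'rV[R]_n -> R) f g :
  (forall k, measurable_fun setT (f_ k)) ->
  mu.-integrable setT (EFin \o g) ->
  (forall k x, `|f_ k x| <= g x) ->
  (forall x, f_ k x @[k --> \oo] --> f x) ->
  Int (f_ k) @[k --> \oo] --> Int f.
Proof.
move=> mf ig fg ff; apply: fine_cvg; rewrite fineK; last first.
  apply: integrable_fin_num => //.
  have mf' : measurable_fun setT f by apply: (measurable_fun_cvg mf) => x _; exact: ff.
  apply: (le_integrable measurableT _ _ ig) => /=; first exact/measurable_EFinP.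
  move=> x _; rewrite lee_fin; apply: (@le_trans _ _ (g x)); last exact: ler_norm.
  have fxn : `|f_ k x| @[k --> \oo] --> `|f x| by apply: cvg_norm; exact: ff.
  rewrite -(cvg_lim _ fxn)//; apply: limr_le; first exact: cvgP fxn.
  by near=> k; exact: fg.
apply: (@dominated_cvg _ _ _ mu _ _ (fun k x => (f_ k x)%:E) _ (EFin \o g)) => //=.
- by move=> k; exact/measurable_EFinP.
- by move=> x _; apply: cvg_EFin; [exact: nearW|exact: ff].
- by move=> k x _; rewrite lee_fin.
Unshelve. all: by end_near. Qed.

Lemma bbox_dct (f_ : nat -> 'rV[R]_n -> R) f M :
  (forall k, bbox M (f_ k)) ->
  (forall x, f_ k x @[k --> \oo] --> f x) ->
  Int (f_ k) @[k --> \oo] --> Int f.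
Proof.
move=> bf; apply: (@Rintegral_dct _ _ (dom M)) => //.
- by move=> k; case: (bf k).
- by move=> k; apply: bbox_dom.
Qed.

(** Differentiation under the integral sign. All the [k h] vanish off one box, hence so do their
    derivatives in [h], and [M] times the indicator of the box dominates them. *)
Lemma bbox_is_derive (k k' : R -> 'rV[R]_n -> R) (M a e : R) : 0 < e ->
  (forall h, `|h - a| < e -> bbox M (k h)) ->
  (forall h y, `|h - a| < e -> is_derive h 1 (k^~ y) (k' h y)) ->
  (forall h y, `|h - a| < e -> `|k' h y| <= M) ->
  is_derive a 1 (fun h => Int (k h)) (Int (k' a)).
Proof.
move=> e0 bk dk k'M.
have I h : `]a - e, a + e[%classic h -> `|h - a| < e.
  by rewrite /= in_itv/= ltr_distl.
have Ia : `]a - e, a + e[%classic a by rewrite /= in_itv/= ltrBlDr ltrDl e0.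
have intk h : `]a - e, a + e[%classic h -> mu.-integrable setT (EFin \o k h).
  by move=> /I /bk; exact: bbox_integrable.
have derk h y : `]a - e, a + e[%classic h -> setT y -> derivable (k^~ y) h 1.
  by move=> /I Ih _; have [] := dk h y Ih.
have domk h y : `]a - e, a + e[%classic h -> setT y ->
    `|lebesgue_integral_under.partial1of2 k h y| <= dom M y.
  move=> Ih _; rewrite lebesgue_integral_under.partial1of2E.
  have := dk h y (I _ Ih) => /@derive_val ->.
  rewrite /dom /= indicE; have [/set_mem xM|/negP xM] := boolP (y \in box M).
    by rewrite mul1r k'M//; exact: I.
  rewrite mul0r.
  have k0 : \forall z \near h, k z y = 0.
    have : \forall z \near h, `]a - e, a + e[%classic z.
      by apply: near_in_itvoo; rewrite inE.
    apply: filterS => z zI; have [_ _ kz] := bk z (I z zI).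
    by apply: kz; apply: boxN => yM; apply: xM; rewrite inE.
  have := dk h y (I _ Ih) => /@derive_val <-.
  have -> : 'D_1 (k^~ y) h = 'D_1 (cst 0) h by apply: near_eq_derive.
  by rewrite derive_cst normr0.
have dom0 y : 0 <= dom M y.
  rewrite /dom/= mulr_ge0//; apply: bbox_ge0 (bk a _).
  by rewrite subrr normr0.
have := @lebesgue_integral_under.derivable_under_integral R _ _ mu k setT measurableT a
  (a - e) (a + e) Ia intk derk _ dom0 (dom_integrable M) domk.
have := @lebesgue_integral_under.differentiation_under_integral R _ _ mu k setT measurableT a
  (a - e) (a + e) Ia intk derk _ dom0 (dom_integrable M) domk.
rewrite derive1E => kE dk'; apply: DeriveDef => //; rewrite kE.
apply: eq_Rintegral => y _; rewrite lebesgue_integral_under.partial1of2E.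
by apply: derive_val; apply: dk; rewrite subrr normr0.
Qed.

Lemma integrable_affine l (b : 'rV[R]_n) f : 0 < l ->
  mu.-integrable setT (EFin \o f) ->
  mu.-integrable setT (fun x => (f (l *: x + b))%:E).
Proof.
move=> l0 /integrableP[mf fo]; apply/integrableP; split.
  exact: (measurableT_comp mf (measurable_rV_affine l b)).
have abs_affine := @ge0_integral_rV_affine _ n l b (fun x => `|(EFin \o f) x|)%E l0.
(* Were the transformed integral infinite, so would be [l ^+ n] times it, which is the original
   integral. *)
rewrite ltey; apply/eqP => foo; move: fo; rewrite -abs_affine//.
  by rewrite foo gt0_muley ?ltxx// lte_fin exprn_gt0.
by apply: measurableT_comp.
Qed.

Lemma Rintegral_affine l (b : 'rV[R]_n) f : 0 < l ->
  mu.-integrable setT (EFin \o f) ->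
  Int (fun x => f (l *: x + b)) = (l ^+ n)^-1 * Int f.
Proof.
move=> l0 intf.
have ln : (0 < l ^+ n)%R by rewrite exprn_gt0.
have mf := measurable_int _ intf.
have intg := integrable_affine b l0 intf.
have posE : (\int[mu]_x (fun x => (f (l *: x + b))%:E)^\+ x =
    \int[mu]_x (EFin \o f)^\+ (l *: x + b)%R)%E.
  by apply: eq_integral => x _; rewrite !funeposE.
have negE : (\int[mu]_x (fun x => (f (l *: x + b))%:E)^\- x =
    \int[mu]_x (EFin \o f)^\- (l *: x + b)%R)%E.
  by apply: eq_integral => x _; rewrite !funenegE.
rewrite /Rintegral [in RHS]integralE [in LHS]integralE posE negE.
rewrite -(@ge0_integral_rV_affine _ n l b (EFin \o f)^\+%E l0)//; last first.
  exact: measurable_funepos.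
rewrite -(@ge0_integral_rV_affine _ n l b (EFin \o f)^\-%E l0)//; last first.
  exact: measurable_funeneg.
have := integrable_pos_fin_num measurableT intg; rewrite posE => pfin.
have := integrable_neg_fin_num measurableT intg; rewrite negE => nfin.
rewrite -muleBr//; last exact: fin_num_adde_defr.
rewrite fineM//; last by rewrite fin_numB pfin nfin.
by rewrite mulKf ?gt_eqF.
Qed.

End integration.

Lemma is_derive_line {R : realType} (V W : normedModType R) (f : V -> W) (x v : V)
    (t : R) (df : W) :
  is_derive (t *: v + x) v f df ->
  is_derive t (1 : R) (fun s : R => f (s *: v + x)) df.
Proof.
have E : (fun h : R => h^-1 *: ((f \o shift (t *: v + x)) (h *: v) - f (t *: v + x))) =
    (fun h : R => h^-1 *: (((fun s : R => f (s *: v + x)) \o shift t) (h *: 1) -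
       f (t *: v + x))).
  by apply/funext => h /=; rewrite [h%:A]mulr1 scalerDl addrA.
move=> [dfx dfv]; apply: DeriveDef.
  by move: dfx; rewrite /derivable E.
by rewrite -dfv /derive E.
Qed.

(** * C1 functions *)

Section C1.
Context {R : realType} (n : nat).
Implicit Types (f : 'rV[R]_n -> R) (x v h : 'rV[R]_n) (Om : set 'rV[R]_n).
Local Notation e_ i := (basis_rV i : 'rV[R]_n).

Lemma dir_rV_basis i : dir_rV (e_ i).
Proof. by exists i. Qed.

Lemma class_C1_derivable Om f x i : class_C (@dir_rV R n) 1 Om f -> Om x ->
  derivable f x (e_ i).
Proof. by move=> /(_ [::])[]// _ + Omx => /(_ isT _ _ (dir_rV_basis i) Omx). Qed.

Lemma class_C_continuous (V : normedModType R) (E : set V) k (Om' : set V) (f' : V -> R) (z : V) :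
  class_C E k Om' f' -> Om' z -> {for z, continuous f'}.
Proof. by move=> /(_ [::])[]// + _ => /(_ isT z). Qed.

Lemma class_C_continuous_derive (V : normedModType R) (E : set V) k (Om' : set V) (f' : V -> R) (z w : V) :
  class_C E k.+1 Om' f' -> E w -> Om' z -> {for z, continuous ('D_w f')}.
Proof.
move=> + Ev; have vE : forall w', w' \in [:: w] -> E w' by move=> w'; rewrite inE => /eqP ->.
by move=> /(_ [:: w] vE)[]/= + _ Omx; exact.
Qed.

Lemma class_C_derive (V : normedModType R) (E : set V) k (Om' : set V) (f' : V -> R) (w : V) :
  class_C E k.+1 Om' f' -> E w -> class_C E k Om' ('D_w f').
Proof.
move=> fC Ev s sE.
have := fC (rcons s w); case.
  by move=> w'; rewrite mem_rcons inE => /orP[/eqP ->//|/sE].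
by rewrite /iter_derive foldr_rcons size_rcons !ltnS.
Qed.

Lemma class_C_leq (V : normedModType R) (E : set V) k l (Om' : set V) (f' : V -> R) :
  (k <= l)%N -> class_C E l Om' f' -> class_C E k Om' f'.
Proof.
move=> kl fC s sE; have [f1 f2] := fC s sE.
by split => sk; [apply: f1|apply: f2]; exact: leq_trans sk kl.
Qed.

Lemma dotE x v : dot x v = \sum_i x ord0 i * v ord0 i. Proof. by []. Qed.

Let trunc (k : nat) h : 'rV[R]_n := \row_i (if (i < k)%N then h ord0 i else 0).

Let truncS (k : 'I_n) h : trunc k.+1 h = h ord0 k *: e_ k + trunc k h.
Proof.
apply/rowP => i; rewrite !mxE ltnS eqxx /=.
have [->|ik] := eqVneq i k; first by rewrite leqnn ltnn mulr1 addr0.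
by rewrite mulr0 add0r leq_eqVlt val_eqE (negbTE ik).
Qed.

(** The increment telescopes over the points [trunc k h + x], consecutive ones differing in a single
    coordinate; on each segment the mean value theorem produces a partial derivative, which is
    within [eps] of the one at [x]. *)
Lemma C1_increment f x (d : R) (eps : R) :
  (forall y, `|y - x| < d -> forall i, derivable f y (e_ i)) ->
  (forall y, `|y - x| < d -> forall i, `|'D_(e_ i) f y - 'D_(e_ i) f x| <= eps) ->
  forall h, `|h| < d ->
    `|f (h + x) - f x - dot (gradient f x) h| <= n%:R * eps * `|h|.
Proof.
move=> fd fe h hd.
(* In the sup norm neither truncating [h] nor shrinking a coordinate increases the norm, so every
   intermediate point stays within [d] of [x]. *)
have trn k (t : R) : `|t| <= `|h| -> forall i : 'I_n, i = k :> nat ->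
    `|t *: e_ i + trunc k h| <= `|h|.
  move=> th i ik; apply: norm_rV_le => // j; rewrite !mxE eqxx /=.
  have [->|ji] := eqVneq j i; first by rewrite ik ltnn mulr1 addr0.
  by rewrite mulr0 add0r; case: ifP => _; rewrite ?normr0 ?coord_le_norm.
have -> : f (h + x) - f x = \sum_(k < n) (f (trunc k.+1 h + x) - f (trunc k h + x)).
  rewrite -(big_mkord xpredT (fun k => f (trunc k.+1 h + x) - f (trunc k h + x))).
  rewrite telescope_sumr//; congr (f (_ + _) - f _).
    by apply/rowP => i; rewrite mxE ltn_ord.
  by apply/rowP => i; rewrite !mxE add0r.
rewrite dotE -sumrB (le_trans (ler_norm_sum _ _ _))//.
apply: (@le_trans _ _ (\sum_(k < n) eps * `|h|)); last first.
  by rewrite sumr_const card_ord -[leLHS]mulr_natl mulrA.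
apply: ler_sum => k _; rewrite mxE.
pose p (t : R) := f (t *: e_ k + (trunc k h + x)).
have pd (t : R) : `|t| <= `|h| -> is_derive t (1 : R) p ('D_(e_ k) f (t *: e_ k + (trunc k h + x))).
  move=> th; apply: (is_derive_line (x := trunc k h + x)); apply: derivableP.
  by apply: fd; rewrite addrA addrK (le_lt_trans _ hd)// trn.
have pT : f (trunc k.+1 h + x) = p (h ord0 k) by rewrite truncS /p addrA.
have p0 : f (trunc k h + x) = p 0 by rewrite /p scale0r add0r.
have hk := coord_le_norm h k; rewrite pT p0 {pT p0}.
have [c ch ->] : exists2 c, `|c| <= `|h| & p (h ord0 k) - p 0 =
    'D_(e_ k) f (c *: e_ k + (trunc k h + x)) * h ord0 k.
  have [h0|h0] := leP 0 (h ord0 k).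
    have [t||c] := @MVT_segment R p (fun t : R => 'D_(e_ k) f (t *: e_ k + (trunc k h + x))) 0 (h ord0 k) h0.
    - rewrite in_itv/= => /andP[t0 t1]; apply: pd.
      by rewrite ger0_norm ?(ltW t0)// (le_trans (ltW t1))// (le_trans _ hk)// ler_norm.
    - apply: derivable_within_continuous => t; rewrite in_itv/= => /andP[t0 t1].
      have := pd t => -[]//.
      by rewrite ger0_norm// (le_trans t1)// (le_trans _ hk)// ler_norm.
    rewrite in_itv/= subr0 => /andP[c0 c1] ->; exists c => //.
    by rewrite ger0_norm// (le_trans c1)// (le_trans _ hk)// ler_norm.
  have [t||c] := @MVT_segment R p (fun t : R => 'D_(e_ k) f (t *: e_ k + (trunc k h + x))) (h ord0 k) 0 (ltW h0).
  - rewrite in_itv/= => /andP[t0 t1]; apply: pd.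
    by rewrite ltr0_norm// (le_trans _ hk)// ltr0_norm// lerN2 ltW.
  - apply: derivable_within_continuous => t; rewrite in_itv/= => /andP[t0 t1].
    have := pd t => -[]//.
    by rewrite ler0_norm// (le_trans _ hk)// ltr0_norm// lerN2.
  rewrite in_itv/= sub0r => /andP[c0 c1] pE; exists c.
    by rewrite ler0_norm// (le_trans _ hk)// ltr0_norm// lerN2.
  by rewrite -opprB pE mulrN opprK.
have ck : `|c *: e_ k + (trunc k h + x) - x| < d.
  by rewrite addrA addrK (le_lt_trans _ hd)// trn.
rewrite -mulrBl normrM.
by apply: ler_pM => //; exact: fe.
Qed.

Lemma dot_linear x : linear (dot x).
Proof.
move=> a v w; rewrite /dot scaler_sumr -big_split; apply: eq_bigr => i _ /=.
by rewrite !mxE mulrDr /GRing.scale/= mulrCA.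
Qed.

Lemma dot_continuous x : continuous (dot x).
Proof.
rewrite /dot; apply: continuous_big => [|i _]; first exact: add_continuous.
by move=> v; apply: continuousM; [exact: cst_continuous|exact: coord_continuous].
Qed.

Lemma C1_is_diff Om f x : open Om -> class_C (@dir_rV R n) 1 Om f -> Om x ->
  is_diff x f (dot (gradient f x)).
Proof.
move=> oOm fC Omx.
pose lind := GRing.isLinear.Build _ _ _ _ _ (dot_linear (gradient f x)).
pose df : {linear _ -> _} := HB.pack (dot (gradient f x)) lind.
have fo : (f : 'rV[R]_n -> R^o) \o shift x =
    cst (f x : R^o) + (df : 'rV[R]_n -> R^o) +o_ (0 : 'rV[R]_n) id.
  apply/eqaddoP => _/posnumP[eps].
  (* [C1_increment] loses a factor [n]; dividing by [n.+1] absorbs it, including for [n = 0]. *)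
  have e0 : 0 < eps%:num / n.+1%:R by rewrite divr_gt0.
  have : \forall y \near x, Om y /\ forall i, `|'D_(e_ i) f y - 'D_(e_ i) f x| <= eps%:num / n.+1%:R.
    apply: filterI; first exact: open_nbhs_nbhs.
    apply: (filter_forall (nbhs_filter x)) => i.
    have := class_C_continuous_derive fC (dir_rV_basis i) Omx.
    move=> /cvgrPdist_le/(_ _ e0); apply: filterS => y.
    by rewrite distrC.
  move=> /nbhs_ballP[d /= d0 dP].
  apply/nbhs_ballP; exists d => //= h; rewrite -ball_normE/= sub0r normrN => hd.
  have xd (y : 'rV[R]_n) : `|y - x| < d -> ball x d y.
    by rewrite -ball_normE/= distrC.
  have := @C1_increment f x d (eps%:num / n.+1%:R)
     (fun y yd i => class_C1_derivable fC (dP y (xd y yd)).1)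
     (fun y yd i => (dP y (xd y yd)).2 i) h hd.
  rewrite -![(_ + _ : _ -> _) _]/(_ + _) -![(- _ : _ -> _) _]/(- _) /cst/=.
  rewrite opprD addrA => /le_trans; apply.
  rewrite ler_wpM2r// mulrCA ler_piMr// ler_pdivrMr ?ltr0n// mul1r ler_nat//.
have dfE : 'd f x = df :> ('rV[R]_n -> R).
  by apply: diff_unique => //; exact: dot_continuous.
apply: DiffDef; last by rewrite dfE.
by apply/diff_locallyP; rewrite dfE; split => //; exact: dot_continuous.
Qed.

End C1.

Lemma is_derive_curve {R : realType} (V W : normedModType R) (f : V -> W) df
    (c : R -> V) (t : R) (c' : V) :
  is_derive t (1 : R) c c' -> is_diff (c t) f df -> is_derive t (1 : R) (f \o c) (df c').
Proof.
move=> [dc <-] [dif <-]; have dc' := dc; move/derivable1_diffP in dc'.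
have dfc := differentiable_comp dc' dif.
apply: DeriveDef; first exact/derivable1_diffP.
by rewrite deriveE// diff_comp//= deriveE.
Qed.

Lemma C1_is_derive_curve {R : realType} n (Om : set 'rV[R]_n) (f : 'rV[R]_n -> R)
   (c : R -> 'rV[R]_n) (t : R) c' :
  open Om -> class_C (@dir_rV R n) 1 Om f -> Om (c t) ->
  is_derive t (1 : R) c c' ->
  is_derive t (1 : R) (f \o c) (dot (gradient f (c t)) c').
Proof. by move=> oOm fC Omct dc; apply: is_derive_curve => //; exact: C1_is_diff Omct. Qed.

Section is_derive1.
Context {R : realType}.
Implicit Types (f g : R -> R).

Lemma is_derive1M f g x df dg : is_derive x (1 : R) f df -> is_derive x (1 : R) g dg ->
  is_derive x (1 : R) (fun y => f y * g y) (df * g x + f x * dg).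
Proof.
move=> fd gd; have [fgd fgv] := is_deriveM fd gd.
apply: DeriveDef; first exact: fgd.
by rewrite [LHS]fgv addrC; congr (_ + _); rewrite /GRing.scale/= mulrC.
Qed.

Lemma is_derive1D f g x df dg : is_derive x (1 : R) f df -> is_derive x (1 : R) g dg ->
  is_derive x (1 : R) (fun y => f y + g y) (df + dg).
Proof.
by move=> fd gd; have [fgd fgv] := is_deriveD fd gd; apply: DeriveDef.
Qed.

Lemma is_derive1B f g x df dg : is_derive x (1 : R) f df -> is_derive x (1 : R) g dg ->
  is_derive x (1 : R) (fun y => f y - g y) (df - dg).
Proof.
by move=> fd gd; have [fgd fgv] := is_deriveB fd gd; apply: DeriveDef.
Qed.

Lemma is_derive1Ml f x df (c : R) : is_derive x (1 : R) f df ->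
  is_derive x (1 : R) (fun y => c * f y) (c * df).
Proof.
by move=> fd; have [fgd fgv] := is_deriveZ c fd; apply: DeriveDef.
Qed.

Lemma is_derive1_ext f g x df : f =1 g ->
  is_derive x (1 : R) f df -> is_derive x (1 : R) g df.
Proof. by move=> /funext ->. Qed.

Lemma is_derive1_chain f g x df dg : is_derive (g x) (1 : R) f df ->
  is_derive x (1 : R) g dg -> is_derive x (1 : R) (fun y => f (g y)) (df * dg).
Proof.
by move=> fd gd; have := is_derive1_comp fd gd; rewrite /GRing.scale/= mulrC.
Qed.

End is_derive1.

(** * Cutoffs and mollification *)

Section smooth.
Context {R : realType}.
Implicit Types (f g : R -> R).

(** Continuity of the last derivative is left out; for [smooth] it follows from the next order. *)
Fixpoint Ck k (f : R -> R) : Prop :=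
  if k is k'.+1 then (forall x, derivable f x 1) /\ Ck k' f^`()%classic else True.

Definition smooth f := forall k, Ck k f.

Lemma Ck_pred k f : Ck k.+1 f -> Ck k f.
Proof. by elim: k f => //= k IH f [df /IH]. Qed.

Lemma is_derive_derive1 f (df : R -> R) :
  (forall x, is_derive x (1 : R) f (df x)) -> f^`()%classic = df.
Proof. by move=> dfE; apply/funext => x; rewrite derive1E; apply: derive_val. Qed.

Lemma CkS k f (df : R -> R) :
  (forall x, is_derive x (1 : R) f (df x)) -> Ck k df -> Ck k.+1 f.
Proof. by move=> fd; split; [move=> x; case: (fd x)|rewrite (is_derive_derive1 fd)]. Qed.

Lemma derivable_is_derive1 f x : derivable f x 1 -> is_derive x (1 : R) f (f^`()%classic x).
Proof. by move=> df; apply: DeriveDef; rewrite ?derive1E. Qed.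

Lemma CkD k f g : Ck k f -> Ck k g -> Ck k (fun x => f x + g x).
Proof.
elim: k f g => //= k IH f g [df fk] [dg gk].
apply: (@CkS k _ (fun x => f^`()%classic x + g^`()%classic x)); last exact: IH.
by move=> x; apply: is_deriveD; apply: derivable_is_derive1.
Qed.

Lemma CkM k f g : Ck k f -> Ck k g -> Ck k (fun x => f x * g x).
Proof.
elim: k f g => // k IH f g fk gk.
have [df f'k] := fk; have [dg g'k] := gk.
apply: (@CkS k (fun x => f x * g x)
    (fun x => f^`()%classic x * g x + f x * g^`()%classic x)).
  by move=> x; apply: is_derive1M; exact: derivable_is_derive1.
by apply: CkD; apply: IH => //; exact: Ck_pred.
Qed.

Lemma Ck_cst k (c : R) : Ck k (fun=> c).
Proof.
elim: k c => // k IH c; apply: (@CkS k _ (fun=> 0)); last exact: IH.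
Qed.

Lemma is_derive_affine f df (a b x : R) : is_derive (b * x + a) (1 : R) f df ->
  is_derive x (1 : R) (fun x => f (b * x + a)) (b * df).
Proof.
move=> fd.
have ad : is_derive x (1 : R) (fun x : R => b * x + a) b.
  have := is_derive1D (is_derive1Ml b (is_derive_id x (1 : R))) (is_derive_cst a x (1 : R)).
  by rewrite mulr1 addr0.
by rewrite mulrC; apply: is_derive1_chain ad.
Qed.

Lemma Ck_affine k f (a b : R) : Ck k f -> Ck k (fun x => f (b * x + a)).
Proof.
elim: k f => // k IH f [df fk].
apply: (@CkS k _ (fun x => b * f^`()%classic (b * x + a))).
  by move=> x; apply: is_derive_affine; exact: derivable_is_derive1.
by apply: CkM; [exact: Ck_cst|exact: IH].
Qed.

Lemma smooth_is_derive f : smooth f -> forall x, is_derive x (1 : R) f (f^`()%classic x).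
Proof. by move=> fs x; apply: derivable_is_derive1; case: (fs 1%N). Qed.

Lemma smooth_derive1 f : smooth f -> smooth f^`()%classic.
Proof. by move=> fs k; have [] := fs k.+1. Qed.

Lemma smooth_continuous f : smooth f -> continuous f.
Proof.
move=> fs x; apply: differentiable_continuous; apply/derivable1_diffP.
by case: (smooth_is_derive fs x).
Qed.

(* This family contains [exp (- 1 / x)] and is stable under differentiation. *)
Definition flat (p : {poly R}) (x : R) : R :=
  if 0 < x then p.[x^-1] * expR (- x^-1) else 0.

(** Termwise, since [t ^+ i / i!] is one term of the exponential series. *)
Lemma poly_le_expR (p : {poly R}) : exists2 C : R, 0 <= C &
  forall t, 0 <= t -> `|p.[t]| <= C * expR t.
Proof.
exists (\sum_(i < size p) `|p`_i| * i`!%:R).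
  by apply: sumr_ge0 => i _; apply: mulr_ge0.
move=> t t0; rewrite horner_coef (le_trans (ler_norm_sum _ _ _))// mulr_suml.
apply: ler_sum => i _; rewrite normrM -mulrA ler_wpM2l// ger0_norm ?exprn_ge0//.
case: (nat_of_ord i) => [|m]; first by rewrite expr0 fact0 mul1r -expR0 ler_expR.
rewrite mulrC -ler_pdivrMr ?ltr0n ?fact_gt0//.
by rewrite (le_trans _ (expR_ge1Dxn m t0))// lerDr.
Qed.

(** Quadratic decay at 0 makes the function derivable there. The bound is [poly_le_expR] for
    [p * 'X^2] at [x^-1], the extra square giving the decay. *)
Lemma flat_small p : exists C : R, forall x, `|flat p x| <= C * x ^+ 2.
Proof.
have [C C0 pC] := poly_le_expR (p * 'X^2).
exists C => x; rewrite /flat; case: ifPn => x0; last first.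
  by rewrite normr0 mulr_ge0// sqr_ge0.
have := pC x^-1; rewrite invr_ge0 (ltW x0) => /(_ isT).
rewrite hornerM hornerXn normrM [X in _ * X <= _]ger0_norm; last first.
  by rewrite exprn_ge0// invr_ge0 ltW.
rewrite exprVn ler_pdivrMr ?exprn_gt0// => pE.
rewrite normrM (ger0_norm (expR_ge0 _)) expRN.
by rewrite ler_pdivrMr ?expR_gt0// mulrAC.
Qed.

Lemma is_derive_small f (C : R) : (forall x, `|f x| <= C * x ^+ 2) ->
  is_derive (0 : R) (1 : R) f 0.
Proof.
move=> fC.
have f0 : f 0 = 0 by apply/normr0_eq0/eqP; rewrite eq_le normr_ge0 andbT
  (le_trans (fC 0))// expr0n mulr0.
have C0 : 0 <= C by have := fC 1; rewrite expr1n mulr1; apply: le_trans.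
have H : h^-1 *: ((f \o shift 0) (h *: 1) - f 0) @[h --> (0:R)^'] --> (0 : R).
  apply/cvgrPdist_le => e e0.
  have C1 : 0 < C + 1 by rewrite ltr_wpDl.
  exists (e / (C + 1)) => /=; first by rewrite divr_gt0.
  move=> h /=; rewrite sub0r normrN => he h0.
  rewrite f0 subr0 addr0 [h%:A]mulr1 sub0r normrN normrM normfV.
  rewrite ler_pdivrMl ?normr_gt0// (le_trans (fC h))//.
  rewrite -normr_id -[h ^+ 2]ger0_norm ?sqr_ge0// normrX expr2 mulrCA.
  rewrite normr_id ler_wpM2l//.
  move: he; rewrite ltr_pdivlMr// => /ltW; apply: le_trans.
  by rewrite mulrC ler_wpM2l// lerDl.
by apply: DeriveDef; [exact: cvgP H|exact: cvg_lim H].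
Qed.

(** With [t = x^-1], whose derivative is [- t^2], the derivative of [p(t) exp(- t)] is
    [(p(t) - p'(t)) t^2 exp(- t)]; this is where the new polynomial comes from. *)
Lemma flat_is_derive p x :
  is_derive x (1 : R) (flat p) (flat ((p - p^`()) * 'X^2) x).
Proof.
have [x0|x0|->] := ltgtP x 0.
- have -> : flat ((p - p^`()) * 'X^2) x = 0 by rewrite /flat ltNge ltW.
  apply: (near_eq_is_derive (f := cst 0)).
  have : \forall y \near x, y < 0 by exact: lt_nbhsl.
  by apply: filterS => y y0; rewrite /flat ltNge ltW.
- have xn0 : x != 0 by rewrite gt_eqF.
  have d1 : is_derive x (1 : R) (fun x : R => x^-1) (- x ^- 2).
    have [dv ev] := @is_deriveV R (@idfun R) x 1 1 xn0 (is_derive_id _ _).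
    by apply: DeriveDef => //; rewrite [LHS]ev /= [_%:A]mulr1.
  have d2 : is_derive x (1 : R) (fun x : R => p.[x^-1]) (p^`().[x^-1] * - x ^- 2).
    by apply: is_derive1_chain d1; exact: is_derive_poly.
  have d3 : is_derive x (1 : R) (fun x : R => expR (- x^-1))
      (expR (- x^-1) * (-1 * - x ^- 2)).
    have nd : is_derive x (1 : R) (fun x : R => - x^-1) (-1 * - x ^- 2).
      by apply: is_derive1_ext (is_derive1Ml (-1) d1) => y; rewrite mulN1r.
    by apply: is_derive1_chain nd; exact: is_derive_expR.
  have d4 := is_derive1M d2 d3.
  have -> : flat ((p - p^`()) * 'X^2) x = p^`().[x^-1] * - x ^- 2 * expR (- x^-1) +
      p.[x^-1] * (expR (- x^-1) * (-1 * - x ^- 2)).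
    by rewrite /flat x0 hornerM hornerXn hornerD hornerN exprVn; ring.
  apply: near_eq_is_derive d4.
  have : \forall y \near x, 0 < y by exact: lt_nbhsr.
  by apply: filterS => y y0; rewrite /flat y0.
- have -> : flat ((p - p^`()) * 'X^2) 0 = 0 by rewrite /flat ltxx.
  by have [C] := flat_small p; exact: is_derive_small.
Qed.

Lemma smooth_flat p : smooth (flat p).
Proof. by move=> k; elim: k p => // k IH p; apply: CkS (IH _) => x; exact: flat_is_derive. Qed.

(** Positive exactly on the open interval from -1 to 1. The coefficients [1] and [-1] are spelled
    out to match [Ck_affine]. *)
Definition bump_fun (x : R) := flat 1 (1 * x + 1) * flat 1 ((-1) * x + 1).

Lemma smooth_bump : smooth bump_fun.
Proof. by move=> k; apply: CkM; apply: Ck_affine; exact: smooth_flat. Qed.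

Lemma flat1_ge0 x : 0 <= flat 1 x.
Proof. by rewrite /flat hornerC mul1r; case: ifP => // _; exact: expR_ge0. Qed.

Lemma bump_ge0 x : 0 <= bump_fun x.
Proof. by apply: mulr_ge0; exact: flat1_ge0. Qed.

Lemma bump_out x : 1 < `|x| -> bump_fun x = 0.
Proof.
rewrite lter_normr => /orP[x1|x1]; rewrite /bump_fun /flat.
  by rewrite [X in _ * X](_ : _ = 0) ?mulr0//; case: ifPn => // ?; lra.
by rewrite [X in X * _](_ : _ = 0) ?mul0r//; case: ifPn => // ?; lra.
Qed.

(** Both arguments of [flat 1] are at least 1/2 there, so each factor is at least [expR (- 2)]. This
    gives the mollifier a positive integral and the cutoff a positive value at 0. *)
Lemma bump_in : exists2 d : R, 0 < d & forall x, `|x| <= 2^-1 -> d <= bump_fun x.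
Proof.
exists (expR (- 2) * expR (- 2)); first by rewrite mulr_gt0// expR_gt0.
move=> x; rewrite ler_norml => /andP[x1 x2].
have H (y : R) : 2^-1 <= y -> expR (- 2) <= flat 1 y.
  move=> y2; have y0 : 0 < y by lra.
  rewrite /flat y0 hornerC mul1r ler_expR lerN2.
  by rewrite -[leRHS]invrK lef_pV2// posrE ?invr_gt0.
by rewrite /bump_fun; apply: ler_pM; rewrite ?expR_ge0//; apply: H; lra.
Qed.

End smooth.

Lemma is_derive_lineP {R : realType} (V W : normedModType R) (f : V -> W) (x v : V) (df : W) :
  is_derive (0 : R) (1 : R) (fun s : R => f (s *: v + x)) df -> is_derive x v f df.
Proof.
have E : (fun h : R => h^-1 *: ((f \o shift x) (h *: v) - f x)) =
    (fun h : R => h^-1 *: (((fun s : R => f (s *: v + x)) \o shift 0) (h *: 1) -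
       f (0 *: v + x))).
  by apply/funext => h /=; rewrite [h%:A]mulr1 addr0 scale0r add0r.
move=> [dfx dfv]; apply: DeriveDef.
  by move: dfx; rewrite /derivable -E.
by rewrite -dfv /derive -E.
Qed.

Section rV_topology.
Context {R : realType} (n : nat).

Lemma continuous_bounded_ball (f : 'rV[R]_n -> R) (r : R) : continuous f ->
  exists2 C, 0 <= C & forall x, `|x| <= r -> `|f x| <= C.
Proof.
move=> cf.
pose B := [set x : 'rV[R]_n | forall i, `[- r, r]%classic (x ord0 i)].
have Bc : compact B.
  by apply: (@rV_compact R n (fun=> `[- r, r]%classic)) => _; exact: segment_compact.
have [C [Creal CP]] : bounded_set (f @` B).
  by apply: compact_bounded; apply: continuous_compact => //; exact: continuous_subspaceT.
exists (`|C| + 1); first by rewrite addr_ge0.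
move=> x xr; apply: (CP (`|C| + 1)); first by rewrite (le_lt_trans (ler_norm C))// ltrDl.
exists x => // i /=; rewrite in_itv/= -ler_norml.
exact: le_trans (coord_le_norm _ _) xr.
Qed.

(** Lets dominated convergence, a statement about sequences, prove the continuity of integrals
    depending on a parameter. *)
Lemma seq_continuous (f : 'rV[R]_n -> R) x :
  (forall u : nat -> 'rV[R]_n, (forall k, `|u k - x| <= k.+1%:R^-1) ->
     f (u k) @[k --> \oo] --> f x) -> {for x, continuous f}.
Proof.
move=> fx; apply/(@cvgrPdist_le _ _ _ _ (nbhs_filter x)) => e e0; apply: contrapT => nf.
have /choice[u uP] : forall k : nat, exists y : 'rV[R]_n,
    `|y - x| <= k.+1%:R^-1 /\ ~ `|f x - f y| <= e.
  move=> k; apply: contrapT => ny; apply: nf; apply/nbhs_ballP.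
  exists k.+1%:R^-1 => //=.
  move=> y; rewrite -ball_normE/= distrC => yx; apply: contrapT => fy; apply: ny.
  by exists y; split => //; exact: ltW.
have /cvgrPdist_le/(_ _ e0)[k _ kP] := fx u (fun k => (uP k).1).
by have := kP k (leqnn k); exact: (uP k).2.
Qed.

Lemma bboxW (M M' : R) (f : 'rV[R]_n -> R) : M <= M' -> bbox M f -> bbox M' f.
Proof.
move=> MM' [mf fM f0]; split => // x; first exact: le_trans MM'.
by move=> /(le_lt_trans MM'); exact: f0.
Qed.

Lemma continuous_bbox (f : 'rV[R]_n -> R) (r : R) : continuous f ->
  (forall x, r < `|x| -> f x = 0) -> exists M, bbox M f.
Proof.
move=> cf f0; have [C C0 fC] := continuous_bounded_ball r cf.
exists (Num.max C r); split; first exact: continuous_rV_measurable.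
  move=> x; have [xr|xr] := leP `|x| r; first by rewrite le_max fC.
  by rewrite f0// normr0 le_max C0.
by move=> x; rewrite gt_max => /andP[_]; exact: f0.
Qed.

End rV_topology.

Section tensor.
Context {R : realType} (n : nat).
Local Notation e_ i := (basis_rV i : 'rV[R]_n).

(** A partial derivative of a product of one-variable functions replaces a single factor, so
    smoothness in several variables reduces to smoothness in one. *)
Definition tens (eta : 'I_n -> R -> R) (x : 'rV[R]_n) : R :=
  \prod_i eta i (x ord0 i).

Definition tens_upd (eta : 'I_n -> R -> R) (j : 'I_n) (h : R -> R) : 'I_n -> R -> R :=
  fun i => if i == j then h else eta i.

Lemma tens_continuous eta : (forall i, continuous (eta i)) -> continuous (tens eta).
Proof.
move=> ce; apply: continuous_big => [|i _]; first exact: mul_continuous.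
move=> x; apply: (@continuous_comp _ _ _ (fun x : 'rV[R]_n => x ord0 i) (eta i)).
  exact: coord_continuous.
exact: ce.
Qed.

Lemma tens_is_derive eta j (h : R -> R) x :
  (forall t, is_derive t (1 : R) (eta j) (h t)) ->
  is_derive x (e_ j) (tens eta) (tens (tens_upd eta j h) x).
Proof.
move=> dh; apply: is_derive_lineP.
have -> : (fun s : R => tens eta (s *: e_ j + x)) =
    (fun s => \prod_(i | i != j) eta i (x ord0 i) * eta j (1 * s + x ord0 j)).
  apply/funext => s; rewrite /tens (bigD1 j)//= mulrC; congr (_ * _).
    apply: eq_bigr => i ij; congr (eta i _).
    by rewrite !mxE (negbTE ij) andbF mulr0 add0r.
  by rewrite !mxE !eqxx mulr1 mul1r.
have -> : tens (tens_upd eta j h) x =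
   \prod_(i | i != j) eta i (x ord0 i) * (1 * h (1 * 0 + x ord0 j)).
  rewrite /tens (bigD1 j)//= mulrC; congr (_ * _).
    by apply: eq_bigr => i ij; rewrite /tens_upd (negbTE ij).
  by rewrite /tens_upd eqxx mulr0 add0r mul1r.
by apply: is_derive1Ml; apply: is_derive_affine.
Qed.

Lemma tens_bump_out x : 1 < `|x| -> tens (fun=> bump_fun) x = 0.
Proof.
move=> x1; apply: contraTeq x1 => x0; rewrite -leNgt; apply: norm_rV_le => // i.
rewrite leNgt; apply: contra x0 => xi; apply/eqP.
by rewrite /tens (bigD1 i)//= bump_out// mul0r.
Qed.

End tensor.

(** Avoids writing out iterated derivatives: it is enough to place [f] in a family of continuous
    functions that is stable under differentiation along [E]. *)
Lemma class_C_family {R : realType} (V : normedModType R) (E : set V) (P : (V -> R) -> Prop) :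
  (forall f, P f -> continuous f) ->
  (forall f v, P f -> E v -> (forall x, derivable f x v) /\ P ('D_v f)) ->
  forall k f, P f -> class_C E k setT f.
Proof.
move=> Pc Pd k f Pf s.
have Ps : (forall v, v \in s -> E v) -> P (iter_derive s f).
  elim: s => //= v s IH vsE; apply: (Pd _ v _ _).2.
    by apply: IH => w ws; apply: vsE; rewrite inE ws orbT.
  by apply: vsE; rewrite inE eqxx.
move=> sE; split => [_ x _|_ v x Ev _]; first exact: Pc (Ps sE) x.
exact: (Pd _ v (Ps sE) Ev).1.
Qed.

(** * Mollification and C1 test functions *)

Section mollification.
Context {R : realType} (n : nat).
Local Notation e_ i := (basis_rV i : 'rV[R]_n).
Local Notation mu := (lebesgue_rV R n).
Local Notation Int f := (Rintegral mu setT f).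
Implicit Types (tau phi : 'rV[R]_n -> R) (x y z : 'rV[R]_n) (eta : 'I_n -> R -> R).

Lemma near_norm_gt (r : R) x : r < `|x| -> \forall y \near x, r < `|y|.
Proof.
move=> rx; apply/nbhs_ballP; exists (`|x| - r) => /=; first by rewrite subr_gt0.
move=> y; rewrite -ball_normE/= => xy.
have h := lerB_dist x y.
by move: xy h; lra.
Qed.

Section convolution.
Variables (eps r : R) (phi : 'rV[R]_n -> R).
Hypotheses (eps0 : 0 < eps) (cphi : continuous phi) (phi0 : forall x, r < `|x| -> phi x = 0).

(** The variable [x] occurs only in the kernel, which therefore receives all derivatives, each with
    a factor [- eps^-1]. The normalising power of [eps] is left to [moll_conv]. *)
Definition conv (tau : 'rV[R]_n -> R) (x : 'rV[R]_n) : R :=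
  Int (fun y => tau (eps^-1 *: (y - x)) * phi y).

Let conv_bbox tau x : continuous tau -> exists M, forall z, `|z - x| <= 1 ->
  bbox M (fun y => tau (eps^-1 *: (y - z)) * phi y).
Proof.
move=> ctau.
(* For [|y| <= r] and [|z - x| <= 1], the argument [eps^-1 *: (y - z)] has norm at most this
   radius. *)
have [C1 C10 tauC] := continuous_bounded_ball (eps^-1 * (`|r| + `|x| + 1)) ctau.
have [C2 C20 phiC] := continuous_bounded_ball r cphi.
exists (Num.max (C1 * C2) r) => z zx; split.
- apply: continuous_rV_measurable => y; apply: continuousM; last exact: cphi.
  apply: (@continuous_comp _ _ _ (fun y => eps^-1 *: (y - z)) tau); last exact: ctau.
  by apply: continuousZr; apply: continuousB => //; exact: cst_continuous.
- move=> y; have [yr|yr] := leP `|y| r; last first.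
    by rewrite phi0// mulr0 normr0 le_max mulr_ge0.
  rewrite le_max normrM ler_pM// ?phiC// tauC// normrZ ger0_norm ?invr_ge0 ?(ltW eps0)//.
  rewrite ler_pM2l ?invr_gt0// (le_trans (ler_normB _ _))// -addrA lerD//.
    by rewrite (le_trans yr)// ler_norm.
  by rewrite -[z](subrK x) (le_trans (ler_normD _ _))// addrC lerD.
- by move=> y; rewrite gt_max => /andP[_ ?]; rewrite phi0// mulr0.
Qed.

Lemma conv_continuous tau : continuous tau -> continuous (conv tau).
Proof.
move=> ctau x; apply: seq_continuous => u ux.
have [M bM] := conv_bbox x ctau.
apply: (@bbox_dct _ _ _ _ M).
  move=> k; apply: bM; rewrite (le_trans (ux k))// invf_le1// ?ltr0n//.
  by rewrite ler1n.
move=> y; apply: cvgM; last exact: cvg_cst.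
have ucvg : u k @[k --> \oo] --> x.
  apply/cvgrPdist_le => e e0; near=> k; rewrite distrC (le_trans (ux k))//.
  by apply: ltW; near: k; exact: (near_infty_natSinv_lt (PosNum e0)).
apply: (@cvg_comp _ _ _ (fun k => eps^-1 *: (y - u k)) tau _ (nbhs (eps^-1 *: (y - x)))).
  by apply: cvgZl_tmp; apply: cvgB => //; exact: cvg_cst.
exact: ctau.
Unshelve. all: by end_near. Qed.

Lemma conv_is_derive eta j x : (forall i, smooth (eta i)) ->
  is_derive x (e_ j) (conv (tens eta))
    (- eps^-1 * conv (tens (tens_upd eta j (eta j)^`()%classic)) x).
Proof.
move=> seta; apply: is_derive_lineP.
pose eta' := tens_upd eta j (eta j)^`()%classic.
have seta' i : smooth (eta' i).
  by rewrite /eta' /tens_upd; case: eqP => // _; exact: smooth_derive1.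
have ct : continuous (tens eta) by apply: tens_continuous => i; exact: smooth_continuous.
have ct' : continuous (tens eta') by apply: tens_continuous => i; exact: smooth_continuous.
have [M bM] := conv_bbox x ct.
have [M' bM'] := conv_bbox x ct'.
have hx (h : R) : `|h - 0| < 1 -> `|h *: e_ j + x - x| <= 1.
  rewrite subr0 addrK => /ltW h1; apply: norm_rV_le => // i; rewrite !mxE.
  by case: (_ && _); rewrite ?mulr1 ?mulr0 ?normr0.
have eta'M (h : R) (y : 'rV[R]_n) : `|h - 0| < 1 ->
    `|tens eta' (eps^-1 *: (y - (h *: e_ j + x))) * phi y| <= M'.
  by move=> h1; have [_ + _] := bM' _ (hx h h1); exact.
pose k (h : R) y := tens eta (eps^-1 *: (y - (h *: e_ j + x))) * phi y.
pose k' (h : R) y := - eps^-1 * (tens eta' (eps^-1 *: (y - (h *: e_ j + x))) * phi y).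
have -> : - eps^-1 * conv (tens eta') x = Int (k' 0).
  rewrite /conv /k' scale0r add0r RintegralZl//.
  by apply: (bbox_integrable (M := M')); apply: bM'; rewrite subrr normr0.
apply: (@bbox_is_derive _ _ k k' (Num.max M (eps^-1 * M')) 0 1) => //.
- by move=> h h1; apply: (bboxW (M := M)); [rewrite le_max lexx|exact/bM/hx].
- move=> h y h1.
  (* This is the shape produced by the product rule, the second factor [phi y] being constant in
     [h]. *)
  have -> : k' h y = - eps^-1 * tens eta' (eps^-1 *: (y - (h *: e_ j + x))) * phi y + tens eta (eps^-1 *: (y - (h *: e_ j + x))) * 0.
    by rewrite mulr0 addr0 /k' mulrA.
  apply: (@is_derive1M _ (fun h => tens eta (eps^-1 *: (y - (h *: e_ j + x)))) (fun=> phi y)).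
  have lineE (s : R) : eps^-1 *: (y - (s *: e_ j + x)) =
      (- eps^-1 * s + 0) *: e_ j + eps^-1 *: (y - x).
    by rewrite addr0 opprD addrCA scalerDr scalerN scalerA mulNr scaleNr.
  apply: (@is_derive1_ext _ (fun s => (fun s => tens eta (s *: e_ j + eps^-1 *: (y - x))) (- eps^-1 * s + 0))).
    by move=> s /=; rewrite lineE.
  apply: (is_derive_affine (f := fun s : R => tens eta (s *: e_ j + eps^-1 *: (y - x)))).
  apply: is_derive_line; rewrite -lineE.
  by apply: (tens_is_derive (h := (eta j)^`()%classic)) => t; exact: smooth_is_derive.
- move=> h y h1; rewrite /k' normrM normrN [X in X * _]gtr0_norm ?invr_gt0//.
  by rewrite le_max ler_pM2l ?invr_gt0// eta'M// orbT.
Qed.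

Lemma conv_class_C eta k (a : R) : (forall i, smooth (eta i)) ->
  class_C (@dir_rV R n) k setT (fun x => a * conv (tens eta) x).
Proof.
move=> seta.
apply: (@class_C_family _ _ _ (fun f : 'rV[R]_n -> R => exists a eta, (forall i, smooth (eta i)) /\
    f = (fun x => a * conv (tens eta) x))); last by exists a, eta.
  move=> _ [{}a [{}eta [{}seta ->]]] x; apply: continuousM; first exact: cst_continuous.
  by apply: conv_continuous; apply: tens_continuous => i; exact: smooth_continuous.
move=> _ _ [{}a [{}eta [{}seta ->]]] [j _ <-].
have D x := is_deriveZ a (conv_is_derive j x seta).
split; first by move=> x; case: (D x).
exists (a * - eps^-1), (tens_upd eta j (eta j)^`()%classic); split.
  by move=> i; rewrite /tens_upd; case: eqP => // _; exact: smooth_derive1.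
by apply/funext => x; rewrite -mulrA; case: (D x).
Qed.

End convolution.

Let rho : 'rV[R]_n -> R := tens (fun _ : 'I_n => @bump_fun R).

Let rho_continuous : continuous rho.
Proof. by apply: tens_continuous => i; exact/smooth_continuous/smooth_bump. Qed.

Let rho_out x : 1 < `|x| -> rho x = 0.
Proof. exact: tens_bump_out. Qed.

Let rho_ge0 x : 0 <= rho x.
Proof. by apply: prodr_ge0 => i _; exact: bump_ge0. Qed.

Let rho_bbox : exists M, bbox M rho.
Proof. exact: continuous_bbox rho_continuous rho_out. Qed.

(** [rho] is at least [d ^+ n] on the cube of half-side 1/2, whose measure is 1. *)
Let Int_rho_gt0 : 0 < Int rho.
Proof.
have [d d0 db] := @bump_in R.
pose B : set 'rV[R]_n := [set x | forall i, `[- 2^-1, 2^-1]%classic (x ord0 i)].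
have mB : measurable B.
  rewrite (_ : B = \bigcap_(i in [set: 'I_n])
      ((fun x : 'rV[R]_n => x ord0 i : measurableTypeR R) @^-1` `[- 2^-1, 2^-1])).
    apply: fin_bigcap_measurable => // i _.
    by rewrite -[X in measurable X]setTI; exact: measurable_coord.
  by apply/seteqP; split => x xM i => [_|]; exact: xM.
have muB : mu B = 1%E.
  rewrite /B (lebesgue_rV_box (A := fun=> `[- 2^-1, 2^-1]%classic))// big1// => i _.
  by rewrite lebesgue_measure_itv/= lte_fin gt0_cp ?invr_gt0//= -EFinB; congr EFin; lra.
have [M bM] := rho_bbox.
have le : (\int[mu]_x (d ^+ n * \1_B x)%:E <= \int[mu]_x (rho x)%:E)%E.
  apply: ge0_le_integral => //.
  - by move=> x _; rewrite lee_fin mulr_ge0// exprn_ge0// ltW.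
  - by apply/measurable_EFinP; apply: measurable_funM.
  - by apply/measurable_EFinP; exact: continuous_rV_measurable.
  - move=> x _; rewrite lee_fin indicE; have [/set_mem xB|_] := boolP (x \in B); last first.
      by rewrite mulr0.
    rewrite mulr1 -[n in _ ^+ n]card_ord -prodr_const /rho /tens.
    apply: ler_prod => i _; rewrite (ltW d0) db//.
    by have := xB i; rewrite /= in_itv/= ler_norml.
have intr := bbox_integrable bM.
rewrite /Rintegral fine_gt0//; apply/andP; split; last first.
  by rewrite ltey_eq (integrable_fin_num measurableT intr).
apply: lt_le_trans le.
under eq_integral do rewrite EFinM.
rewrite ge0_integralZl//; last 2 first.
- by apply/measurable_EFinP.
- by rewrite lee_fin exprn_ge0// ltW.
by rewrite integral_indic// setIT [X in (_ * X)%E]muB mule1 lte_fin exprn_gt0.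
Qed.

(** The convolution [conv] after the substitution [y = eps z + x]. In this form derivatives fall on
    [phi] and the limit [eps -> 0] is visible; the form [conv] shows that the result is smooth. *)
Definition moll (eps : R) (phi : 'rV[R]_n -> R) (x : 'rV[R]_n) :=
  Int (fun z => rho z * phi (eps *: z + x)).

Let phi_shift_continuous eps x phi : continuous phi ->
  continuous (fun z => phi (eps *: z + x)).
Proof.
move=> cphi z; apply: (@continuous_comp _ _ _ (fun z => eps *: z + x) phi); last exact: cphi.
by apply: continuousD; [exact: continuousZr|exact: cst_continuous].
Qed.

Let moll_bbox phi (C : R) : continuous phi -> (forall x, `|phi x| <= C) ->
  exists M, forall eps x, bbox M (fun z => rho z * phi (eps *: z + x)).
Proof.
move=> cphi phiC; have [M bM] := rho_bbox; have [_ rM _] := bM.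
have C0 : 0 <= C by exact: le_trans (phiC 0).
exists (Num.max (M * C) 1) => eps x; split.
- apply: continuous_rV_measurable => z; apply: continuousM; first exact: rho_continuous.
  exact: phi_shift_continuous.
- by move=> z; rewrite le_max normrM ler_pM.
- by move=> z; rewrite gt_max => /andP[_ ?]; rewrite rho_out// mul0r.
Qed.

Let moll_le phi (C : R) eps x : continuous phi -> (forall x, `|phi x| <= C) ->
  `|moll eps phi x| <= C * Int rho.
Proof.
move=> cphi phiC; have [M bM] := moll_bbox cphi phiC; have [M' bM'] := rho_bbox.
have ib := bbox_integrable (bM eps x); have ir := bbox_integrable bM'.
apply: le_trans (le_normr_Rintegral measurableT ib) _.
rewrite -RintegralZl//; apply: le_Rintegral => //.
- exact: integrable_norm.
- exact: (integrableZl measurableT C ir).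
- by move=> z _; rewrite normrM ger0_norm// mulrC ler_wpM2r.
Qed.

(** [rho] is not normalised, hence the factor [Int rho], which [weak_C1] cancels at the end. *)
Let moll_cvg phi (C : R) x : continuous phi -> (forall x, `|phi x| <= C) ->
  moll k.+1%:R^-1 phi x @[k --> \oo] --> Int rho * phi x.
Proof.
move=> cphi phiC; have [M bM] := moll_bbox cphi phiC; have [M' bM'] := rho_bbox.
rewrite mulrC -RintegralZl//; last exact: bbox_integrable bM'.
apply: (@bbox_dct _ _ _ _ M) => // z.
rewrite mulrC; apply: cvgM; first exact: cvg_cst.
apply: (@cvg_comp _ _ _ (fun k => k.+1%:R^-1 *: z + x) phi _ (nbhs x)); last exact: cphi.
have : k.+1%:R^-1 *: z + x @[k --> \oo] --> (0 : R) *: z + x.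
  by apply: cvgD; [apply: cvgZr_tmp; exact: cvg_harmonic|exact: cvg_cst].
by rewrite scale0r add0r.
Qed.

Section moll.
Variables (phi : 'rV[R]_n -> R) (r : R).
Hypotheses (phiC1 : class_C (@dir_rV R n) 1 setT phi) (phi0 : forall x, r < `|x| -> phi x = 0).

Let cphi : continuous phi.
Proof. by move=> x; exact: class_C_continuous phiC1 _. Qed.

Lemma continuous_derive_C1 (psi : 'rV[R]_n -> R) j :
  class_C (@dir_rV R n) 1 setT psi -> continuous ('D_(e_ j) psi).
Proof. by move=> pC x; apply: (class_C_continuous_derive pC) => //; exact: dir_rV_basis. Qed.

Lemma gradient_continuous (psi : 'rV[R]_n -> R) j :
  class_C (@dir_rV R n) 1 setT psi -> continuous (fun x => gradient psi x ord0 j).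
Proof.
move=> pC; rewrite (_ : (fun x => _) = 'D_(e_ j) psi); first exact: continuous_derive_C1.
by apply/funext => x; rewrite mxE.
Qed.

Lemma derive_out v x : r < `|x| -> 'D_v phi x = 0.
Proof.
move=> rx; rewrite (@near_eq_derive _ _ _ phi (cst 0)) ?derive_cst//.
by apply: filterS (near_norm_gt rx) => y /phi0.
Qed.

Let bphi : exists C, forall x, `|phi x| <= C.
Proof. by have [M [_ ? _]] := continuous_bbox cphi phi0; exists M. Qed.

Let bdphi j : exists C, forall x, `|'D_(e_ j) phi x| <= C.
Proof.
have [M [_ ? _]] := continuous_bbox (continuous_derive_C1 (j := j) phiC1) (@derive_out (e_ j)).
by exists M.
Qed.

Let moll_is_derive eps x j : is_derive x (e_ j) (moll eps phi) (moll eps ('D_(e_ j) phi) x).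
Proof.
apply: is_derive_lineP.
have [C phiC] := bphi; have [C' dphiC] := bdphi j.
have [M bM] := moll_bbox cphi phiC.
have [M' bM'] := moll_bbox (continuous_derive_C1 (j := j) phiC1) dphiC.
pose k (h : R) z := rho z * phi (eps *: z + (h *: e_ j + x)).
pose k' (h : R) z := rho z * 'D_(e_ j) phi (eps *: z + (h *: e_ j + x)).
have -> : moll eps ('D_(e_ j) phi) x = Int (k' 0) by rewrite /k' scale0r add0r.
apply: (@bbox_is_derive _ _ k k' (Num.max M M') 0 1) => //.
- by move=> h _; apply: bboxW (bM _ _); rewrite le_max lexx.
- move=> h z _; apply: is_derive1Ml.
  apply: (@is_derive1_ext _ (fun s : R => phi (s *: e_ j + (eps *: z + x)))).
    by move=> s; rewrite addrCA.
  apply: is_derive_line; rewrite addrCA; apply: derivableP.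
  exact: class_C1_derivable phiC1 _.
- by move=> h z _; have [_ kM _] := bM' eps (h *: e_ j + x); rewrite le_max kM orbT.
Qed.

Let moll_out eps x : 0 < eps -> r + eps < `|x| -> moll eps phi x = 0.
Proof.
move=> e0 rx; rewrite /moll /Rintegral integral0_eq// => z _.
have [z1|z1] := leP `|z| 1; last by rewrite rho_out// mul0r.
rewrite phi0 ?mulr0//; move: rx; rewrite addrC -ltrBDr; apply: contraTT.
rewrite -!leNgt => h; rewrite lerBlDr (le_trans (_ : _ <= `|eps *: z + x| + `|eps *: z|))//.
  by rewrite -[X in `|X| <= _](addKr (eps *: z)) addrC ler_normB.
rewrite addrC lerD// normrZ gtr0_norm// -[leRHS]mulr1 ler_pM2l//.
Qed.

Let moll_conv eps x : 0 < eps -> moll eps phi x = (eps ^+ n)^-1 * conv eps phi rho x.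
Proof.
move=> e0; pose f y := rho (eps^-1 *: (y - x)) * phi y.
have cf : continuous f.
  move=> y; apply: (@continuousM _ _ (fun y => rho (eps^-1 *: (y - x))) phi); last exact: cphi.
  apply: (@continuous_comp _ _ _ (fun y => eps^-1 *: (y - x)) rho); last exact: rho_continuous.
  by apply: continuousZr; apply: continuousB => //; exact: cst_continuous.
have [M bM] := continuous_bbox cf (fun y ry => etrans (congr1 _ (phi0 ry)) (mulr0 _)).
rewrite -[RHS](Rintegral_affine x e0 (bbox_integrable bM)).
apply: eq_Rintegral => z _; rewrite /f addrK scalerA mulVf ?scale1r//.
by rewrite gt_eqF.
Qed.

Let moll_class_C eps k : 0 < eps -> class_C (@dir_rV R n) k setT (moll eps phi).
Proof.
move=> e0; have -> : moll eps phi = fun x => (eps ^+ n)^-1 * conv eps phi rho x.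
  by apply/funext => x; exact: moll_conv.
apply: (conv_class_C e0 cphi phi0) => i; exact: smooth_bump.
Qed.

Let moll_test eps : 0 < eps -> test_function (moll eps phi).
Proof.
move=> e0; split; first by move=> k; exact: moll_class_C.
apply: bounded_closed_compact; last exact: closed_closure.
exists (r + eps); split; first exact: num_real.
move=> M rM x; have cM : closed [set x : 'rV[R]_n | `|x| <= M].
  apply: (@closed_comp _ _ (fun x : 'rV[R]_n => `|x|) [set t : R | t <= M]).
    by move=> y _; exact: norm_continuous.
  exact: closed_le.
move=> xc; have : closure [set x : 'rV[R]_n | `|x| <= M] x.
  apply: closure_subset xc => y /=; apply: contraR; rewrite -ltNge => My.
  by rewrite moll_out// (lt_trans rM).
by rewrite -(closure_id _).1.
Qed.

(** The mollifications of [phi] are test functions, and their gradients are the mollified partial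
    derivatives of [phi]. With [eps <= 1] all supports lie in the ball of radius [r + 1], so
    dominated convergence applies to both sides; both limits carry the factor [Int rho], which is
    positive. *)
Lemma weak_C1 (A : 'rV[R]_n -> 'rV[R]_n) (f : 'rV[R]_n -> R) :
  (forall i, continuous (fun x => A x ord0 i)) -> continuous f ->
  (forall psi, test_function psi ->
    (\int[mu]_x (dot (A x) (gradient psi x))%:E = \int[mu]_x (f x * psi x)%:E)%E) ->
  Int (fun x => dot (A x) (gradient phi x)) = Int (fun x => f x * phi x).
Proof.
move=> cA cf weak.
pose e (k : nat) : R := k.+1%:R^-1.
have e0 k : 0 < e k by rewrite invr_gt0.
have e1 k : e k <= 1 by rewrite invf_le1// ler1n.
have weak_k k : Int (fun x => dot (A x) (gradient (moll (e k) phi) x)) =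
    Int (fun x => f x * moll (e k) phi x).
  by rewrite /Rintegral weak//; exact: moll_test.
have [C phiC] := bphi.
have out k x : r + 1 < `|x| -> moll (e k) phi x = 0.
  by move=> rx; apply: moll_out => //; rewrite (le_lt_trans _ rx)// lerD2l.
have gradE k x j : gradient (moll (e k) phi) x ord0 j = moll (e k) ('D_(e_ j) phi) x.
  by rewrite mxE; case: (moll_is_derive (e k) x j).
have R1 : Int (fun x => f x * moll (e k) phi x) @[k --> \oo] -->
    Int (fun x => Int rho * (f x * phi x)).
  have [C1 C10 fC] := continuous_bounded_ball (r + 1) cf.
  have C0 : 0 <= C by exact: le_trans (phiC 0).
  apply: (@bbox_dct _ _ _ _ (Num.max (C1 * (C * Int rho)) (r + 1))).
    move=> k; split.
    - apply: continuous_rV_measurable => x; apply: continuousM; first exact: cf.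
      exact: (class_C_continuous (moll_class_C 0 (e0 k))).
    - move=> x; have [xr|xr] := leP `|x| (r + 1); last first.
        by rewrite out// mulr0 normr0 le_max !mulr_ge0// ltW.
      by rewrite le_max normrM ler_pM ?fC// moll_le.
    - by move=> x; rewrite gt_max => /andP[_ ?]; rewrite out// mulr0.
  move=> x; rewrite mulrCA; apply: cvgM; [exact: cvg_cst|exact: moll_cvg phiC].
have /choice[D dD] := bdphi.
have R2 : Int (fun x => dot (A x) (gradient (moll (e k) phi) x)) @[k --> \oo] -->
    Int (fun x => Int rho * dot (A x) (gradient phi x)).
  have /choice[CA CAP] : forall i, exists C, 0 <= C /\ forall x, `|x| <= r + 1 -> `|A x ord0 i| <= C.
    by move=> i; have [c c0 cP] := continuous_bounded_ball (r + 1) (cA i); exists c.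
  have D0 i : 0 <= D i by exact: le_trans (dD i 0).
  have gout k x : r + 1 < `|x| -> dot (A x) (gradient (moll (e k) phi) x) = 0.
    move=> rx; rewrite /dot big1// => i _; rewrite mxE (@near_eq_derive _ _ _ _ (cst 0)) ?derive_cst ?mulr0//.
    by apply: filterS (near_norm_gt rx) => y /(out k).
  apply: (@bbox_dct _ _ _ _ (Num.max (\sum_i CA i * (D i * Int rho)) (r + 1))).
    move=> k; split.
    - apply: continuous_rV_measurable; apply: continuous_big => [|i _]; first exact: add_continuous.
      move=> x; apply: continuousM; first exact: cA.
      exact: (gradient_continuous (moll_class_C 1 (e0 k))).
    - move=> x; have [xr|xr] := leP `|x| (r + 1); last first.
        by rewrite gout// normr0 le_max sumr_ge0// => i _; rewrite !mulr_ge0// ?(CAP i).1 ?ltW.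
      rewrite le_max /dot (le_trans (ler_norm_sum _ _ _))//.
      apply: ler_sum => i _; rewrite normrM ler_pM// ?(CAP i).2// gradE.
      by apply: moll_le => //; exact: continuous_derive_C1.
    - by move=> x; rewrite gt_max => /andP[_ ?]; rewrite gout.
  move=> x; rewrite /dot mulr_sumr.
  apply: cvg_big => [|i _]; first exact: add_continuous.
  under eq_cvg do rewrite gradE.
  rewrite mulrCA mxE; apply: cvgM; [exact: cvg_cst|apply: moll_cvg (dD i)].
  exact: continuous_derive_C1.
have eqk : (fun k => Int (fun x => dot (A x) (gradient (moll (e k) phi) x))) =
    (fun k => Int (fun x => f x * moll (e k) phi x)) by apply/funext.
rewrite eqk in R2.
have E : Int (fun x => Int rho * (f x * phi x)) =
    Int (fun x => Int rho * dot (A x) (gradient phi x)).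
  exact: (cvg_unique (@Rhausdorff R) R1 R2).
have [M1 bM1] : exists M, bbox M (fun x => f x * phi x).
  apply: (continuous_bbox (r := r)); last by move=> x /phi0 ->; rewrite mulr0.
  by move=> x; apply: continuousM; [exact: cf|exact: cphi].
have [M2 bM2] : exists M, bbox M (fun x => dot (A x) (gradient phi x)).
  apply: (continuous_bbox (r := r)); last first.
    by move=> x rx; rewrite /dot big1// => i _; rewrite mxE derive_out// mulr0.
  apply: continuous_big => [|i _]; first exact: add_continuous.
  move=> x; apply: continuousM; first exact: cA.
  exact: gradient_continuous.
move: E; rewrite !RintegralZl//; last 2 first.
- exact: bbox_integrable bM2.
- exact: bbox_integrable bM1.
by move=> E'; apply/esym/(mulfI (lt0r_neq0 Int_rho_gt0)).
Qed.

End moll.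

End mollification.

(** Negative arguments are outside the control of the hypothesis; composing with [Num.max 0] gives a
    function continuous on the whole line that agrees with [f] on the half-line. *)
Lemma within_continuous_max0 {R : realType} (f : R -> R) :
  {within `[0, +oo[, continuous f} -> continuous (fun t : R => f (Num.max 0 t)).
Proof.
move=> /subspace_continuousP fc t.
have m0 : `[0, +oo[%classic (Num.max 0 t) by rewrite /= in_itv/= andbT le_max lexx.
apply: cvg_trans (fc _ m0); move=> A; rewrite /within/= /nbhs/= => An.
have mc : Num.max 0 s @[s --> t] --> Num.max 0 t.
  by apply: continuous_max; [exact: cvg_cst|exact: cvg_id].
have nA : nbhs t (fun s : R => `[0, +oo[%classic (Num.max 0 s) -> A (f (Num.max 0 s))).
  exact: (mc _ An).
apply: filterS nA => s /=; apply.
by rewrite in_itv/= andbT le_max lexx.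
Qed.

(** * The functions B and H *)

Section hyp_B.
Context {R : realType} (beta : R) (B : R -> R).
Hypothesis hB : hyp_B beta 0 B.
Local Notation b := (half_derive B).
Implicit Types s t : R.

Lemma hyp_B0 : B 0 = 0.
Proof. by case: hB => _ []. Qed.

Lemma hyp_b0 : b 0 = 0.
Proof. by case: hB => _ []. Qed.

Let B_C3 : class_C (dir_R : set R^o) 3 `]0, +oo[ (B : R^o -> R).
Proof. by case: hB => -[[]]. Qed.

Let pos_itv (t : R) : 0 < t -> `]0, +oo[%classic t.
Proof. by move=> t0; rewrite /= in_itv/= t0. Qed.

Lemma hyp_B_is_derive t : 0 < t -> is_derive t (1 : R) B (b t).
Proof.
move=> t0; rewrite half_deriveE// derive1E; apply: derivableP.
have [] := B_C3 (s := [::]) => // _; apply => //.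
exact: pos_itv.
Qed.

Lemma hyp_b_is_derive t : 0 < t -> is_derive t (1 : R) b (derive1n 2 B t).
Proof.
move=> t0.
have D : is_derive t (1 : R) (derive1 B) (derive1n 2 B t).
  rewrite /= derive1E; apply: derivableP.
  have [|_] := B_C3 (s := [:: (1 : R^o)]); first by move=> v; rewrite inE => /eqP ->.
  move=> /(_ isT 1 t erefl (pos_itv t0)) /=.
  by rewrite (_ : derive1 B = 'D_1 (B : R^o -> R))//; apply/funext => s; rewrite derive1E.
apply: near_eq_is_derive D.
have : \forall y \near t, 0 < y by exact: lt_nbhsr.
by apply: filterS => y y0; rewrite half_deriveE.
Qed.

Lemma hyp_b_gt0 t : 0 < t -> 0 < b t.
Proof. by move=> t0; case: hB => _ _ /(_ t t0)[]. Qed.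

Lemma hyp_b_ge0 t : 0 <= t -> 0 <= b t.
Proof. by rewrite le_eqVlt => /predU1P[<-|/hyp_b_gt0/ltW//]; rewrite hyp_b0. Qed.

Let b_continuous : {within `[0, +oo[, continuous b}.
Proof. by case: hB => -[_ []]. Qed.

Let B_continuous : {within `[0, +oo[, continuous B}.
Proof.
apply/subspace_continuousP => t; rewrite /= in_itv/= andbT le_eqVlt => /predU1P[<-|t0]; last first.
  apply: cvg_within_filter; apply: differentiable_continuous; apply/derivable1_diffP.
  by case: (hyp_B_is_derive t0).
(* At 0 only the one-sided difference quotient converges. Near 0 it is bounded by [|l| + 1], so that
   [|B s| <= (|l| + 1) |s|]. *)
have : cvg (half_quotient B 0) by case: hB => -[_ [+ _]] _ _ _; apply.
move=> /cvg_ex[l] /cvgrPdist_lt/(_ 1 ltr01) /nbhs_ballP[d /= d0 dP].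
have B0 : from_subspace `[0, +oo[ B 0 = 0 by exact: hyp_B0.
rewrite B0; apply/cvgrPdist_le => e e0; apply/nbhs_ballP.
have l1 : 0 < `|l| + 1 by rewrite ltr_wpDl.
exists (Num.min d (e / (`|l| + 1))) => /=; first by rewrite lt_min d0 divr_gt0.
move=> s; rewrite /ball/= sub0r normrN lt_min => /andP[sd se]; rewrite in_itv/= andbT => s0.
suff : `|B s| <= e by rewrite sub0r normrN.
have [->|sn0] := eqVneq s 0; first by rewrite hyp_B0 normr0 ltW.
have := dP s; rewrite /ball/= sub0r normrN => /(_ sd sn0 s0).
rewrite hyp_B0 !subr0 => Bs.
have -> : B s = (B s / s) * s by rewrite mulfVK.
rewrite normrM; have : `|B s / s| <= `|l| + 1.
  rewrite -[B s / s](subrK l) (le_trans (ler_normD _ _))// addrC lerD2l distrC.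
  exact: ltW.
move: se; rewrite ltr_pdivlMr// => /ltW se h; apply: le_trans se.
by rewrite mulrC ler_wpM2l.
Qed.

Lemma hyp_B_continuous : continuous (fun t : R => B (Num.max 0 t)).
Proof. exact: within_continuous_max0. Qed.

Lemma hyp_b_continuous : continuous (fun t : R => b (Num.max 0 t)).
Proof. exact: within_continuous_max0. Qed.

Let sub_itv (a c : R) : 0 <= a -> `[a, c] `<=` `[0, +oo[.
Proof. by move=> a0 t /=; rewrite !in_itv/= andbT => /andP[/(le_trans a0)]. Qed.

Let MVT_B s t : 0 <= s -> s < t ->
  exists2 c, s < c < t & B t - B s = b c * (t - s).
Proof.
move=> s0 st; have [|c] := @MVT R B b s t st _ (continuous_subspaceW (sub_itv s0) B_continuous).
- move=> c; rewrite in_itv/= => /andP[sc _]; apply: hyp_B_is_derive.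
  exact: le_lt_trans sc.
- by rewrite in_itv/= => ct ->; exists c.
Qed.

Lemma hyp_b_le s t : 0 <= s -> s <= t -> b s <= b t.
Proof.
move=> s0; rewrite le_eqVlt => /predU1P[->//|st].
have [|c] := @MVT R b (derive1n 2 B) s t st _ (continuous_subspaceW (sub_itv s0) b_continuous).
- move=> c; rewrite in_itv/= => /andP[sc _]; apply: hyp_b_is_derive.
  exact: le_lt_trans sc.
- rewrite in_itv/= => /andP[sc ct] bE; rewrite -subr_ge0 bE mulr_ge0 ?subr_ge0 ?(ltW st)//.
  by apply: ltW; case: hB => _ _ /(_ c (le_lt_trans s0 sc))[].
Qed.

Lemma hyp_B_tangent s t : 0 <= s -> 0 < t -> B t + b t * (s - t) <= B s.
Proof.
move=> s0 t0; have [st|ts|->] := ltgtP s t; last by rewrite subrr mulr0 addr0.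
- have [c /andP[sc ct] BE] := MVT_B s0 st.
  have bc : b c <= b t by apply: hyp_b_le; [exact: le_trans s0 (ltW sc)|exact: ltW].
  have : b c * (t - s) <= b t * (t - s) by rewrite ler_wpM2r// subr_ge0 ltW.
  by move: BE; lra.
- have [c /andP[tc cs] BE] := MVT_B (ltW t0) ts.
  have bc : b t <= b c by apply: hyp_b_le; exact: ltW.
  have : b t * (s - t) <= b c * (s - t) by rewrite ler_wpM2r// subr_ge0 ltW.
  by move: BE; lra.
Qed.

Lemma hyp_B_le s t : 0 <= s -> s <= t -> B s <= B t.
Proof.
move=> s0; rewrite le_eqVlt => /predU1P[->//|st].
have [c /andP[sc ct] BE] := MVT_B s0 st.
rewrite -subr_ge0 BE mulr_ge0 ?subr_ge0 ?(ltW st)//.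
by apply: hyp_b_ge0; exact: le_trans s0 (ltW sc).
Qed.

Lemma hyp_B_ge0 t : 0 <= t -> 0 <= B t.
Proof. by move=> t0; rewrite -hyp_B0; exact: hyp_B_le. Qed.

(* With [C = 1 + Gamma / gamma], growth gives [t B''(t) <= (C - 1) B'(t)],
   so [C B(t) - t B'(t)] is nondecreasing and vanishes at [0]. *)
Lemma hyp_B_doubling : exists2 C, 0 <= C & forall t, 0 <= t -> b t * t <= C * B t.
Proof.
case: (hB) => _ _ _ [_ [p [gam [Gam [_ gam0 Gam0 growth]]]]].
have Gg : 0 < Gam / gam by rewrite divr_gt0.
exists (1 + Gam / gam); first by rewrite addr_ge0// ltW.
move=> t; rewrite le_eqVlt => /predU1P[<-|t0]; first by rewrite hyp_B0 !mulr0.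
pose G (s : R) := (1 + Gam / gam) * B (Num.max 0 s) - b (Num.max 0 s) * s.
pose G' (s : R) := (1 + Gam / gam) * b s - (derive1n 2 B s * s + b s * 1).
have cG : continuous G.
  move=> s; apply: (@continuousB _ _ _ (fun s => (1 + Gam / gam) * B (Num.max 0 s))
      (fun s => b (Num.max 0 s) * s)).
    by apply: continuousM; [exact: cst_continuous|exact: hyp_B_continuous].
  by apply: continuousM; [exact: hyp_b_continuous|exact: cvg_id].
have dG s : 0 < s -> is_derive s (1 : R) G (G' s).
  move=> s0.
  have D : is_derive s (1 : R) (fun s => (1 + Gam / gam) * B s - b s * s) (G' s).
    apply: is_derive1B; first by apply: is_derive1Ml; exact: hyp_B_is_derive.
    by apply: is_derive1M; exact: hyp_b_is_derive.
  apply: near_eq_is_derive D.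
  have : \forall y \near s, 0 < y by exact: lt_nbhsr.
  by apply: filterS => y y0; rewrite /G (max_idPr (ltW y0)).
have [|c] := @MVT R G G' 0 t t0 _ (continuous_subspaceT cG).
- by move=> s; rewrite in_itv/= => /andP[s0 _]; exact: dG.
- rewrite in_itv/= => /andP[c0 ct]; rewrite {1 2}/G maxxx hyp_B0 mulr0 mulr0 !subr0.
  rewrite (max_idPr (ltW t0)) -subr_ge0 => ->; rewrite mulr_ge0 ?(ltW t0)//.
  have := growth c c0; set P := (0 + c) `^ (p - 2) => -[/andP[b1 _] /andP[_ b2]].
  have : derive1n 2 B c * c <= Gam / gam * b c.
    apply: (@le_trans _ _ (Gam / gam * (gam * P * c))); last by rewrite ler_pM2l.
    rewrite !mulrA mulfVK ?gt_eqF//; by rewrite ler_pM2r.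
  by rewrite /G'; lra.
Qed.

(** For [h = 0] the function is constant in [l], so [B] is never differentiated at 0, where its
    derivative is one-sided. *)
Lemma hyp_B_scale_is_derive (h l : R) : 0 <= h -> 0 < l ->
  is_derive l (1 : R) (fun l => B (l * h)) (b (l * h) * h).
Proof.
move=> + l0; rewrite le_eqVlt => /predU1P[<-|h0].
  rewrite mulr0 (_ : (fun _ => _) = cst (B 0)); first exact: is_derive_cst.
  by apply/funext => s; rewrite mulr0.
apply: (is_derive1_chain (g := fun l => l * h)).
  by apply: hyp_B_is_derive; rewrite mulr_gt0.
have := is_derive1M (is_derive_id l (1 : R)) (is_derive_cst h l (1 : R)).
by rewrite mul1r mulr0 addr0.
Qed.

End hyp_B.

Section dot.
Context {R : realType} (n : nat).
Implicit Types (x y z : 'rV[R]_n).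

Lemma dotC x y : dot x y = dot y x.
Proof. by apply: eq_bigr => i _; rewrite mulrC. Qed.

Lemma dotDr x y z : dot x (y + z) = dot x y + dot x z.
Proof. by rewrite /dot -big_split; apply: eq_bigr => i _; rewrite mxE mulrDr. Qed.

Lemma dotZr x y (a : R) : dot x (a *: y) = a * dot x y.
Proof. by rewrite /dot mulr_sumr; apply: eq_bigr => i _; rewrite mxE mulrCA. Qed.

Lemma dotZl x y (a : R) : dot (a *: x) y = a * dot x y.
Proof. by rewrite dotC dotZr dotC. Qed.

Lemma dotNr x y : dot x (- y) = - dot x y.
Proof. by rewrite -scaleN1r dotZr mulN1r. Qed.

Lemma dotBr x y z : dot x (y - z) = dot x y - dot x z.
Proof. by rewrite dotDr dotNr. Qed.

Lemma dot0r x : dot x 0 = 0.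
Proof. by rewrite /dot big1// => i _; rewrite mxE mulr0. Qed.

Lemma dot0l x : dot 0 x = 0.
Proof. by rewrite dotC dot0r. Qed.

Lemma dot_basis x i : dot x (basis_rV i) = x ord0 i.
Proof.
rewrite /dot (bigD1 i)//= big1 ?addr0; last first.
  by move=> j ji; rewrite mxE (negbTE ji) andbF mulr0.
by rewrite mxE !eqxx mulr1.
Qed.

Lemma dotxx_ge0 x : 0 <= dot x x.
Proof. by apply: sumr_ge0 => i _; rewrite -expr2 sqr_ge0. Qed.

End dot.

(** The relation [f (s *: y) = a * f y] is differentiated along [v]. It serves with [a = s] for [H]
    and with [a = 1] for its partial derivatives. *)
Lemma homogeneous_derive {R : realType} n (f : 'rV[R]_n -> R) (s a : R) (xi v : 'rV[R]_n) :
  0 < s -> (forall y, f (s *: y) = a * f y) -> derivable f xi v ->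
  'D_v f (s *: xi) = a / s * 'D_v f xi.
Proof.
move=> s0 fs df; have sn0 : s != 0 by rewrite gt_eqF.
have D : is_derive (s *: xi) v f (s^-1 * (a * 'D_v f xi)).
  apply: is_derive_lineP.
  apply: (@is_derive1_ext _ (fun h : R => (fun t : R => a * f (t *: v + xi)) (s^-1 * h + 0))).
    move=> h /=; rewrite -fs addr0 scalerDr scalerA mulrA mulfV// mul1r//.
  apply: (@is_derive_affine _ (fun t : R => a * f (t *: v + xi))).
  rewrite mulr0 addr0; apply: (@is_derive1Ml _ (fun t : R => f (t *: v + xi))).
  by apply: is_derive_line; rewrite scale0r add0r; exact: derivableP.
by case: D => _ ->; rewrite mulrCA mulrA.
Qed.

(** * Homogeneity and convexity of H, and the flux *)

Section hyp_H.
Context {R : realType} (m : nat) (beta : R).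
Local Notation n := m.+1.
Variable H : 'rV[R]_n -> R.
Hypothesis hH : hyp_H beta H.
Implicit Types (xi eta v w : 'rV[R]_n).
Local Notation e_ i := (basis_rV i : 'rV[R]_n).
Let Om : set 'rV[R]_n := [set xi | xi != 0].

Let H_C3 : class_C (@dir_rV R n) 3 Om H.
Proof. by case: hH => -[[]]. Qed.

Let H_C1 : class_C (@dir_rV R n) 1 Om H.
Proof. exact: class_C_leq H_C3. Qed.

Let dH_C1 i : class_C (@dir_rV R n) 1 Om ('D_(e_ i) H).
Proof. by apply: class_C_derive; [exact: class_C_leq H_C3|exact: dir_rV_basis]. Qed.

Let Om_open : open Om.
Proof.
rewrite openE => x; rewrite /Om/= -normr_gt0 => x0.
by apply: filterS (near_norm_gt x0) => y; rewrite normr_gt0.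
Qed.

(** Positive dimension enters here: a nonzero vector yields [H 0 = 0] and a nonempty unit sphere. *)
Let e0_neq0 : e_ ord0 != 0.
Proof.
apply/eqP => /rowP/(_ ord0); rewrite !mxE !eqxx/= => /eqP.
by rewrite oner_eq0.
Qed.

Lemma hyp_H0 : H 0 = 0.
Proof. by case: hH => _ + _ => /(_ _ 0 e0_neq0); rewrite scale0r normr0 mul0r. Qed.

Lemma hyp_H_gt0 xi : xi != 0 -> 0 < H xi.
Proof. by case: hH => -[_ +] _ _; exact. Qed.

Lemma hyp_H_ge0 xi : 0 <= H xi.
Proof. by have [->|/hyp_H_gt0/ltW//] := eqVneq xi 0; rewrite hyp_H0. Qed.

Lemma hyp_HZ s xi : H (s *: xi) = `|s| * H xi.
Proof.
have [->|xi0] := eqVneq xi 0; first by rewrite scaler0 hyp_H0 mulr0.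
by case: hH => _ + _; exact.
Qed.

Let sphere : set 'rV[R]_n := [set xi | `|xi| = 1].

Let sphere_compact : compact sphere.
Proof.
apply: bounded_closed_compact.
  by exists 1; split => // M M1 x /= ->; exact: ltW.
rewrite (_ : sphere = (fun x : 'rV[R]_n => `|x|) @^-1` [set 1])//.
apply: closed_comp; last exact: closed_eq.
by move=> x _; exact: norm_continuous.
Qed.

Let sphere_neq0 : sphere !=set0.
Proof. by exists (`|e_ ord0|^-1 *: e_ ord0); rewrite /sphere/= normrZ normfV normr_id mulVf// normr_eq0. Qed.

Let H_continuous0 xi : xi != 0 -> {for xi, continuous H}.
Proof. by move=> xi0; apply: (class_C_continuous H_C1). Qed.

Let H_sphere_continuous : {within sphere, continuous H}.
Proof.
apply: continuous_in_subspaceT => x; rewrite inE /sphere/= => x1.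
by apply: H_continuous0; rewrite -normr_eq0 x1 oner_neq0.
Qed.

Let H_sphere xi : xi != 0 -> sphere (`|xi|^-1 *: xi) /\ H xi = `|xi| * H (`|xi|^-1 *: xi).
Proof.
move=> xi0; have x0 : `|xi| != 0 by rewrite normr_eq0.
split; first by rewrite /sphere/= normrZ normfV normr_id mulVf.
by rewrite hyp_HZ normfV normr_id mulrA mulfV// mul1r.
Qed.

(** By homogeneity the ratio of [H] to the norm is determined by its values on the compact unit
    sphere, where [H] attains its maximum and, for the reverse bound below, a positive minimum. *)
Lemma hyp_H_le_norm : exists2 C, 0 <= C & forall xi, H xi <= C * `|xi|.
Proof.
have [c cS cmax] := EVT_max_rV sphere_neq0 sphere_compact H_sphere_continuous.
exists (H c); first exact: hyp_H_ge0.
move=> xi; have [->|xi0] := eqVneq xi 0; first by rewrite hyp_H0 normr0 mulr0.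
have [xS ->] := H_sphere xi0; by rewrite mulrC ler_wpM2r//; apply: cmax; rewrite inE.
Qed.

Lemma hyp_H_ge_norm : exists2 C, 0 <= C & forall xi, `|xi| <= C * H xi.
Proof.
have [c cS cmin] := EVT_min_rV sphere_neq0 sphere_compact H_sphere_continuous.
have Hc : 0 < H c.
  apply: hyp_H_gt0; move: cS; rewrite inE /sphere/= => c1.
  by rewrite -normr_eq0 c1 oner_neq0.
exists (H c)^-1; first by rewrite invr_ge0 ltW.
move=> xi; rewrite ler_pdivlMl//.
have [->|xi0] := eqVneq xi 0; first by rewrite hyp_H0 normr0 mulr0.
by have [xS ->] := H_sphere xi0; rewrite mulrC ler_wpM2l//; apply: cmin; rewrite inE.
Qed.

Lemma hyp_H_continuous : continuous H.
Proof.
move=> xi; have [->|xi0] := eqVneq xi 0; last exact: H_continuous0.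
have [C C0 HC] := hyp_H_le_norm.
apply/(@cvgrPdist_le _ _ _ _ (nbhs_filter _)) => e e0; apply/nbhs_ballP.
have C1 : 0 < C + 1 by rewrite ltr_wpDl.
exists (e / (C + 1)) => /=; first by rewrite divr_gt0.
move=> y; rewrite -ball_normE/= sub0r normrN ltr_pdivlMr// => /ltW ye.
rewrite hyp_H0 sub0r normrN ger0_norm ?hyp_H_ge0// (le_trans (HC y))//.
by apply: le_trans ye; rewrite mulrC ler_wpM2l// lerDl.
Qed.

Let derH xi i : xi != 0 -> derivable H xi (e_ i).
Proof. by move=> xi0; exact: class_C1_derivable H_C1 _. Qed.

Let derdH xi i j : xi != 0 -> derivable ('D_(e_ i) H) xi (e_ j).
Proof. by move=> xi0; exact: class_C1_derivable (dH_C1 i) _. Qed.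

Let dHZ s xi i : 0 < s -> xi != 0 -> 'D_(e_ i) H (s *: xi) = 'D_(e_ i) H xi.
Proof.
move=> s0 xi0; rewrite (@homogeneous_derive _ _ _ _ s)//.
- by rewrite mulfV ?mul1r// gt_eqF.
- by move=> y; rewrite hyp_HZ gtr0_norm.
- exact: derH.
Qed.

Let ddHZ s xi i j : 0 < s -> xi != 0 ->
  'D_(e_ j) ('D_(e_ i) H) (s *: xi) = s^-1 * 'D_(e_ j) ('D_(e_ i) H) xi.
Proof.
move=> s0 xi0; rewrite (@homogeneous_derive _ _ _ _ 1) ?mul1r//.
- move=> y; rewrite mul1r; have [->|y0] := eqVneq y 0; first by rewrite scaler0.
  exact: dHZ.
- exact: derdH.
Qed.

Let scale_is_derive xi (s : R) : is_derive s (1 : R) (fun s : R => s *: xi) xi.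
Proof.
have := @is_derive_line R 'rV[R]_n 'rV[R]_n id 0 xi s xi (is_derive_id _ _).
by congr is_derive; apply/funext => t /=; rewrite addr0.
Qed.

Lemma hyp_H_euler xi : xi != 0 -> dot (gradient H xi) xi = H xi.
Proof.
move=> xi0.
have D : is_derive (1 : R) (1 : R) (H \o (fun s : R => s *: xi)) (dot (gradient H (1 *: xi)) xi).
  by apply: (C1_is_derive_curve Om_open H_C1) => //; rewrite scale1r.
have D' : is_derive (1 : R) (1 : R) (H \o (fun s : R => s *: xi)) (H xi).
  have E : is_derive (1 : R) (1 : R) (fun s : R => s * H xi) (H xi).
    have := is_derive1M (is_derive_id (1 : R) (1 : R)) (is_derive_cst (H xi) (1 : R) (1 : R)).
    by rewrite mul1r mulr0 addr0.
  apply: near_eq_is_derive E.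
  have : \forall y \near (1 : R), 0 < y by exact: lt_nbhsr.
  by apply: filterS => y y0 /=; rewrite hyp_HZ gtr0_norm.
by case: D D' => _ E [_]; rewrite E scale1r.
Qed.

(* [D_i H] is homogeneous of degree 0 and Euler's identity can be differentiated:
   the Hessian kills [xi] on both sides, without using its symmetry. *)
Let hess_col xi i : xi != 0 -> \sum_j hessian H xi i j * xi ord0 j = 0.
Proof.
move=> xi0.
have D : is_derive (1 : R) (1 : R) ('D_(e_ i) H \o (fun s : R => s *: xi))
    (dot (gradient ('D_(e_ i) H) (1 *: xi)) xi).
  by apply: (C1_is_derive_curve Om_open (dH_C1 i)) => //; rewrite scale1r.
have D' : is_derive (1 : R) (1 : R) ('D_(e_ i) H \o (fun s : R => s *: xi)) 0.
  have E := is_derive_cst ('D_(e_ i) H xi) (1 : R) (1 : R).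
  apply: near_eq_is_derive E.
  have : \forall y \near (1 : R), 0 < y by exact: lt_nbhsr.
  by apply: filterS => y y0 /=; rewrite dHZ.
case: D D' => _ E [_]; rewrite E scale1r => E2; rewrite -[RHS]E2.
by apply: eq_bigr => j _; rewrite !mxE.
Qed.

Let hess_row xi j : xi != 0 -> \sum_i xi ord0 i * hessian H xi i j = 0.
Proof.
move=> xi0.
pose E (i : 'I_n) (y : 'rV[R]_n) := y ord0 i * 'D_(e_ i) H y.
have DE i : is_derive xi (e_ j) (E i)
   ((i == j)%:R * 'D_(e_ i) H xi + xi ord0 i * hessian H xi i j).
  have Dc : is_derive xi (e_ j) (fun y : 'rV[R]_n => y ord0 i) ((i == j)%:R : R).
    apply: is_derive_lineP.
    apply: (@is_derive1_ext _ (fun s : R => (i == j)%:R * s + xi ord0 i)).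
      by move=> s; rewrite !mxE eqxx mulrC.
    have := is_derive1D (is_derive1Ml (i == j)%:R (is_derive_id (0 : R) (1 : R))) (is_derive_cst (xi ord0 i) (0 : R) (1 : R)).
    by rewrite mulr1 addr0.
  have [ME MV] := is_deriveM Dc (derivableP (derdH (i := i) (j := j) xi0)).
  apply: DeriveDef => //; rewrite [LHS]MV addrC /GRing.scale/= [_ * (_ == _)%:R]mulrC.
  by rewrite mxE.
have HE : is_derive xi (e_ j) H
    (\sum_i ((i == j)%:R * 'D_(e_ i) H xi + xi ord0 i * hessian H xi i j)).
  apply: near_eq_is_derive (is_derive_sum DE).
  have : \forall y \near xi, Om y by exact: open_nbhs_nbhs.
  apply: filterS => y y0; rewrite -(hyp_H_euler y0) fct_sumE.
  by apply: eq_bigr => i _; rewrite /E mxE mulrC.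
(* Euler's identity, differentiated, expresses [D_j H] as [D_j H] plus the sum in question. *)
case: HE => _; rewrite big_split/= (bigD1 j)//= eqxx mul1r big1 ?addr0.
  by move=> /eqP; rewrite -subr_eq0 opprD addNKr oppr_eq0 => /eqP.
by move=> i /negbTE ->; rewrite mul0r.
Qed.

Let frontierP xi : H xi = 1 -> frontier [set eta | H eta < 1] xi.
Proof.
move=> H1; split; last by move=> /nbhs_singleton /=; rewrite H1 ltxx.
move=> A /nbhs_ballP[e /= e0 eA].
(* Chosen so that [d < 1] and [d * |xi| < e]: the point [(1 - d) *: xi] lies in the ball and
   satisfies [H < 1]. *)
pose d := e / (`|xi| + e).
have xe : 0 < `|xi| + e by rewrite ltr_wpDl.
have d1 : d < 1.
  rewrite ltr_pdivrMr// mul1r ltrDr normr_gt0; apply/eqP => x0.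
  by move/eqP: H1; rewrite x0 hyp_H0 eq_sym oner_eq0.
have d0 : 0 < d by rewrite divr_gt0.
exists ((1 - d) *: xi); split; first by rewrite /= hyp_HZ H1 mulr1 ger0_norm; lra.
apply: eA; rewrite -ball_normE/= scalerBl scale1r opprB addrCA subrr addr0.
rewrite normrZ gtr0_norm// /d mulrAC ltr_pdivrMr// ltr_pM2l// ltrDl//.
Qed.

(** Write [v = w + a *: xi] with [w] orthogonal to the gradient, [a] being given by Euler's
    identity. The Hessian kills [xi] on both sides, so only [w] counts. Ellipticity applies to [w]
    at [(H xi)^-1 *: xi], a point of the level set [H = 1] where the gradient is the same and the
    Hessian is multiplied by [H xi]. *)
Let hess_ge0 xi v : xi != 0 -> 0 <= dot (v *m hessian H xi) v.
Proof.
move=> xi0; have Hxi := hyp_H_gt0 xi0.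
have [_ _ [L L0 ell]] := hH.
pose a := dot (gradient H xi) v / H xi.
pose w := v - a *: xi.
have vE : v = w + a *: xi by rewrite subrK.
have gw : dot (gradient H xi) w = 0.
  by rewrite dotBr dotZr hyp_H_euler// /a mulfVK ?subrr// gt_eqF.
have row0 : xi *m hessian H xi = 0.
  by apply/rowP => j; rewrite !mxE hess_row.
have col0 : dot (w *m hessian H xi) xi = 0.
  rewrite /dot; under eq_bigr do rewrite mxE mulr_suml.
  rewrite exchange_big/= big1// => i _.
  under eq_bigr do rewrite -mulrA.
  by rewrite -mulr_sumr hess_col// mulr0.
have -> : dot (v *m hessian H xi) v = dot (w *m hessian H xi) w.
  by rewrite vE mulmxDl -scalemxAl row0 scaler0 addr0 dotDr dotZr col0 mulr0 addr0.
have s0 : 0 < (H xi)^-1 by rewrite invr_gt0.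
have fr : frontier [set eta | H eta < 1] ((H xi)^-1 *: xi).
  by apply: frontierP; rewrite hyp_HZ gtr0_norm// mulVf// gt_eqF.
have gE : gradient H ((H xi)^-1 *: xi) = gradient H xi.
  by apply/rowP => i; rewrite !mxE dHZ.
have hE : hessian H ((H xi)^-1 *: xi) = H xi *: hessian H xi.
  by apply/matrixP => i j; rewrite !mxE ddHZ// invrK.
have := ell _ w fr; rewrite gE gw hE -scalemxAr dotZl => /(_ erefl) h.
rewrite -(pmulr_rge0 _ Hxi); apply: le_trans h.
by rewrite mulr_ge0 ?dotxx_ge0// ltW.
Qed.

(** By Euler's identity this is the tangent inequality of [H] at [xi]. Two applications of the mean
    value theorem along the segment to [eta] reduce it to [hess_ge0]. If the segment meets the
    origin, where no regularity is assumed, then [eta] is a nonpositive multiple of [xi] and Euler's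
    identity settles the case directly. *)
Lemma hyp_H_tangent xi eta : xi != 0 -> dot (gradient H xi) eta <= H eta.
Proof.
move=> xi0.
have [[t0 [t01 t0x]]|nseg] := pselect (exists t : R, 0 <= t <= 1 /\ t *: (eta - xi) + xi = 0).
  have t0n : t0 != 0.
    by apply: contra_eq_neq t0x => ->; rewrite scale0r add0r.
  have tp : 0 < t0 by rewrite lt_def t0n; case/andP: t01.
  have -> : eta = (- ((1 - t0) / t0)) *: xi.
    have -> : eta = t0^-1 *: (t0 *: (eta - xi) + xi) - t0^-1 *: xi + xi.
      by rewrite scalerDr scalerA mulVf// scale1r addrK subrK.
    rewrite t0x scaler0 add0r -scaleNr -[X in _ + X]scale1r -scalerDl; congr (_ *: _).
    by field.
  have c0 : 0 <= (1 - t0) / t0 by rewrite divr_ge0 ?(ltW tp)// subr_ge0; case/andP: t01.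
  rewrite dotZr hyp_H_euler// hyp_HZ normrN (ger0_norm c0) mulNr.
  have : 0 <= (1 - t0) / t0 * H xi by rewrite mulr_ge0 ?hyp_H_ge0.
  by lra.
pose v := eta - xi.
pose c (t : R) := t *: v + xi.
have cn0 t : 0 <= t -> t <= 1 -> c t != 0.
  by move=> t0 t1; apply/eqP => ct; apply: nseg; exists t; rewrite t0 t1.
have dc (t : R) : is_derive t (1 : R) c v.
  by apply: (@is_derive_line R 'rV[R]_n 'rV[R]_n id).
have dh (t : R) : 0 <= t -> t <= 1 -> is_derive t (1 : R) (H \o c) (dot (gradient H (c t)) v).
  by move=> t0 t1; apply: (C1_is_derive_curve Om_open H_C1) => //; exact: cn0.
pose h' (t : R) := \sum_i ('D_(e_ i) H \o c) t * v ord0 i.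
pose h'' (t : R) := dot (v *m hessian H (c t)) v.
have h'E t : dot (gradient H (c t)) v = h' t.
  by apply: eq_bigr => i _; rewrite mxE.
have dh' (t : R) : 0 <= t -> t <= 1 -> is_derive t (1 : R) h' (h'' t).
  move=> t0 t1.
  have Di i : is_derive t (1 : R) (fun t => ('D_(e_ i) H \o c) t * v ord0 i)
      (dot (gradient ('D_(e_ i) H) (c t)) v * v ord0 i + ('D_(e_ i) H \o c) t * 0).
    apply: is_derive1M.
    by apply: (C1_is_derive_curve Om_open (dH_C1 i)) => //; exact: cn0.
  have S := is_derive_sum Di.
  have -> : h'' t = \sum_i (dot (gradient ('D_(e_ i) H) (c t)) v * v ord0 i + ('D_(e_ i) H \o c) t * 0).
    rewrite /h'' /dot; under eq_bigr do rewrite mxE mulr_suml.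
    rewrite exchange_big/=; apply: eq_bigr => i _; rewrite mulr0 addr0 mulr_suml.
    by apply: eq_bigr => j _; rewrite !mxE; ring.
  by apply: is_derive1_ext S => s; rewrite fct_sumE.
have ch : {within `[0, 1], continuous (H \o c)}.
  apply: derivable_within_continuous => t; rewrite in_itv/= => /andP[t0 t1].
  by case: (dh t t0 t1).
have [|t] := @MVT R (H \o c) h' 0 1 ltr01 _ ch.
  move=> t; rewrite in_itv/= => /andP[t0 t1]; rewrite -h'E.
  by apply: dh; exact: ltW.
rewrite in_itv/= => /andP[t0 t1]; rewrite subr0 mulr1 => hE.
have ch' : {within `[0, t], continuous h'}.
  apply: derivable_within_continuous => s; rewrite in_itv/= => /andP[s0 s1].
  by case: (dh' s s0 (le_trans s1 (ltW t1))).
have [|s] := @MVT R h' h'' 0 t t0 _ ch'.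
  move=> s; rewrite in_itv/= => /andP[s0 s1].
  by apply: dh'; [exact: ltW|exact: ltW (lt_trans s1 t1)].
rewrite in_itv/= => /andP[s0 s1]; rewrite subr0 => h'E2.
have h2 : 0 <= h'' s * t.
  by rewrite mulr_ge0 ?(ltW t0)// hess_ge0// cn0 ?(ltW s0)// ltW// (lt_trans s1).
have c1 : c 1 = eta by rewrite /c scale1r subrK.
have c0 : c 0 = xi by rewrite /c scale0r add0r.
move: hE h'E2 (h'E 0); rewrite /= c1 c0 dotBr hyp_H_euler// => hE h'E2 h0.
by move: h2; lra.
Qed.

(** The tangent inequality at [e_ i] and at [- e_ i], where [H] takes the same value. *)
Lemma hyp_dH_le xi i : xi != 0 -> `|'D_(e_ i) H xi| <= H (e_ i).
Proof.
move=> xi0; rewrite ler_norml; apply/andP; split.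
  have := hyp_H_tangent (- e_ i) xi0.
  rewrite -scaleN1r hyp_HZ normrN1 mul1r dotZr mulN1r dot_basis mxE.
  by rewrite lerNl.
by have := hyp_H_tangent (e_ i) xi0; rewrite dot_basis mxE.
Qed.

Section flux.
Variable B : R -> R.
Hypothesis hB : hyp_B beta 0 B.
Local Notation b := (half_derive B).

Lemma flux_le xi i : `|flux B H xi ord0 i| <= b (H xi) * H (e_ i).
Proof.
rewrite /flux; case: eqVneq => [->|xi0].
  by rewrite mxE normr0 hyp_H0 (hyp_b0 hB) mul0r.
rewrite !mxE normrM ger0_norm; last by rewrite (hyp_b_ge0 hB)// hyp_H_ge0.
by rewrite ler_wpM2l ?hyp_dH_le// (hyp_b_ge0 hB)// hyp_H_ge0.
Qed.

Lemma bH_continuous : continuous (fun xi => b (H xi)).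
Proof.
rewrite (_ : (fun xi => _) = (fun t : R => b (Num.max 0 t)) \o H); last first.
  by apply/funext => xi /=; rewrite (max_idPr (hyp_H_ge0 xi)).
move=> xi; apply: continuous_comp; first exact: hyp_H_continuous.
exact: (hyp_b_continuous hB).
Qed.

Lemma BH_continuous : continuous (fun xi => B (H xi)).
Proof.
rewrite (_ : (fun xi => _) = (fun t : R => B (Num.max 0 t)) \o H); last first.
  by apply/funext => xi /=; rewrite (max_idPr (hyp_H_ge0 xi)).
move=> xi; apply: continuous_comp; first exact: hyp_H_continuous.
exact: (hyp_B_continuous hB).
Qed.

(** At the origin the gradient of [H] need not have a limit, but its entries are bounded and
    multiplied by [b (H y)], which tends to [b 0 = 0]. *)
Lemma flux_continuous i : continuous (fun xi => flux B H xi ord0 i).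
Proof.
move=> xi; have [->|xi0] := eqVneq xi 0.
  apply/(@cvgrPdist_le _ _ _ _ (nbhs_filter _)) => e e0.
  have f0 : flux B H 0 ord0 i = 0 by rewrite /flux eqxx mxE.
  have e0' : 0 < e / (H (e_ i) + 1) by rewrite divr_gt0// ltr_wpDl// hyp_H_ge0.
  have /(@cvgrPdist_le _ _ _ _ (nbhs_filter _))/(_ _ e0') := @bH_continuous (0 : 'rV[R]_n).
  apply: filterS => y; rewrite hyp_H0 (hyp_b0 hB) f0 !sub0r !normrN.
  rewrite ger0_norm ?(hyp_b_ge0 hB) ?hyp_H_ge0// ler_pdivlMr ?ltr_wpDl ?hyp_H_ge0//.
  apply: le_trans; apply: le_trans (flux_le y i) _.
  by rewrite ler_wpM2l ?lerDl// (hyp_b_ge0 hB) ?hyp_H_ge0.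
have C : {for xi, continuous (fun y => b (H y) * 'D_(e_ i) H y)}.
  apply: continuousM; first exact: bH_continuous.
  by apply: (class_C_continuous (dH_C1 i)).
have xE : flux B H xi ord0 i = b (H xi) * 'D_(e_ i) H xi.
  by rewrite /flux (negbTE xi0) !mxE.
have nOm : \forall y \near xi, Om y by exact: open_nbhs_nbhs.
apply/(@cvgrPdist_le _ _ _ _ (nbhs_filter xi)) => e e0.
have Ce := (@cvgrPdist_le _ _ _ _ (nbhs_filter xi) _ _).1 C e e0.
by apply: filterS2 nOm Ce => y y0; rewrite xE /flux (negbTE y0) !mxE.
Qed.

Lemma flux_dot xi : dot (flux B H xi) xi = b (H xi) * H xi.
Proof.
rewrite /flux; case: eqVneq => [->|xi0]; first by rewrite dot0r hyp_H0 mulr0.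
by rewrite dotZl hyp_H_euler.
Qed.

(** The tangent inequality of [B] at [H xi], followed by that of [H] at [xi]; the sign of [b]
    preserves the direction. At [xi = 0] it amounts to [B >= 0]. *)
Lemma flux_tangent xi eta : B (H xi) + dot (flux B H xi) (eta - xi) <= B (H eta).
Proof.
rewrite dotBr flux_dot /flux; case: eqVneq => [->|xi0].
  by rewrite dot0l hyp_H0 mulr0 subr0 addr0 (hyp_B0 hB) (hyp_B_ge0 hB)// hyp_H_ge0.
rewrite dotZl; apply: le_trans (hyp_B_tangent hB (hyp_H_ge0 eta) (hyp_H_gt0 xi0)).
rewrite lerD2l mulrBr lerD2r ler_wpM2l ?hyp_H_tangent//.
by rewrite (hyp_b_ge0 hB)// hyp_H_ge0.
Qed.

End flux.

End hyp_H.

(** * Integrals depending on a parameter *)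

Section minimum_and_bounds.
Context {R : realType}.

Lemma is_derive_min (f : R -> R) (a d e : R) : 0 < e ->
  (forall h, `|h - a| < e -> f a <= f h) -> is_derive a (1 : R) f d -> d = 0.
Proof.
move=> e0 fmin [df <-]; apply: contrapT => /eqP d0; set D := 'D_1 f a in d0.
have D0 : 0 < `|D| by rewrite normr_gt0.
have : h^-1 *: ((f \o shift a) (h *: 1) - f a) @[h --> (0:R)^'] --> D by exact: df.
move=> /cvgrPdist_lt/(_ _ D0) /nbhs_ballP[r /= r0 rP].
pose t := Num.min r e / 2.
have t0 : 0 < t by rewrite divr_gt0// lt_min r0.
have tr : t < r /\ t < e.
  have h1 : Num.min r e <= r by rewrite ge_min lexx.
  have h2 : Num.min r e <= e by rewrite ge_min lexx orbT.
  by rewrite /t; move: t0; rewrite /t => t0; split; lra.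
(* With a step of sign opposite to [D], minimality makes the difference quotient zero or of sign
   opposite to [D], hence at distance at least [|D|] from [D]. *)
pose h := if 0 < D then - t else t.
have hn : `|h| = t by rewrite /h; case: ifP => _; rewrite ?normrN gtr0_norm.
have h0 : h != 0 by rewrite -normr_gt0 hn.
have := rP h; rewrite /ball/= sub0r normrN hn => /(_ tr.1 h0).
rewrite [h%:A]mulr1.
have : f a <= f (h + a) by apply: fmin; rewrite addrK hn; exact: tr.2.
rewrite -subr_ge0; set q := f (h + a) - f a => q0.
have [Dp|Dn] := ltP 0 D.
  have hE : h = - t by rewrite /h Dp.
  rewrite (gtr0_norm Dp) ltNge => /negP; apply.
  rewrite /GRing.scale/= hE invrN mulNr opprK ger0_norm; last first.
    by rewrite addr_ge0 ?(ltW Dp)// mulr_ge0// invr_ge0 ltW.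
  by rewrite lerDl mulr_ge0// invr_ge0 ltW.
have hE : h = t by rewrite /h ltNge Dn.
have Dn' : D < 0 by rewrite lt_def Dn eq_sym d0.
rewrite (ltr0_norm Dn') ltNge => /negP; apply.
rewrite /GRing.scale/= hE ler0_norm; last first.
  by rewrite subr_le0 (le_trans Dn)// mulr_ge0// invr_ge0 ltW.
by rewrite opprB lerDr mulr_ge0// invr_ge0 ltW.
Qed.

Lemma class_C1P n (f : 'rV[R]_n -> R) (d : 'I_n -> 'rV[R]_n -> R) :
  continuous f -> (forall i x, is_derive x (basis_rV i) f (d i x)) ->
  (forall i, continuous (d i)) -> class_C (@dir_rV R n) 1 setT f.
Proof.
move=> cf df cd [|v [|w s]]//= sE; split => //.
- by move=> _ x _; exact: cf.
- by move=> _ _ x [i _ <-] _; case: (df i x).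
move=> _ x _; have [i _ <-] : dir_rV v by apply: sE; rewrite inE eqxx.
rewrite (_ : 'D_(basis_rV i) f = d i); first exact: cd.
by apply/funext => y; case: (df i y).
Qed.

(** Measurability of [k' a] comes from difference quotients along a sequence of steps tending to 0
    and smaller than [e]. The result makes the derivative integrands integrable, so that their
    integrals can be added. *)
Lemma bbox_is_derive_bbox n (k k' : R -> 'rV[R]_n -> R) (M a e : R) : 0 < e ->
  (forall h, `|h - a| < e -> bbox M (k h)) ->
  (forall h y, `|h - a| < e -> is_derive h (1 : R) (k^~ y) (k' h y)) ->
  (forall h y, `|h - a| < e -> `|k' h y| <= M) -> bbox M (k' a).
Proof.
move=> e0 bk dk k'M.
have aa : `|a - a| < e by rewrite subrr normr0.
split; [|by move=> y; exact: k'M|]; last first.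
  move=> y My; have [_ <-] := dk a y aa.
  rewrite (@near_eq_derive _ _ _ _ (cst 0)) ?derive_cst//.
  apply/nbhs_ballP; exists e => //= h; rewrite /ball/= distrC => ha.
  by have [_ _ ->] := bk h ha.
pose t (j : nat) : R := e / 2 * j.+1%:R^-1.
have t0 j : t j != 0 by rewrite gt_eqF// !mulr_gt0// invr_gt0.
have te j : `|t j + a - a| < e.
  rewrite addrK gtr0_norm ?mulr_gt0 ?invr_gt0 ?ltr0n//.
  apply: (@le_lt_trans _ _ (e / 2)); last by lra.
  by rewrite ger_pMr ?divr_gt0// invf_le1// ler1n.
apply: (@measurable_fun_cvg _ _ _ _ (fun j y => (t j)^-1 * (k (t j + a) y - k a y))).
  move=> j; apply: measurable_funM => //; apply: measurable_funB.
    by have [] := bk _ (te j).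
  by have [] := bk a aa.
move=> y _; have [dv dE] := dk a y aa.
have C : h^-1 *: ((k^~ y \o shift a) (h *: 1) - k a y) @[h --> (0:R)^'] --> k' a y.
  by rewrite -dE; exact: dv.
have tc : t j @[j --> \oo] --> (0 : R).
  rewrite -(mulr0 (e / 2)); apply: cvgM; first exact: cvg_cst.
  exact: cvg_harmonic.
have := (cvgr_dnbhsP _ _ _).1 C t (conj t0 tc).
by under eq_fun do rewrite /= [_%:A]mulr1.
Qed.

Lemma continuous_bounded_prod n (f : 'rV[R]_n * R^o -> R) (r : R) : continuous f ->
  exists2 C, 0 <= C & forall x s, `|x| <= r -> `|s| <= r -> `|f (x, s)| <= C.
Proof.
move=> cf.
pose D := [set x : 'rV[R]_n | forall i, `[- r, r]%classic (x ord0 i)].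
have Dc : compact D.
  by apply: (@rV_compact R n (fun=> `[- r, r]%classic)) => _; exact: segment_compact.
pose I : set R^o := `[- r, r]%classic.
have Ic : compact I by exact: segment_compact.
have [C [Creal CP]] : bounded_set (f @` (D `*` I)).
  apply: compact_bounded; apply: continuous_compact; last exact: compact_setX.
  exact: continuous_subspaceT.
exists (`|C| + 1); first by rewrite addr_ge0.
move=> x s xr sr; apply: (CP (`|C| + 1)); first by rewrite (le_lt_trans (ler_norm C))// ltrDl.
exists (x, s) => //; split => /=; last by rewrite /I /= in_itv/= -ler_norml.
by move=> i /=; rewrite in_itv/= -ler_norml (le_trans (coord_le_norm _ _)).
Qed.

End minimum_and_bounds.

Local Notation integral0 := Defs.integral0.

Section integral0.
Context {R : realType}.
Local Notation leb := (@lebesgue_measure R).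
Implicit Types (h : R -> R) (t : R).

Lemma continuous_itv_integrable h (a c : R) : continuous h ->
  leb.-integrable `[a, c] (EFin \o h).
Proof.
move=> ch; apply: continuous_compact_integrable; first exact: segment_compact.
exact: continuous_subspaceT.
Qed.

(** A base point to the left of both 0 and [t] gives one formula for both signs of [t], to which the
    fundamental theorem of calculus applies. *)
Lemma integral0E h (a t : R) : continuous h -> a < 0 -> a < t ->
  integral0 h t = \int[leb]_(s in `[a, t]) h s - \int[leb]_(s in `[a, 0]) h s.
Proof.
move=> ch a0 at_; rewrite /integral0.
have itvE (c d : R) : a <= c -> c <= d ->
    \int[leb]_(s in `[a, d]) h s - \int[leb]_(s in `[a, c]) h s = \int[leb]_(s in `[c, d]) h s.
  move=> ac cd; rewrite Rintegral_itvB//; last exact: continuous_itv_integrable.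
  rewrite Rintegral_itv_obnd_cbnd//.
  apply: (integrableS _ _ _ (@continuous_itv_integrable h c d ch)) => //.
  exact: subset_itv_oc_cc.
case: ifPn => [t0|]; first by rewrite itvE// ltW.
rewrite -ltNge => t0; rewrite -(itvE t 0) ?opprB// ltW//.
Qed.

Lemma integral0_is_derive h t : continuous h -> is_derive t (1 : R) (integral0 h) (h t).
Proof.
move=> ch; pose a := Num.min 0 t - 1.
have a0 : a < 0 by rewrite /a ltrBlDr add0r (le_lt_trans _ ltr01)// ge_min lexx.
have at_ : a < t by rewrite /a ltrBlDr (le_lt_trans (_ : _ <= t)) ?ltrDl// ge_min lexx orbT.
have [dJ JE] : derivable (fun s => \int[leb]_(r in `[a, s]) h r) t 1 /\
    (fun s => \int[leb]_(r in `[a, s]) h r)^`()%classic t = h t.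
  apply: (@continuous_FTC1 R h (BLeft a) t (t + 1)); rewrite ?ltrDl ?bnd_simp//.
  - exact: continuous_itv_integrable.
  - exact: ch.
have J : is_derive t (1 : R) (fun s => \int[leb]_(r in `[a, s]) h r) (h t).
  by apply: DeriveDef; [exact: dJ|rewrite -derive1E; exact: JE].
have D : is_derive t (1 : R) (fun s => \int[leb]_(r in `[a, s]) h r -
    (fun=> \int[leb]_(r in `[a, 0]) h r) s) (h t - 0).
  by apply: (is_derive1B J).
rewrite subr0 in D; apply: near_eq_is_derive D.
have : \forall y \near t, a < y by exact: lt_nbhsr.
by apply: filterS => y ay; rewrite (integral0E ch a0 ay).
Qed.

Let itv_sum n (c : 'I_n -> R) (h : 'I_n -> R -> R) (a d : R) : (forall i, continuous (h i)) ->
  \int[leb]_(s in `[a, d]) (\sum_i c i * h i s) =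
  \sum_i c i * \int[leb]_(s in `[a, d]) h i s.
Proof.
move=> ch.
have cc (r : seq 'I_n) : continuous (fun s => \sum_(i <- r) c i * h i s).
  apply: continuous_big => [|i _]; first exact: add_continuous.
  by move=> x; apply: continuousM; [exact: cst_continuous|exact: ch].
have ci i : continuous (fun s => c i * h i s).
  by move=> x; apply: continuousM; [exact: cst_continuous|exact: ch].
elim: (index_enum _) => [|i r IH].
  by under eq_Rintegral do rewrite big_nil; rewrite big_nil Rintegral_cst// mul0r.
rewrite big_cons -IH -RintegralZl//; last exact: continuous_itv_integrable.
rewrite -RintegralD//; [|exact: continuous_itv_integrable..].
by apply: eq_Rintegral => s _; rewrite big_cons.
Qed.

Lemma integral0_sum n (c : 'I_n -> R) (h : 'I_n -> R -> R) t : (forall i, continuous (h i)) ->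
  integral0 (fun s => \sum_i c i * h i s) t = \sum_i c i * integral0 (h i) t.
Proof.
move=> ch; rewrite /integral0; case: ifP => _; rewrite itv_sum//.
by rewrite -sumrN; apply: eq_bigr => i _; rewrite mulrN.
Qed.

Let itv_le h (a d C : R) : a <= d -> continuous h -> (forall s, a <= s <= d -> `|h s| <= C) ->
  `|\int[leb]_(s in `[a, d]) h s| <= C * (d - a).
Proof.
move=> ad ch hC.
have mI : measurable (`[a, d]%classic : set (measurableTypeR R)) by exact: measurable_itv.
apply: le_trans (le_normr_Rintegral mI (continuous_itv_integrable a d ch)) _.
rewrite (_ : C * (d - a) = \int[leb]_(s in `[a, d]) (cst C) s); last first.
  rewrite Rintegral_cst//= lebesgue_measure_itv/= lte_fin.
  by move: ad; rewrite le_eqVlt => /predU1P[->|ad]; rewrite ?ltxx ?subrr// ad -EFinB.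
apply: le_Rintegral => //.
- exact: (integrable_norm (continuous_itv_integrable a d ch)).
- by apply: continuous_itv_integrable; exact: cst_continuous.
Qed.

Lemma integral0_le h t (C : R) : continuous h -> (forall s, `|s| <= `|t| -> `|h s| <= C) ->
  `|integral0 h t| <= C * `|t|.
Proof.
move=> ch hC; rewrite /integral0; case: ifPn => t0.
  rewrite (ger0_norm t0) -[t in _ * t]subr0; apply: itv_le => // s /andP[s0 st].
  by apply: hC; rewrite !ger0_norm// (le_trans s0).
rewrite -ltNge in t0; rewrite normrN (ltr0_norm t0) -[- t]sub0r.
apply: itv_le; rewrite ?(ltW t0)// => s /andP[s0 st].
by apply: hC; rewrite ler0_norm// ltr0_norm// lerN2.
Qed.

Let itv_param_is_derive (k k' : R -> R -> R) (c d M a e : R) : 0 < e ->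
  (forall l, `|l - a| < e -> continuous (k l)) ->
  (forall l s, `|l - a| < e -> is_derive l (1 : R) (k^~ s) (k' l s)) ->
  (forall l s, `|l - a| < e -> c <= s <= d -> `|k' l s| <= M) ->
  is_derive a (1 : R) (fun l => \int[leb]_(s in `[c, d]) k l s) (\int[leb]_(s in `[c, d]) k' a s).
Proof.
move=> e0 ck dk k'M.
have I l : `]a - e, a + e[%classic l -> `|l - a| < e.
  by rewrite /= in_itv/= ltr_distl.
have Ia : `]a - e, a + e[%classic a by rewrite /= in_itv/= ltrBlDr ltrDl e0.
have intk l : `]a - e, a + e[%classic l -> leb.-integrable `[c, d] (EFin \o k l).
  by move=> /I /ck; exact: continuous_itv_integrable.
have derk l s : `]a - e, a + e[%classic l -> `[c, d]%classic s -> derivable (k^~ s) l 1.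
  by move=> /I Ih _; have [] := dk l s Ih.
have domk l s : `]a - e, a + e[%classic l -> `[c, d]%classic s ->
    `|lebesgue_integral_under.partial1of2 k l s| <= (cst `|M|) s.
  move=> Ih cs; rewrite lebesgue_integral_under.partial1of2E.
  have := dk l s (I _ Ih) => /@derive_val ->.
  by rewrite (le_trans (k'M l s (I _ Ih) _)) ?ler_norm.
have M0 s : 0 <= (cst `|M| : R -> R) s by rewrite /=.
have intM : leb.-integrable `[c, d] (EFin \o (cst `|M| : R -> R)).
  by apply: continuous_itv_integrable; exact: cst_continuous.
have mI : measurable (`[c, d]%classic : set (measurableTypeR R)) by exact: measurable_itv.
have dk' := @lebesgue_integral_under.derivable_under_integral R _ _ leb k _ mI a
  (a - e) (a + e) Ia intk derk _ M0 intM domk.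
have := @lebesgue_integral_under.differentiation_under_integral R _ _ leb k _ mI a
  (a - e) (a + e) Ia intk derk _ M0 intM domk.
rewrite derive1E => kE; apply: DeriveDef; first exact: dk'.
rewrite kE.
apply: eq_Rintegral => y _; rewrite lebesgue_integral_under.partial1of2E.
by apply: derive_val; apply: dk; rewrite subrr normr0.
Qed.

Lemma integral0_param_is_derive (k k' : R -> R -> R) t (M a e : R) : 0 < e ->
  (forall l, `|l - a| < e -> continuous (k l)) ->
  (forall l s, `|l - a| < e -> is_derive l (1 : R) (k^~ s) (k' l s)) ->
  (forall l s, `|l - a| < e -> `|s| <= `|t| -> `|k' l s| <= M) ->
  is_derive a (1 : R) (fun l => integral0 (k l) t) (integral0 (k' a) t).
Proof.
move=> e0 ck dk k'M; rewrite /integral0; have [t0|t0] := leP 0 t.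
  apply: (itv_param_is_derive e0 ck dk (M := M)) => l s la /andP[s0 st].
  by apply: k'M => //; rewrite !ger0_norm// (le_trans s0).
rewrite -mulN1r.
apply: (@is_derive1_ext _ (fun l => -1 * \int[leb]_(s in `[t, 0]) k l s)).
  by move=> l; rewrite mulN1r.
apply: is_derive1Ml.
apply: (itv_param_is_derive e0 ck dk (M := M)) => l s la /andP[s0 st].
by apply: k'M => //; rewrite ler0_norm// ltr0_norm// lerN2.
Qed.

End integral0.

Lemma scale_is_derive {R : realType} n (x : 'rV[R]_n) (l : R) :
  is_derive l (1 : R) (fun l : R => l *: x) x.
Proof.
have := @is_derive_line R 'rV[R]_n 'rV[R]_n id 0 x l x (is_derive_id _ _).
by congr is_derive; apply/funext => t /=; rewrite addr0.
Qed.

Lemma scale_continuous {R : realType} n (x : 'rV[R]_n) : continuous (fun l : R => l *: x).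
Proof.
move=> l; apply: differentiable_continuous; apply/derivable1_diffP.
by case: (scale_is_derive x l).
Qed.

(** * The primitive of g and its derivative along rays *)

Section primitive.
Context {R : realType} (n : nat).
Variable g : 'rV[R]_n -> R -> R.
Hypothesis g_C1 : class_C (@dir_rV_R R n) 1 setT (fun z => g z.1 z.2).
Local Notation e_ i := (basis_rV i : 'rV[R]_n).
Implicit Types (x y : 'rV[R]_n) (s t l : R).

Let gi i x s := 'D_(e_ i) (g^~ s) x.

Let dirE i : @dir_rV_R R n (e_ i, 0 : R^o).
Proof. by left; split => //; exact: dir_rV_basis. Qed.

Lemma g_continuous : continuous (fun z : 'rV[R]_n * R^o => g z.1 z.2).
Proof. by move=> z; exact: class_C_continuous g_C1 _. Qed.

(** A step along [(e_ i, 0)] leaves the second component alone, so partial derivatives of a slice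
    [g^~ s] are directional derivatives of [g] on the product. *)
Let pairE i x s : (fun h : R => h^-1 *: (((fun z : 'rV[R]_n * R^o => g z.1 z.2) \o shift (x, s : R^o))
      (h *: (e_ i, 0 : R^o)) - g x s)) =
  (fun h : R => h^-1 *: (((g^~ s) \o shift x) (h *: e_ i) - g x s)).
Proof. by apply/funext => h /=; rewrite scaler0 add0r. Qed.

Lemma g_derivable i x s : derivable (g^~ s) x (e_ i).
Proof.
have [//|_] := g_C1 (s := [::]) _.
move=> /(_ isT _ (x, s : R^o) (dirE i) Logic.I).
by rewrite /derivable pairE.
Qed.

Lemma gi_continuous i : continuous (fun z : 'rV[R]_n * R^o => gi i z.1 z.2).
Proof.
have -> : (fun z : 'rV[R]_n * R^o => gi i z.1 z.2) =
    'D_(e_ i, 0 : R^o) (fun z : 'rV[R]_n * R^o => g z.1 z.2).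
  by apply/funext => -[x s]; rewrite /gi /derive pairE.
by move=> z; exact: (class_C_continuous_derive g_C1 (dirE i)).
Qed.

Let pair_continuousl (f : 'rV[R]_n * R^o -> R) x :
  continuous f -> continuous (fun s : R => f (x, s)).
Proof.
move=> cf s; apply: (@continuous_comp _ _ _ (fun s : R => (x, s : R^o)) f); last exact: cf.
have xs : (fun=> x) r @[r --> s] --> x by exact: cvg_cst.
exact: (@cvg_pair _ _ _ (nbhs s) (nbhs x) (nbhs (s : R^o)) (nbhs_filter s)
  (nbhs_filter x) (nbhs_filter (s : R^o)) (fun=> x) id xs (@cvg_id _ _)).
Qed.

Let pair_continuousr (f : 'rV[R]_n * R^o -> R) s :
  continuous f -> continuous (fun x => f (x, s)).
Proof.
move=> cf x; apply: (@continuous_comp _ _ _ (fun x => (x, s : R^o)) f); last exact: cf.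
have sx : {for x, continuous (fun=> s : R^o)} by exact: cst_continuous.
exact: (@cvg_pair _ _ _ (nbhs x) (nbhs x) (nbhs (s : R^o)) (nbhs_filter x)
  (nbhs_filter x) (nbhs_filter (s : R^o)) id (fun=> s : R^o) (@cvg_id _ _) sx).
Qed.

Lemma g_continuous2 x : continuous (g x).
Proof. exact: (pair_continuousl (x := x) g_continuous). Qed.

Let gi_continuous2 i x : continuous (gi i x).
Proof. exact: (pair_continuousl (x := x) (gi_continuous (i := i))). Qed.

Lemma g_slice_C1 s : class_C (@dir_rV R n) 1 setT (g^~ s).
Proof.
apply: (@class_C1P _ _ _ (fun i x => gi i x s)).
- exact: (pair_continuousr (s := s) g_continuous).
- by move=> i x; apply: derivableP; exact: g_derivable.
- by move=> i; exact: (pair_continuousr (s := s) (gi_continuous (i := i))).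
Qed.

Lemma g_bounded (r : R) : exists2 C, 0 <= C & forall x s, `|x| <= r -> `|s| <= r -> `|g x s| <= C.
Proof. exact: (continuous_bounded_prod r g_continuous). Qed.

Lemma gi_bounded (r : R) : exists2 C, 0 <= C &
  forall i x s, `|x| <= r -> `|s| <= r -> `|'D_(e_ i) (g^~ s) x| <= C.
Proof.
have /choice[C CP] : forall i, exists C, 0 <= C /\ forall x s, `|x| <= r -> `|s| <= r -> `|gi i x s| <= C.
  by move=> i; have [C C0 CP] := continuous_bounded_prod r (gi_continuous (i := i)); exists C.
exists (\sum_i C i); first by apply: sumr_ge0 => i _; case: (CP i).
move=> i x s xr sr; apply: le_trans ((CP i).2 x s xr sr) _.
rewrite (bigD1 i)//= lerDl; apply: sumr_ge0 => j _; by case: (CP j).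
Qed.

Lemma grad_x_primitive_le (r : R) : exists2 C, 0 <= C &
  forall i x t, `|x| <= r -> `|t| <= r -> `|grad_x_primitive g x t ord0 i| <= C.
Proof.
have [C C0 CP] := gi_bounded r.
exists (C * `|r|); first by rewrite mulr_ge0.
move=> i x t xr tr; rewrite mxE.
apply: le_trans (integral0_le (C := C) _ _) _.
- exact: gi_continuous2.
- by move=> s st; apply: CP => //; exact: le_trans tr.
- by rewrite ler_wpM2l// (le_trans tr)// ler_norm.
Qed.

Lemma primitive_le (r : R) : exists2 C, 0 <= C &
  forall x t, `|x| <= r -> `|t| <= r -> `|primitive g x t| <= C.
Proof.
have [C C0 CP] := g_bounded r.
exists (C * `|r|); first by rewrite mulr_ge0.
move=> x t xr tr; rewrite /primitive.
apply: le_trans (integral0_le (C := C) _ _) _.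
- exact: g_continuous2.
- by move=> s st; apply: CP => //; exact: le_trans tr.
- by rewrite ler_wpM2l// (le_trans tr)// ler_norm.
Qed.

Let primitive_param x t l0 :
  is_derive l0 (1 : R) (fun l => primitive g (l *: x) t)
    (dot x (grad_x_primitive g (l0 *: x) t)).
Proof.
pose k l s := g (l *: x) s.
pose k' l s := \sum_i x ord0 i * gi i (l *: x) s.
have dk l s : is_derive l (1 : R) (k^~ s) (k' l s).
  have := C1_is_derive_curve openT (g_slice_C1 s) (c := fun l => l *: x) Logic.I (scale_is_derive x l).
  congr is_derive; rewrite dotC /dot; apply: eq_bigr => i _; by rewrite mxE.
pose r := Num.max ((`|l0| + 1) * `|x|) `|t|.
have [C C0 CP] := gi_bounded r.
have := @integral0_param_is_derive _ k k' t (\sum_i `|x ord0 i| * C) l0 1 ltr01.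
have -> : dot x (grad_x_primitive g (l0 *: x) t) = integral0 (k' l0) t.
  rewrite integral0_sum; last by move=> i; exact: gi_continuous2.
  by apply: eq_bigr => i _; rewrite mxE.
apply.
- by move=> l _; exact: g_continuous2.
- move=> l s ll st; apply: le_trans (ler_norm_sum _ _ _) _.
  apply: ler_sum => i _; rewrite normrM ler_wpM2l// CP//.
    rewrite normrZ /r le_max ler_wpM2r// -[l](subrK l0) (le_trans (ler_normD _ _))//.
    by rewrite addrC lerD2l ltW.
  by rewrite /r le_max st orbT.
Qed.

Variable u : 'rV[R]_n -> R.
Hypothesis u_C1 : class_C (@dir_rV R n) 1 setT u.

Lemma u_scale_is_derive x l : is_derive l (1 : R) (fun l => u (l *: x)) (dot (gradient u (l *: x)) x).
Proof. exact: (C1_is_derive_curve openT u_C1 (c := fun l => l *: x) Logic.I (scale_is_derive x l)). Qed.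

(** With [T l = u (l *: x)], the part where [T] is frozen at [l0] is [primitive_param]. The rest
    [Q l] equals [g (l *: x) (tau l) * (T l - T l0)] for some [tau l] between [T l0] and [T l], by
    the mean value theorem in the second variable; its difference quotient converges because [g] is
    continuous and [T] derivable. *)
Lemma primitive_is_derive x l0 :
  is_derive l0 (1 : R) (fun l => primitive g (l *: x) (u (l *: x)))
    (dot x (grad_x_primitive g (l0 *: x) (u (l0 *: x))) +
     g (l0 *: x) (u (l0 *: x)) * dot (gradient u (l0 *: x)) x).
Proof.
pose T (l : R) := u (l *: x).
pose Q (l : R) := primitive g (l *: x) (T l) - primitive g (l *: x) (T l0).
have /choice[tau tauP] : forall l : R, exists tau : R, `|tau - T l0| <= `|T l - T l0| /\
    Q l = g (l *: x) tau * (T l - T l0).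
  move=> l; have dK s : is_derive s (1 : R) (primitive g (l *: x)) (g (l *: x) s).
    by apply: integral0_is_derive; exact: g_continuous2.
  have cK a c : {within `[a, c], continuous (primitive g (l *: x))}.
    by apply: derivable_within_continuous => s _; case: (dK s).
  have [TT|TT] := leP (T l0) (T l).
    have [tau + QE] := MVT_segment TT (fun s _ => dK s) (cK _ _).
    rewrite in_itv/= => /andP[t1 t2]; exists tau; split => //.
    by rewrite !ger0_norm ?subr_ge0// lerD2r.
  have [tau + QE] := MVT_segment (ltW TT) (fun s _ => dK s) (cK _ _).
  rewrite in_itv/= => /andP[t1 t2]; exists tau; split => //.
    by rewrite !ler0_norm ?subr_le0 ?(ltW TT)// lerN2 lerD2r.
  by rewrite /Q -opprB QE -mulrN opprB.
pose q (l : R) := g (l *: x) (tau l).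
have dT := u_scale_is_derive x l0.
have cT : {for l0, continuous T}.
  by apply: differentiable_continuous; apply/derivable1_diffP; case: dT.
have ctau : tau l @[l --> l0] --> T l0.
  apply/cvgrPdist_le => e e0.
  have := (@cvgrPdist_le _ _ _ _ (nbhs_filter l0) _ _).1 cT e e0.
  apply: filterS => l Tl; rewrite distrC (le_trans (tauP l).1)//.
  by rewrite distrC.
have cq : q l @[l --> l0] --> g (l0 *: x) (T l0).
  apply: (@cvg_comp _ _ _ (fun l => (l *: x, tau l : R^o))
     (fun z : 'rV[R]_n * R^o => g z.1 z.2) _ (nbhs (l0 *: x, T l0 : R^o))).
    exact: (@cvg_pair _ _ _ (nbhs l0) (nbhs (l0 *: x)) (nbhs (T l0 : R^o)) (nbhs_filter l0)
      (nbhs_filter _) (nbhs_filter (T l0 : R^o)) (fun l => l *: x) tau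
      (@scale_continuous _ _ x l0) ctau).
  exact: (@g_continuous (l0 *: x, T l0 : R^o)).
have Q0 : Q l0 = 0 by rewrite /Q subrr.
have dQ : is_derive l0 (1 : R) Q (g (l0 *: x) (T l0) * dot (gradient u (l0 *: x)) x).
  have H : h^-1 *: ((Q \o shift l0) (h *: 1) - Q l0) @[h --> (0:R)^'] -->
      g (l0 *: x) (T l0) * dot (gradient u (l0 *: x)) x.
    have -> : (fun h : R => h^-1 *: ((Q \o shift l0) (h *: 1) - Q l0)) =
        (fun h : R => q (h + l0) * (h^-1 *: ((T \o shift l0) (h *: 1) - T l0))).
      apply/funext => h; rewrite Q0 subr0 /= [h%:A]mulr1 (tauP _).2 /q.
      by rewrite /GRing.scale/= mulrCA.
    apply: cvgM; last by case: dT => dTd <-; exact: dTd.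
    apply: cvg_within_filter.
    apply: (@cvg_comp _ _ _ (fun h : R => h + l0) q _ (nbhs l0)); last exact: cq.
    rewrite -{2}[l0]add0r; apply: cvgD; [exact: cvg_id|exact: cvg_cst].
  by apply: DeriveDef; [exact: cvgP H|exact: cvg_lim H].
apply: is_derive1_ext (is_derive1D (primitive_param x (T l0) l0) dQ) => l.
by rewrite /Q addrC subrK.
Qed.

End primitive.

Lemma continuous_rV {R : realType} (T : topologicalType) n (A : T -> 'rV[R]_n) :
  (forall i, continuous (fun x => A x ord0 i)) -> continuous A.
Proof.
move=> cA x; apply/(@cvgrPdist_le _ _ _ _ (nbhs_filter x)) => e e0.
have H i : \forall y \near x, `|A x ord0 i - A y ord0 i| <= e.
  exact: (@cvgrPdist_le _ _ _ _ (nbhs_filter x) _ _).1 (cA i x) e e0.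
have := filter_forall (nbhs_filter x) H.
apply: filterS => y Hy; apply: norm_rV_le; first exact: ltW.
by move=> i; rewrite !mxE.
Qed.

Lemma dot_continuous2 {R : realType} (T : topologicalType) n (A C : T -> 'rV[R]_n) :
  (forall i, continuous (fun x => A x ord0 i)) ->
  (forall i, continuous (fun x => C x ord0 i)) -> continuous (fun x => dot (A x) (C x)).
Proof.
move=> cA cC; apply: continuous_big => [|i _]; first exact: add_continuous.
by move=> x; apply: continuousM; [exact: cA|exact: cC].
Qed.

Lemma dot_le {R : realType} n (x y : 'rV[R]_n) (C : 'I_n -> R) (r : R) :
  (forall i, `|x ord0 i| <= C i) -> `|y| <= r -> `|dot x y| <= \sum_i C i * r.
Proof.
move=> xC yr; apply: le_trans (ler_norm_sum _ _ _) _; apply: ler_sum => i _.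
by rewrite normrM ler_pM// (le_trans (coord_le_norm _ _)).
Qed.

(** * The localized identity *)

Section local_identity.
Context {R : realType} (m : nat) (beta : R).
Local Notation n := m.+1.
Variables (g : 'rV[R]_n -> R -> R) (H : 'rV[R]_n -> R) (B : R -> R) (u : 'rV[R]_n -> R).
Hypotheses (g_C1 : class_C (@dir_rV_R R n) 1 setT (fun z => g z.1 z.2))
  (hH : hyp_H beta H) (hB : hyp_B beta 0 B) (u_sol : weak_solution B H g u)
  (mG : measurable_fun setT (fun x => primitive g x (u x))).
Local Notation mu := (lebesgue_rV R n).
Local Notation Int f := (Rintegral mu setT f).
Local Notation b := (half_derive B).
Local Notation e_ i := (basis_rV i : 'rV[R]_n).
Local Notation U := (gradient u).
Local Notation a := (flux B H).
Implicit Types (x y : 'rV[R]_n) (l q : R).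
Let f x := g x (u x).

Let u_C1 : class_C (@dir_rV R n) 1 setT u. Proof. by case: u_sol. Qed.

Lemma u_continuous : continuous u.
Proof. by move=> x; exact: class_C_continuous u_C1 _. Qed.

Lemma U_continuous i : continuous (fun x => U x ord0 i).
Proof. exact: gradient_continuous. Qed.

Let cU : continuous U. Proof. exact: continuous_rV U_continuous. Qed.

Lemma f_continuous : continuous f.
Proof.
move=> x; apply: (@continuous_comp _ _ _ (fun x => (x, u x : R^o))
  (fun z : 'rV[R]_n * R^o => g z.1 z.2)); last exact: g_continuous.
exact: (@cvg_pair _ _ _ (nbhs x) (nbhs x) (nbhs (u x : R^o)) (nbhs_filter x)
  (nbhs_filter x) (nbhs_filter (u x : R^o)) id u (@cvg_id _ _) (@u_continuous x)).
Qed.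

Lemma aU_continuous i : continuous (fun x => a (U x) ord0 i).
Proof.
move=> x; apply: (@continuous_comp _ _ _ U (fun xi => a xi ord0 i)); first exact: cU.
exact: (flux_continuous hH hB).
Qed.

Let HU_continuous : continuous (fun x => H (U x)).
Proof.
by move=> x; apply: (@continuous_comp _ _ _ U H); [exact: cU|exact: (hyp_H_continuous hH)].
Qed.

Let BlHU_continuous l : 0 <= l -> continuous (fun x => B (l * H (U x))).
Proof.
move=> l0; rewrite (_ : (fun x => _) = (fun xi => B (H xi)) \o (fun x => l *: U x)); last first.
  by apply/funext => x /=; rewrite (hyp_HZ hH) ger0_norm.
move=> x; apply: continuous_comp; last exact: (BH_continuous hH hB).
by apply: (@continuousZr _ _ _ U); exact: cU.
Qed.

Section psi.
Variables (psi : 'rV[R]_n -> R) (r : R).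
Hypotheses (psiC1 : class_C (@dir_rV R n) 1 setT psi) (psi_ge0 : forall x, 0 <= psi x)
  (r0 : 0 < r) (psi0 : forall x, r < `|x| -> psi x = 0).
Local Notation G := (gradient psi).

Let cpsi : continuous psi.
Proof. by move=> x; exact: class_C_continuous psiC1 _. Qed.

Let cG i : continuous (fun x => G x ord0 i).
Proof. exact: gradient_continuous. Qed.

Let G0 x : r < `|x| -> G x = 0.
Proof. by move=> rx; apply/rowP => i; rewrite !mxE (derive_out psi0). Qed.

Let psi_bounded : exists2 C, 0 <= C & forall x, `|psi x| <= C.
Proof.
have [M bM] := continuous_bbox cpsi psi0.
by exists M; [exact: bbox_ge0 bM|case: bM].
Qed.

Let G_bounded : exists C : 'I_n -> R, forall i, 0 <= C i /\ forall x, `|G x ord0 i| <= C i.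
Proof.
have /choice[C CP] : forall i, exists c, 0 <= c /\ forall x, `|G x ord0 i| <= c.
  move=> i; have Gi0 x : r < `|x| -> G x ord0 i = 0 by move=> /G0 ->; rewrite mxE.
  have [M bM] := continuous_bbox (cG (i := i)) Gi0.
  by exists M; split; [exact: bbox_ge0 bM|case: bM].
by exists C.
Qed.

Let cs_integrable (h : 'rV[R]_n -> R) : continuous h -> (forall x, r < `|x| -> h x = 0) ->
  mu.-integrable setT (EFin \o h).
Proof. by move=> ch h0; have [M bM] := continuous_bbox ch h0; exact: bbox_integrable bM. Qed.

(* The change of variables [y = l x] turns the weight [psi x] into [W l^-1 y]. *)
Let W (q : R) y := q ^+ n * psi (q *: y).
Let W' (q : R) y := n%:R * q ^+ m * psi (q *: y) + q ^+ n * dot (G (q *: y)) y.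

Let psi_scale_continuous q : continuous (fun y => psi (q *: y)).
Proof.
move=> y; apply: (@continuous_comp _ _ _ (fun y => q *: y) psi); last exact: cpsi.
exact: continuousZr.
Qed.

Let W_continuous q : continuous (W q).
Proof.
move=> y; apply: (@continuousM _ _ (fun=> q ^+ n) (fun y => psi (q *: y))).
  exact: cst_continuous.
exact: psi_scale_continuous.
Qed.

Let W_is_derive q y : is_derive q (1 : R) (W^~ y) (W' q y).
Proof.
apply: is_derive1M.
  apply: DeriveDef; first exact: exprn_derivable.
  by rewrite exp_derive [LHS]mulr1.
exact: (C1_is_derive_curve openT psiC1 (c := fun q => q *: y) Logic.I (scale_is_derive y q)).
Qed.

(** The derivative of [W l^-1 y] in [l] at 1, which is minus the divergence of [y |-> psi(y) y]. *)
Let dpsi y := - (n%:R * psi y + dot (G y) y).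

Let inv_is_derive (l : R) : 0 < l -> is_derive l (1 : R) (fun l : R => l^-1) (- l ^- 2).
Proof.
move=> l0; have ln0 : l != 0 by rewrite gt_eqF.
have [dv ev] := @is_deriveV R (@idfun R) l 1 1 ln0 (is_derive_id _ _).
by apply: DeriveDef => //; rewrite [LHS]ev /= [_%:A]mulr1.
Qed.

(** Keeping [l] within 1/2 of 1 puts the supports of all the dilated cutoffs [psi (l^-1 *: y)] in
    the ball of radius [2 * r] and bounds the powers of [l^-1]. *)
Let near1 (l : R) : `|l - 1| < 2^-1 -> [/\ 0 < l, l <= 2, 0 < l^-1, l^-1 <= 2 & 2^-1 < l^-1].
Proof.
rewrite ltr_distl => /andP[l1 l2]; have l0 : 0 < l by lra.
split => //; [by lra|by rewrite invr_gt0| |].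
- by rewrite -[2]invrK lef_pV2 ?posrE ?invr_gt0//; lra.
- by rewrite ltf_pV2 ?posrE//; lra.
Qed.

Let out_scale (q : R) y : 2^-1 < q -> 2 * r < `|y| -> r < `|q *: y|.
Proof.
move=> q2 ry; have q0 : 0 < q by lra.
rewrite normrZ (gtr0_norm q0).
have h : 2^-1 * (2 * r) < q * `|y| by apply: ltr_pM => //; rewrite mulr_ge0// ltW.
by move: h; rewrite mulrA mulVf ?mul1r// pnatr_eq0.
Qed.

(** Applied to the energy density [B (l * H (U y))] and to the primitive of [g] along [u], which
    does not depend on [l] once the dilation has been moved to the weight. *)
Lemma weighted_is_derive (h h' : R -> 'rV[R]_n -> R) (C : R) :
  (forall l, `|l - 1| < 2^-1 -> measurable_fun setT (h l)) ->
  (forall l y, `|l - 1| < 2^-1 -> `|y| <= 2 * r -> `|h l y| <= C) ->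
  (forall l y, `|l - 1| < 2^-1 -> `|y| <= 2 * r -> `|h' l y| <= C) ->
  (forall l y, `|l - 1| < 2^-1 -> is_derive l (1 : R) (h^~ y) (h' l y)) ->
  let D y := dpsi y * h 1 y + psi y * h' 1 y in
  is_derive (1 : R) (1 : R) (fun l => Int (fun y => W l^-1 y * h l y)) (Int D) /\
  exists M, bbox M D.
Proof.
move=> mh hC h'C dh D.
have [Cp Cp0 psiC] := psi_bounded; have [CG CGP] := G_bounded.
pose k l y := W l^-1 y * h l y.
pose k' l y := W' l^-1 y * (- l ^- 2) * h l y + W l^-1 y * h' l y.
have e0 : 0 < 2^-1 :> R by rewrite invr_gt0.
have k'1 : k' 1 = D.
  apply/funext => y; rewrite /k' /D /W /W' /dpsi invr1 expr1n !expr1n scale1r invr1; ring.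
(* [CW] bounds [W l^-1] and [CW'] the derivative of [W l^-1 y] in [l]: powers of [l^-1] are bounded
   by powers of 2, the final [4] bounds the factor [l ^- 2] of the inner derivative, and
   [|y| <= 2 * r]. *)
pose CW := 2 ^+ n * Cp.
pose CW' := (n%:R * 2 ^+ m * Cp + 2 ^+ n * \sum_i CG i * (2 * r)) * 4.
have C0 : 0 <= C by apply: le_trans (hC 1 0 _ _); rewrite ?subrr ?normr0// mulr_ge0// ltW.
have CW0 : 0 <= CW by rewrite mulr_ge0// exprn_ge0.
have qX (q : R) j : 0 < q -> q <= 2 -> 0 <= q ^+ j <= 2 ^+ j.
  by move=> q0 q2; rewrite exprn_ge0 ?(ltW q0)//= lerXn2r// nnegrE ltW.
have WC l y : `|l - 1| < 2^-1 -> `|W l^-1 y| <= CW.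
  move=> /near1[_ _ q0 q2 _]; have /andP[X0 X2] := qX _ n q0 q2.
  by rewrite normrM (ger0_norm X0) ler_pM.
have W'C l y : `|l - 1| < 2^-1 -> `|y| <= 2 * r -> `|W' l^-1 y * (- l ^- 2)| <= CW'.
  move=> /near1[_ _ q0 q2 _] yr.
  have /andP[X0 X2] := qX _ n q0 q2; have /andP[Y0 Y2] := qX _ m q0 q2.
  have /andP[Z0 Z2] := qX _ 2%N q0 q2.
  rewrite normrM; apply: ler_pM => //; last first.
    by rewrite normrN -exprVn ger0_norm// (le_trans Z2)//; lra.
  apply: le_trans (ler_normD _ _) _; apply: lerD.
    by rewrite normrM ler_pM// normrM (ger0_norm Y0) (ger0_norm (ler0n _ _)) ler_wpM2l.
  by rewrite normrM (ger0_norm X0) ler_pM// dot_le// => i; case: (CGP i).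
have Wout l y : `|l - 1| < 2^-1 -> 2 * r < `|y| -> W l^-1 y = 0.
  by move=> /near1[_ _ _ _ q2] yr; rewrite /W psi0 ?mulr0//; exact: out_scale.
have W'out l y : `|l - 1| < 2^-1 -> 2 * r < `|y| -> W' l^-1 y = 0.
  move=> /near1[_ _ _ _ q2] yr; have qr := out_scale q2 yr.
  by rewrite /W' psi0// G0// dot0l !mulr0 addr0.
pose M := Num.max (Num.max (CW * C) (CW' * C + CW * C)) (2 * r).
have M0 : 0 <= M by rewrite /M !le_max mulr_ge0.
have bk l : `|l - 1| < 2^-1 -> bbox M (k l).
  move=> l1; split.
  - apply: measurable_funM; last exact: mh.
    by apply: continuous_rV_measurable; exact: W_continuous.
  - move=> y; have [yr|yr] := leP `|y| (2 * r); last by rewrite /k Wout// mul0r normr0.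
    by rewrite /M !le_max /k normrM ler_pM// ?WC// hC.
  - by move=> y; rewrite /M gt_max => /andP[_ yr]; rewrite /k Wout// mul0r.
have dk l y : `|l - 1| < 2^-1 -> is_derive l (1 : R) (k^~ y) (k' l y).
  move=> l1; have [l0 _ _ _ _] := near1 l1.
  apply: (is_derive1M (f := fun l => W l^-1 y)); last exact: dh.
  exact: (is_derive1_chain (W_is_derive l^-1 y) (inv_is_derive l0)).
have k'M l y : `|l - 1| < 2^-1 -> `|k' l y| <= M.
  move=> l1; have [yr|yr] := leP `|y| (2 * r); last first.
    by rewrite /k' Wout// W'out// !mul0r addr0 normr0.
  apply: (@le_trans _ _ (CW' * C + CW * C)); last by rewrite /M !le_max lexx orbT.
  apply: le_trans (ler_normD _ _) _; apply: lerD; rewrite normrM ler_pM// ?WC ?W'C ?hC ?h'C//.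
split; last by exists M; rewrite -k'1; exact: (bbox_is_derive_bbox e0 bk dk k'M).
by rewrite -k'1; exact: (bbox_is_derive e0 bk dk k'M).
Qed.

(** The counterpart with a weight fixed in [l], for integrands in which [u] or the primitive is
    evaluated at the moving point [l *: y]. *)
Lemma tested_is_derive (Z : 'rV[R]_n -> R) (p p' : R -> 'rV[R]_n -> R) (C : R) :
  continuous Z -> (forall x, r < `|x| -> Z x = 0) ->
  (forall l, `|l - 1| < 2^-1 -> measurable_fun setT (p l)) ->
  (forall l y, `|l - 1| < 2^-1 -> `|y| <= r -> `|p l y| <= C) ->
  (forall l y, `|l - 1| < 2^-1 -> `|y| <= r -> `|p' l y| <= C) ->
  (forall l y, `|l - 1| < 2^-1 -> is_derive l (1 : R) (p^~ y) (p' l y)) ->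
  is_derive (1 : R) (1 : R) (fun l => Int (fun y => Z y * p l y)) (Int (fun y => Z y * p' 1 y)) /\
  exists M, bbox M (fun y => Z y * p' 1 y).
Proof.
move=> cZ Z0 mp pC p'C dp.
have [MZ bZ] := continuous_bbox cZ Z0; have [_ ZM _] := bZ.
have e0 : 0 < 2^-1 :> R by rewrite invr_gt0.
have C0 : 0 <= C by apply: le_trans (pC 1 0 _ _); rewrite ?subrr ?normr0// ltW.
have MZ0 := bbox_ge0 bZ.
pose k l y := Z y * p l y.
pose k' l y := Z y * p' l y.
pose M := Num.max (MZ * C) r.
have M0 : 0 <= M by rewrite le_max mulr_ge0.
have bk l : `|l - 1| < 2^-1 -> bbox M (k l).
  move=> l1; split.
  - by apply: measurable_funM; [exact: continuous_rV_measurable|exact: mp].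
  - move=> y; have [yr|yr] := leP `|y| r; last by rewrite /k Z0// mul0r normr0.
    by rewrite le_max normrM ler_pM// pC.
  - by move=> y; rewrite gt_max => /andP[_ yr]; rewrite /k Z0// mul0r.
have dk l y : `|l - 1| < 2^-1 -> is_derive l (1 : R) (k^~ y) (k' l y).
  by move=> l1; apply: is_derive1Ml; exact: dp.
have k'M l y : `|l - 1| < 2^-1 -> `|k' l y| <= M.
  move=> l1; have [yr|yr] := leP `|y| r; last by rewrite /k' Z0// mul0r normr0.
  by rewrite le_max normrM ler_pM// p'C.
split; first exact: (bbox_is_derive e0 bk dk k'M).
by exists M; exact: (bbox_is_derive_bbox e0 bk dk k'M).
Qed.

Let scaling (h : 'rV[R]_n -> R) (C : R) l : measurable_fun setT h ->
  (forall y, `|y| <= 2 * r -> `|h y| <= C) -> `|l - 1| < 2^-1 ->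
  Int (fun y => W l^-1 y * h y) = Int (fun x => psi x * h (l *: x)).
Proof.
move=> mh hC /near1[l0 _ q0 _ q2].
have [Cp Cp0 psiC] := psi_bounded.
have C0 : 0 <= C by apply: le_trans (hC 0 _); rewrite ?normr0// mulr_ge0// ltW.
pose f0 y := psi (l^-1 *: y) * h y.
have out y : 2 * r < `|y| -> f0 y = 0.
  by move=> yr; rewrite /f0 psi0 ?mul0r//; exact: out_scale.
have bf0 : bbox (Num.max (Cp * C) (2 * r)) f0.
  split.
  - by apply: measurable_funM; [apply: continuous_rV_measurable; exact: psi_scale_continuous|].
  - move=> y; have [yr|yr] := leP `|y| (2 * r); last by rewrite out// normr0 le_max mulr_ge0.
    by rewrite le_max normrM ler_pM// hC.
  - by move=> y; rewrite gt_max => /andP[_ /out].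
have if0 := bbox_integrable bf0.
transitivity ((l ^+ n)^-1 * Int f0).
  by rewrite -RintegralZl//; apply: eq_Rintegral => y _; rewrite /W /f0 exprVn mulrA.
rewrite -(Rintegral_affine 0 l0 if0); apply: eq_Rintegral => x _.
by rewrite /f0 addr0 scalerA mulVf ?scale1r// gt_eqF.
Qed.

(** For a test function [psi * w], the equation says that the integral of [psi a(U) . grad w] plus
    that of [Z * w] vanishes. Here [w] will be [u(l x) - u(x)]. *)
Let Z y := dot (a (U y)) (G y) - f y * psi y.

Let Z_continuous : continuous Z.
Proof.
move=> y; apply: (@continuousB _ _ _ (fun y => dot (a (U y)) (G y)) (fun y => f y * psi y)).
  by apply: dot_continuous2; [exact: aU_continuous|exact: cG].
by apply: continuousM; [exact: f_continuous|exact: cpsi].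
Qed.

Let Z_out y : r < `|y| -> Z y = 0.
Proof. by move=> yr; rewrite /Z G0// psi0// dot0r mulr0 subr0. Qed.

(** This radius accommodates [l *: y] for [l <= 2] and [|y| <= 2 * r]. *)
Let u_bounded : exists2 C, 0 <= C & forall x, `|x| <= 2 * (2 * r) -> `|u x| <= C.
Proof. exact: continuous_bounded_ball u_continuous. Qed.

Let U_bounded : exists C : 'I_n -> R, forall i, 0 <= C i /\
  forall x, `|x| <= 2 * (2 * r) -> `|U x ord0 i| <= C i.
Proof.
have /choice[C CP] : forall i, exists c, 0 <= c /\
    forall x, `|x| <= 2 * (2 * r) -> `|U x ord0 i| <= c.
  by move=> i; have [c c0 cP] := continuous_bounded_ball (2 * (2 * r)) (U_continuous (i := i)); exists c.
by exists C.
Qed.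

Let scale_le l y (s : R) : `|l - 1| < 2^-1 -> `|y| <= s -> `|l *: y| <= 2 * s.
Proof. by move=> /near1[l0 l2 _ _ _] ys; rewrite normrZ gtr0_norm// ler_pM// ltW. Qed.

Let r_le2 x : `|x| <= r -> `|x| <= 2 * r.
Proof. by move=> /le_trans; apply; rewrite ler_peMl ?ler1n// ltW. Qed.

(** By homogeneity of [H] the density is [F (l *: U y)]: the parameter acts on the value of the
    gradient and not on its argument, so the derivative in [l] does not involve derivatives of
    [U]. *)
Let energy l := Int (fun y => W l^-1 y * B (l * H (U y))).
(** This and the following derivative densities keep the shape in which the differentiation lemmas
    return them at [l = 1], with [1 *], [- 0] or [psi y * 0]; [local_identity] simplifies them. *)
Let energy' y := dpsi y * B (1 * H (U y)) + psi y * (b (1 * H (U y)) * H (U y)).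

Let energy_is_derive : is_derive (1 : R) (1 : R) energy (Int energy') /\ exists M, bbox M energy'.
Proof.
have [CH CH0 HC] := continuous_bounded_ball (2 * r) HU_continuous.
have hH0 y : 0 <= H (U y) := hyp_H_ge0 hH (U y).
have Hle y : `|y| <= 2 * r -> H (U y) <= CH.
  by move=> /HC; apply: le_trans; exact: ler_norm.
apply: (@weighted_is_derive (fun l y => B (l * H (U y))) (fun l y => b (l * H (U y)) * H (U y))
    (Num.max (B (2 * CH)) (b (2 * CH) * CH))).
- move=> l /near1[l0 _ _ _ _]; apply: continuous_rV_measurable.
  by apply: BlHU_continuous; exact: ltW.
- move=> l y /near1[l0 l2 _ _ _] /Hle yC.
  have lH : 0 <= l * H (U y) by rewrite mulr_ge0// ltW.
  rewrite ger0_norm ?(hyp_B_ge0 hB)// le_max (hyp_B_le hB)//.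
  by apply: ler_pM => //; exact: ltW.
- move=> l y /near1[l0 l2 _ _ _] /Hle yC.
  have lH : 0 <= l * H (U y) by rewrite mulr_ge0// ltW.
  rewrite ger0_norm ?mulr_ge0 ?(hyp_b_ge0 hB)// le_max; apply/orP; right.
  apply: ler_pM => //; first exact: (hyp_b_ge0 hB).
  by apply: (hyp_b_le hB) => //; apply: ler_pM => //; exact: ltW.
- by move=> l y /near1[l0 _ _ _ _]; exact: (hyp_B_scale_is_derive hB).
Qed.

Let work l := Int (fun y => Z y * (u (l *: y) - u y)).
Let work' y := Z y * (dot (U (1 *: y)) y - 0).

Let u_scale_continuous l : continuous (fun y => u (l *: y)).
Proof.
move=> y; apply: (@continuous_comp _ _ _ (fun y => l *: y) u); last exact: u_continuous.
exact: continuousZr.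
Qed.

Let u_diff_continuous l : continuous (fun y => u (l *: y) - u y).
Proof.
by move=> y; apply: continuousB; [exact: u_scale_continuous|exact: u_continuous].
Qed.

Let work_is_derive : is_derive (1 : R) (1 : R) work (Int work') /\ exists M, bbox M work'.
Proof.
have [Cu Cu0 uC] := u_bounded; have [CU CUP] := U_bounded.
apply: (@tested_is_derive Z (fun l y => u (l *: y) - u y) (fun l y => dot (U (l *: y)) y - 0)
    (Num.max (Cu + Cu) (\sum_i CU i * r))) => //.
- by move=> l _; apply: continuous_rV_measurable; exact: u_diff_continuous.
- move=> l y l1 yr; rewrite le_max (le_trans (ler_normB _ _))// lerD// uC//.
    by apply: scale_le => //; exact: r_le2.
  by apply: le_trans yr _; move: r0; lra.
- move=> l y l1 yr; rewrite subr0 le_max dot_le ?orbT// => i; apply: (CUP i).2.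
  by apply: scale_le => //; exact: r_le2.
- move=> l y _; apply: (is_derive1B (f := fun l => u (l *: y)) (g := fun=> u y)).
  exact: u_scale_is_derive.
Qed.

Let primw' y := dpsi y * primitive g y (u y) + psi y * 0.

Let primw_is_derive : is_derive (1 : R) (1 : R)
  (fun l => Int (fun y => W l^-1 y * primitive g y (u y))) (Int primw') /\ exists M, bbox M primw'.
Proof.
have [Cu Cu0 uC] := u_bounded.
have [C C0 CP] := primitive_le g_C1 (Num.max (2 * (2 * r)) Cu).
have Cb y : `|y| <= 2 * r -> `|primitive g y (u y)| <= C.
  move=> yr; have yr2 : `|y| <= 2 * (2 * r).
    by rewrite (le_trans yr)// ler_peMl ?ler1n// mulr_ge0// ltW.
  by apply: CP; rewrite le_max ?yr2// uC ?orbT.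
apply: (@weighted_is_derive (fun _ y => primitive g y (u y)) (fun _ _ => 0) C) => //.
- by move=> l y _; exact: Cb.
- by move=> l y _ _; rewrite normr0.
- by move=> l y _; exact: is_derive_cst.
Qed.

Let prims' x := psi x * (dot x (grad_x_primitive g (1 *: x) (u (1 *: x))) +
     g (1 *: x) (u (1 *: x)) * dot (U (1 *: x)) x).

Let prims_is_derive : is_derive (1 : R) (1 : R)
  (fun l => Int (fun x => psi x * primitive g (l *: x) (u (l *: x)))) (Int prims') /\
  exists M, bbox M prims'.
Proof.
have [Cu Cu0 uC] := u_bounded; have [CU CUP] := U_bounded.
pose r' := Num.max (2 * (2 * r)) Cu.
have [C C0 CP] := primitive_le g_C1 r'.
have [C' C'0 CP'] := grad_x_primitive_le g_C1 r'.
have [C2 C20 CP2] := g_bounded g_C1 r'.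
have lyr l y : `|l - 1| < 2^-1 -> `|y| <= r -> `|l *: y| <= r' /\ `|u (l *: y)| <= r'.
  move=> l1 yr; have ly : `|l *: y| <= 2 * (2 * r) by apply: scale_le => //; exact: r_le2.
  by rewrite /r' !le_max ly uC ?orbT.
apply: (@tested_is_derive psi (fun l x => primitive g (l *: x) (u (l *: x)))
  (fun l x => dot x (grad_x_primitive g (l *: x) (u (l *: x))) + g (l *: x) (u (l *: x)) * dot (U (l *: x)) x)
  (Num.max C (\sum_(i < n) C' * r + C2 * \sum_i CU i * r))) => //.
- move=> l _.
  rewrite (_ : (fun x => _) = (fun x => primitive g x (u x)) \o (fun x => l *: x + 0)).
    exact: measurableT_comp mG (measurable_rV_affine l 0).
  by apply/funext => x /=; rewrite addr0.
- move=> l y l1 yr; have [h1 h2] := lyr l y l1 yr.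
  by rewrite le_max CP.
- move=> l y l1 yr; have [h1 h2] := lyr l y l1 yr.
  rewrite le_max; apply/orP; right; apply: le_trans (ler_normD _ _) _; apply: lerD.
    by rewrite dotC; apply: dot_le => // i; exact: CP'.
  rewrite normrM ler_pM// ?CP2//; apply: dot_le => // i; apply: (CUP i).2.
  by apply: scale_le => //; exact: r_le2.
- by move=> l y _; exact: primitive_is_derive.
Qed.

Let prim_identity : Int primw' = Int prims'.
Proof.
have [Cu Cu0 uC] := u_bounded.
have [C C0 CP] := primitive_le g_C1 (Num.max (2 * (2 * r)) Cu).
have Cb y : `|y| <= 2 * r -> `|primitive g y (u y)| <= C.
  move=> yr; have yr2 : `|y| <= 2 * (2 * r).
    by rewrite (le_trans yr)// ler_peMl ?ler1n// mulr_ge0// ltW.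
  by apply: CP; rewrite le_max ?yr2// uC ?orbT.
have [D1 _] := primw_is_derive; have [[_ D2] _] := prims_is_derive.
rewrite -D2; have [_ <-] := D1; apply: near_eq_derive.
apply/nbhs_ballP; exists 2^-1 => /=; first by rewrite invr_gt0.
move=> l; rewrite /ball/= distrC => l1.
exact: (scaling (h := fun y => primitive g y (u y)) mG Cb).
Qed.

Let energy_scaling l : `|l - 1| < 2^-1 ->
  energy l = Int (fun x => psi x * B (l * H (U (l *: x)))).
Proof.
move=> l1; have [l0 _ _ _ _] := near1 l1.
have cB : continuous (fun y => B (l * H (U y))) by apply: BlHU_continuous; exact: ltW.
have [C C0 CP] := continuous_bounded_ball (2 * r) cB.
by rewrite /energy (scaling (h := fun y => B (l * H (U y))) (continuous_rV_measurable cB) CP).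
Qed.

Let variation l x := psi x * (u (l *: x) - u x).

Let variation' l i x := G x ord0 i * (u (l *: x) - u x) + psi x * (l * U (l *: x) ord0 i - U x ord0 i).

Let variation_is_derive l i x : is_derive x (e_ i) (variation l) (variation' l i x).
Proof.
have du y : derivable u y (e_ i) by exact: class_C1_derivable u_C1 _.
have dpsi_ : derivable psi x (e_ i) by exact: class_C1_derivable psiC1 _.
apply: is_derive_lineP.
have dline (h : 'rV[R]_n -> R) : derivable h x (e_ i) ->
    is_derive (0 : R) (1 : R) (fun s : R => h (s *: e_ i + x)) ('D_(e_ i) h x).
  by move=> dh; apply: is_derive_line; rewrite scale0r add0r; exact: derivableP.
have dul : is_derive (0 : R) (1 : R) (fun s : R => u (l *: (s *: e_ i + x)))
    (l * 'D_(e_ i) u (l *: x)).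
  apply: (@is_derive1_ext _ (fun s => (fun t : R => u (t *: e_ i + l *: x)) (l * s + 0))).
    by move=> s /=; rewrite addr0 scalerDr scalerA.
  apply: (@is_derive_affine _ (fun t : R => u (t *: e_ i + l *: x))).
  rewrite mulr0 addr0; apply: is_derive_line; rewrite scale0r add0r.
  exact: derivableP (du _).
have D := is_derive1M (dline psi dpsi_) (is_derive1B dul (dline u (du x))).
by move: D; rewrite /variation' !mxE scale0r add0r.
Qed.

Let U_scale_continuous l i : continuous (fun x => U (l *: x) ord0 i).
Proof.
move=> x; apply: (@continuous_comp _ _ _ (fun x => l *: x) (fun x => U x ord0 i));
  last exact: U_continuous.
exact: continuousZr.
Qed.

Let variation_C1 l : class_C (@dir_rV R n) 1 setT (variation l).
Proof.
apply: class_C1P; [|exact: variation_is_derive|].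
- move=> x; apply: (@continuousM _ _ psi (fun x => u (l *: x) - u x)); first exact: cpsi.
  exact: u_diff_continuous.
- move=> i x; apply: (@continuousD _ _ _ (fun x => G x ord0 i * (u (l *: x) - u x))
      (fun x => psi x * (l * U (l *: x) ord0 i - U x ord0 i))).
    apply: (@continuousM _ _ (fun x => G x ord0 i) (fun x => u (l *: x) - u x)).
      exact: cG.
    exact: u_diff_continuous.
  apply: (@continuousM _ _ psi (fun x => l * U (l *: x) ord0 i - U x ord0 i)).
    exact: cpsi.
  apply: (@continuousB _ _ _ (fun x => l * U (l *: x) ord0 i)); last exact: U_continuous.
  apply: (@continuousM _ _ (fun=> l) (fun x => U (l *: x) ord0 i)).
    exact: cst_continuous.
  exact: U_scale_continuous.
Qed.

Let weak_variation l :
  Int (fun x => dot (a (U x)) (gradient (variation l) x)) = Int (fun x => f x * variation l x).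
Proof.
apply: (weak_C1 (r := r)).
- exact: variation_C1.
- by move=> x xr; rewrite /variation psi0// mul0r.
- exact: aU_continuous.
- exact: f_continuous.
- by move=> phi tphi; have [_ ->] := u_sol.
Qed.

Let gradient_variation l x :
  gradient (variation l) x = (u (l *: x) - u x) *: G x + psi x *: (l *: U (l *: x) - U x).
Proof.
apply/rowP => i; rewrite mxE; have [_ ->] := variation_is_derive l i x.
by rewrite /variation' !mxE mulrC.
Qed.

(* Convexity of [B \o H] bounds the variation of the energy below by the equation
   tested with [psi (u (l x) - u x)]. *)
Let energy_min l : `|l - 1| < 2^-1 -> energy 1 + work 1 <= energy l + work l.
Proof.
move=> l1; have [l0 _ _ _ _] := near1 l1.
have one1 : `|1 - 1| < 2^-1 :> R by rewrite subrr normr0 invr_gt0.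
rewrite !energy_scaling//.
pose E k x := psi x * B (k * H (U (k *: x))).
pose V k x := Z x * (u (k *: x) - u x).
pose P x := dot (a (U x)) (gradient (variation l) x).
pose Q x := f x * variation l x.
have cE k : 0 <= k -> continuous (E k).
  move=> k0 x; apply: (@continuousM _ _ psi (fun x => B (k * H (U (k *: x))))).
    exact: cpsi.
  apply: (@continuous_comp _ _ _ (fun x => k *: x) (fun x => B (k * H (U x)))).
    exact: continuousZr.
  exact: BlHU_continuous.
have cV k : continuous (V k).
  move=> x; apply: (@continuousM _ _ Z (fun x => u (k *: x) - u x)).
    exact: Z_continuous.
  exact: u_diff_continuous.
have cP : continuous P.
  apply: dot_continuous2; first exact: aU_continuous.
  by move=> i; exact: gradient_continuous (variation_C1 l).
have cQ : continuous Q.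
  move=> x; apply: (@continuousM _ _ f (variation l)); first exact: f_continuous.
  apply: (@continuousM _ _ psi (fun x => u (l *: x) - u x)); first exact: cpsi.
  exact: u_diff_continuous.
have iE k : 0 <= k -> mu.-integrable setT (EFin \o E k).
  by move=> k0; apply: cs_integrable (cE _ k0) _ => x xr; rewrite /E psi0// mul0r.
have iV k : mu.-integrable setT (EFin \o V k).
  by apply: cs_integrable (cV _) _ => x xr; rewrite /V Z_out// mul0r.
have iP : mu.-integrable setT (EFin \o P).
  apply: cs_integrable cP _ => x xr; rewrite /P gradient_variation G0// psi0//.
  by rewrite scaler0 scale0r addr0 dot0r.
have iQ : mu.-integrable setT (EFin \o Q).
  by apply: cs_integrable cQ _ => x xr; rewrite /Q /variation psi0// mul0r mulr0.
have iD (h1 h2 : 'rV[R]_n -> R) : mu.-integrable setT (EFin \o h1) ->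
    mu.-integrable setT (EFin \o h2) -> mu.-integrable setT (EFin \o (fun x => h1 x + h2 x)).
  by move=> i1 i2; exact: (integrableD measurableT i1 i2).
have weak : Int P = Int Q by exact: weak_variation.
have S (h1 h2 : 'rV[R]_n -> R) : mu.-integrable setT (EFin \o h1) ->
    mu.-integrable setT (EFin \o h2) -> Int (fun x => h1 x + h2 x) = Int h1 + Int h2.
  by move=> i1 i2; exact: RintegralD.
have i1 := iD _ _ (iE _ ler01) (iV 1); have il := iD _ _ (iE _ (ltW l0)) (iV l).
(* Since [V 1] is 0 and the terms in the gradient of [psi] agree on both sides, the pointwise
   inequality is [psi x] times the tangent inequality of [F] at [U x], compared at
   [l *: U (l *: x)]. The weak equation makes the integrals of [P] and [Q] equal. *)
have : Int (fun x => (E 1 x + V 1 x) + P x) <= Int (fun x => (E l x + V l x) + Q x).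
  apply: le_Rintegral => //; [exact: iD i1 iP|exact: iD il iQ|].
  move=> x _; rewrite /E /V /P /Q /variation gradient_variation /Z dotDr !dotZr.
  rewrite !scale1r subrr mulr0 mul1r addr0.
  have := flux_tangent hH hB (U x) (l *: U (l *: x)).
  rewrite (hyp_HZ hH) (gtr0_norm l0) => /(ler_wpM2l (psi_ge0 x)).
  by rewrite mulrDr; lra.
rewrite (S _ _ i1 iP) (S _ _ il iQ) weak lerD2r.
by rewrite (S _ _ (iE _ ler01) (iV 1)) (S _ _ (iE _ (ltW l0)) (iV l)).
Qed.

Let energy_identity : Int energy' + Int work' = 0.
Proof.
have [De _] := energy_is_derive; have [Dw _] := work_is_derive.
apply: (@is_derive_min _ (fun l => energy l + work l) 1 _ 2^-1).
- by rewrite invr_gt0.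
- by move=> l; exact: energy_min.
Qed.

Lemma local_identity :
  Int (fun x => psi x * (b (H (U x)) * H (U x) + dot x (grad_x_primitive g x (u x))) +
    dot (U x) x * dot (a (U x)) (G x) -
    (n%:R * psi x + dot (G x) x) * (B (H (U x)) - primitive g x (u x))) = 0.
Proof.
have [_ [M1 /bbox_integrable i1]] := energy_is_derive.
have [_ [M2 /bbox_integrable i2]] := work_is_derive.
have [_ [M3 /bbox_integrable i3]] := primw_is_derive.
have [_ [M4 /bbox_integrable i4]] := prims_is_derive.
have i12 : mu.-integrable setT (EFin \o (fun x => energy' x + work' x)).
  exact: (integrableD measurableT i1 i2).
have i43 : mu.-integrable setT (EFin \o (fun x => prims' x - primw' x)).
  exact: (integrableB measurableT i4 i3).
(* The term [- psi g (U . x)] of [work'] cancels against its opposite in [prims']. What is left is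
   free of [g] except through its primitive and the gradient of that in [x]. *)
transitivity (Int (fun x => (energy' x + work' x) + (prims' x - primw' x))).
  apply: eq_Rintegral => x _.
  rewrite /energy' /work' /prims' /primw' /Z /dpsi /f !scale1r !mul1r; ring.
by rewrite RintegralD// RintegralD// energy_identity RintegralB// prim_identity subrr addr0.
Qed.

End psi.
End local_identity.

(** * Removing the cutoff *)

(** In the limit the cutoff survives only through the number [psi 0], which is divided out; hence
    positivity at 0 takes the place of a plateau of height 1. *)
Lemma cutoff_exists {R : realType} n : exists psi : 'rV[R]_n -> R,
  [/\ class_C (@dir_rV R n) 1 setT psi, forall x, 0 <= psi x,
      forall x, 1 < `|x| -> psi x = 0 & 0 < psi 0].
Proof.
pose eta := fun _ : 'I_n => @bump_fun R; exists (tens eta); split.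
- apply: (@class_C1P _ _ _ (fun i => tens (tens_upd eta i (@bump_fun R)^`()%classic))).
  + by apply: tens_continuous => j; exact: smooth_continuous (@smooth_bump R).
  + by move=> i x; apply: tens_is_derive => t; exact: smooth_is_derive (@smooth_bump R) t.
  + move=> i; apply: tens_continuous => j; rewrite /tens_upd; case: ifP => _.
      exact: smooth_continuous (smooth_derive1 (@smooth_bump R)).
    exact: smooth_continuous (@smooth_bump R).
- by move=> x; apply: prodr_ge0 => i _; exact: bump_ge0.
- exact: tens_bump_out.
- apply: prodr_gt0 => i _; rewrite mxE; have [d d0] := @bump_in R.
  by move=> /(_ 0) h; apply: lt_le_trans d0 (h _); rewrite normr0 invr_ge0.
Qed.

Lemma is_derive_dilate {R : realType} n (psi : 'rV[R]_n -> R) (q d : R) (x v : 'rV[R]_n) :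
  is_derive (q *: x) v psi d -> is_derive x v (fun y => psi (q *: y)) (q * d).
Proof.
move=> dpsi; apply: is_derive_lineP.
apply: (@is_derive1_ext _ (fun s => (fun t : R => psi (t *: v + q *: x)) (q * s + 0))).
  by move=> s /=; rewrite addr0 scalerDr scalerA.
apply: (@is_derive_affine _ (fun t : R => psi (t *: v + q *: x))).
by rewrite mulr0 addr0; apply: is_derive_line; rewrite scale0r add0r.
Qed.

Section dilate.
Context {R : realType} (n : nat).
Variables (psi : 'rV[R]_n -> R) (q : R).
Hypothesis psiC1 : class_C (@dir_rV R n) 1 setT psi.
Implicit Types x y : 'rV[R]_n.

Let psiq_is_derive i x :
  is_derive x (basis_rV i) (fun y => psi (q *: y)) (q * gradient psi (q *: x) ord0 i).
Proof.
rewrite mxE; apply: is_derive_dilate.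
by apply: derivableP; exact: class_C1_derivable psiC1 _.
Qed.

Lemma gradient_dilate x : gradient (fun y => psi (q *: y)) x = q *: gradient psi (q *: x).
Proof. by apply/rowP => i; rewrite mxE; have [_ ->] := psiq_is_derive i x; rewrite !mxE. Qed.

Lemma class_C1_dilate : class_C (@dir_rV R n) 1 setT (fun y => psi (q *: y)).
Proof.
have cq : continuous (fun y : 'rV[R]_n => q *: y) by move=> x; exact: continuousZr.
apply: class_C1P; [|exact: psiq_is_derive|].
  move=> x; apply: (@continuous_comp _ _ _ (fun y => q *: y) psi); first exact: cq.
  exact: class_C_continuous psiC1 _.
move=> i x; apply: (@continuousM _ _ (fun=> q) (fun y => gradient psi (q *: y) ord0 i)).
  exact: cst_continuous.
apply: (@continuous_comp _ _ _ (fun y => q *: y) (fun y => gradient psi y ord0 i)).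
  exact: cq.
exact: gradient_continuous.
Qed.

End dilate.

Section pohozaev.
Context {R : realType} (m : nat) (beta : R).
Local Notation n := m.+1.
Variables (g : 'rV[R]_n -> R -> R) (H : 'rV[R]_n -> R) (B : R -> R) (u : 'rV[R]_n -> R).
Hypotheses (g_C1 : class_C (@dir_rV_R R n) 1 setT (fun z => g z.1 z.2))
  (hH : hyp_H beta H) (hB : hyp_B beta 0 B) (u_sol : weak_solution B H g u).
Local Notation mu := (lebesgue_rV R n).
Local Notation Int f := (Rintegral mu setT f).
Local Notation b := (half_derive B).
Local Notation U := (gradient u).
Local Notation a := (flux B H).
Let F x := B (H (U x)).
Let Gam x := primitive g x (u x).
Let X x := dot x (grad_x_primitive g x (u x)).
Let P x := b (H (U x)) * H (U x).
Hypotheses (F_L1 : mu.-integrable setT (EFin \o F)) (G_L1 : mu.-integrable setT (EFin \o Gam))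
  (X_L1 : mu.-integrable setT (EFin \o X)).
Implicit Types x y : 'rV[R]_n.

Let mG : measurable_fun setT Gam.
Proof. by have /measurable_int/measurable_EFinP := G_L1. Qed.

Let mX : measurable_fun setT X.
Proof. by have /measurable_int/measurable_EFinP := X_L1. Qed.

Let u_C1 : class_C (@dir_rV R n) 1 setT u. Proof. by case: u_sol. Qed.

Let cU : continuous U.
Proof. by apply: continuous_rV => i; exact: gradient_continuous. Qed.

Let F_continuous : continuous F.
Proof.
by move=> x; apply: (@continuous_comp _ _ _ U (fun xi => B (H xi)));
    [exact: cU|exact: (BH_continuous hH hB)].
Qed.

Let P_continuous : continuous P.
Proof.
move=> x; apply: (@continuousM _ _ (fun x => b (H (U x))) (fun x => H (U x))).
  by apply: (@continuous_comp _ _ _ U (fun xi => b (H xi)));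
    [exact: cU|exact: (bH_continuous hH hB)].
by apply: (@continuous_comp _ _ _ U (fun xi => H xi));
    [exact: cU|exact: (hyp_H_continuous hH)].
Qed.

Let F_ge0 x : 0 <= F x.
Proof. by apply: (hyp_B_ge0 hB); exact: (hyp_H_ge0 hH). Qed.

Let P_ge0 x : 0 <= P x.
Proof. by rewrite mulr_ge0 ?(hyp_b_ge0 hB)// (hyp_H_ge0 hH). Qed.

Let P_le : exists2 C, 0 <= C & forall x, P x <= C * F x.
Proof.
have [C C0 CP] := hyp_B_doubling hB; exists C => // x.
by apply: CP; exact: (hyp_H_ge0 hH).
Qed.

Let iZ (c : R) f : mu.-integrable setT (EFin \o f) ->
  mu.-integrable setT (EFin \o (fun x => c * f x)).
Proof.
by move=> i; rewrite (_ : _ \o _ = (fun x => (c%:E * (f x)%:E)%E))//; exact: integrableZl.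
Qed.

Let iD (f1 f2 : 'rV[R]_n -> R) : mu.-integrable setT (EFin \o f1) ->
  mu.-integrable setT (EFin \o f2) -> mu.-integrable setT (EFin \o (fun x => f1 x + f2 x)).
Proof. by move=> i1 i2; exact: (integrableD measurableT i1 i2). Qed.

Let iB (f1 f2 : 'rV[R]_n -> R) : mu.-integrable setT (EFin \o f1) ->
  mu.-integrable setT (EFin \o f2) -> mu.-integrable setT (EFin \o (fun x => f1 x - f2 x)).
Proof. by move=> i1 i2; exact: (integrableB measurableT i1 i2). Qed.

Let iN (f : 'rV[R]_n -> R) : mu.-integrable setT (EFin \o f) ->
  mu.-integrable setT (EFin \o (fun x => `|f x|)).
Proof. by move=> i; exact: (integrable_abse i). Qed.

Let P_L1 : mu.-integrable setT (EFin \o P).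
Proof.
have [C C0 CP] := P_le.
apply: (le_integrable measurableT _ _ (iZ C F_L1)) => /=.
  by apply/measurable_EFinP; exact: continuous_rV_measurable P_continuous.
by move=> x _; rewrite lee_fin ger0_norm// (le_trans (CP x))// ler_norm.
Qed.

Section cutoff.
Variable psi : 'rV[R]_n -> R.
Hypotheses (psiC1 : class_C (@dir_rV R n) 1 setT psi) (psi_ge0 : forall x, 0 <= psi x)
  (psi_out : forall x, 1 < `|x| -> psi x = 0).
Local Notation G := (gradient psi).

(* The integrand of [local_identity] for the cutoff [psi (q *: _)] is
   [J x (q *: x)]. *)
Let J x y := psi y * (P x + X x) + dot (U x) y * dot (a (U x)) (G y) -
  (n%:R * psi y + dot (G y) y) * (F x - Gam x).

Let J_local q : 0 < q -> Int (fun x => J x (q *: x)) = 0.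
Proof.
move=> q0; have q'0 : 0 < q^-1 by rewrite invr_gt0.
have out x : q^-1 < `|x| -> psi (q *: x) = 0.
  by move=> qx; apply: psi_out; rewrite normrZ gtr0_norm// -ltr_pdivrMl// mulr1.
apply: etrans (local_identity g_C1 hH hB u_sol mG (@class_C1_dilate R n psi q psiC1)
  (fun x => psi_ge0 _) q'0 out).
apply: eq_Rintegral => x _.
(* The factor [q] of the dilated gradient is absorbed by the accompanying [x], so [q] occurs only in
   [q *: x]. *)
by rewrite gradient_dilate// /J !(dotZr, dotZl) /F /Gam /X /P; ring.
Qed.

Let cpsi : continuous psi.
Proof. by move=> x; exact: class_C_continuous psiC1 _. Qed.

Let cG i : continuous (fun y => G y ord0 i).
Proof. exact: gradient_continuous. Qed.

Let G_out y : 1 < `|y| -> G y = 0.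
Proof. by move=> y1; apply/rowP => i; rewrite !mxE (derive_out psi_out). Qed.

Let cGy : continuous (fun y => dot (G y) y).
Proof. by apply: dot_continuous2 => // i; exact: coord_continuous. Qed.

Let caG x : continuous (fun y => dot (a (U x)) (G y)).
Proof. by apply: dot_continuous2 => // i; exact: cst_continuous. Qed.

Let J_continuous x : continuous (J x).
Proof.
move=> y; apply: (@continuousB _ _ _
  (fun y => psi y * (P x + X x) + dot (U x) y * dot (a (U x)) (G y))
  (fun y => (n%:R * psi y + dot (G y) y) * (F x - Gam x))).
  apply: (@continuousD _ _ _ (fun y => psi y * (P x + X x))
    (fun y => dot (U x) y * dot (a (U x)) (G y))).
    apply: (@continuousM _ _ psi (fun=> P x + X x)); first exact: cpsi.
    exact: cst_continuous.
  apply: (@continuousM _ _ (dot (U x)) (fun y => dot (a (U x)) (G y))).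
    exact: dot_continuous.
  exact: caG.
apply: (@continuousM _ _ (fun y => n%:R * psi y + dot (G y) y) (fun=> F x - Gam x));
  last exact: cst_continuous.
apply: (@continuousD _ _ _ (fun y => n%:R * psi y) (fun y => dot (G y) y)); last exact: cGy.
by apply: (@continuousM _ _ (fun=> n%:R) psi); [exact: cst_continuous|exact: cpsi].
Qed.

(** The bound is uniform in [y], hence in the dilation. All terms vanish for [|y| > 1]; for
    [|y| <= 1] the norm of [U x] is at most a multiple of [H (U x)], so with [flux_le] the mixed
    term is at most a multiple of [P x], and doubling passes from [P] to [F]. *)
Let J_bounded : exists C1 C2 C3, forall x y,
  `|J x y| <= C1 * F x + C2 * `|X x| + C3 * `|Gam x|.
Proof.
have [Cp Cp0 pC] := continuous_bounded_ball 1 cpsi.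
have psiC y : `|psi y| <= Cp.
  by have [/pC//|y1] := leP `|y| 1; rewrite psi_out// normr0.
have [Cd Cd0 dC] := continuous_bounded_ball 1 cGy.
have dotC' y : `|dot (G y) y| <= Cd.
  by have [/dC//|y1] := leP `|y| 1; rewrite G_out// dot0l normr0.
have /choice[CG CGP] : forall i, exists c, 0 <= c /\ forall y, `|y| <= 1 -> `|G y ord0 i| <= c.
  by move=> i; have [c c0 cP] := continuous_bounded_ball 1 (@cG i); exists c.
have [K K0 KP] := P_le; have [h h0 hP] := hyp_H_ge_norm hH.
pose S := \sum_i H (basis_rV i) * CG i.
have S0 : 0 <= S.
  by apply: sumr_ge0 => i _; rewrite mulr_ge0 ?(hyp_H_ge0 hH)//; case: (CGP i).
have Ca x y : `|y| <= 1 -> `|dot (U x) y * dot (a (U x)) (G y)| <= n%:R * h * S * P x.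
  move=> y1.
  have e1 : `|dot (U x) y| <= n%:R * h * H (U x).
    apply: le_trans (ler_norm_sum _ _ _) _.
    apply: (@le_trans _ _ (\sum_(i < n) h * H (U x))).
      apply: ler_sum => i _; rewrite normrM -[leRHS]mulr1 ler_pM//.
        exact: le_trans (coord_le_norm _ _) (hP _).
      exact: le_trans (coord_le_norm _ _) y1.
    by rewrite sumr_const card_ord -mulrA mulr_natl.
  have e2 : `|dot (a (U x)) (G y)| <= b (H (U x)) * S.
    apply: le_trans (ler_norm_sum _ _ _) _; rewrite mulr_sumr; apply: ler_sum => i _.
    by rewrite normrM mulrA ler_pM// ?(flux_le hH hB)//; case: (CGP i) => _; apply.
  rewrite normrM (_ : n%:R * h * S * P x = n%:R * h * H (U x) * (b (H (U x)) * S)).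
    exact: ler_pM.
  by rewrite /P; ring.
have Cc x y : `|dot (U x) y * dot (a (U x)) (G y)| <= n%:R * h * S * K * F x.
  have [y1|y1] := leP `|y| 1; last first.
    by rewrite G_out// dot0r mulr0 normr0 !mulr_ge0.
  by apply: le_trans (Ca x y y1) _; rewrite -[leRHS]mulrA ler_wpM2l// !mulr_ge0.
exists (Cp * K + n%:R * h * S * K + (n%:R * Cp + Cd)), Cp, (n%:R * Cp + Cd) => x y.
have e1 : `|psi y * (P x + X x)| <= Cp * (K * F x + `|X x|).
  rewrite normrM ler_pM// (le_trans (ler_normD _ _))// lerD2r ger0_norm//.
have e2 : `|(n%:R * psi y + dot (G y) y) * (F x - Gam x)| <= (n%:R * Cp + Cd) * (F x + `|Gam x|).
  rewrite normrM ler_pM//.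
    by rewrite (le_trans (ler_normD _ _))// lerD// normrM ger0_norm// ler_wpM2l.
  by rewrite (le_trans (ler_normB _ _))// lerD2r ger0_norm.
have e3 := Cc x y.
have := ler_normB (psi y * (P x + X x) + dot (U x) y * dot (a (U x)) (G y))
  ((n%:R * psi y + dot (G y) y) * (F x - Gam x)).
have := ler_normD (psi y * (P x + X x)) (dot (U x) y * dot (a (U x)) (G y)).
rewrite -/(J x y); lra.
Qed.

Let J_measurable q : measurable_fun setT (fun x => J x (q *: x)).
Proof.
have cq : continuous (fun y : 'rV[R]_n => q *: y) by move=> x; exact: continuousZr.
have cm (h : 'rV[R]_n -> R) : continuous h -> measurable_fun setT (fun x => h (q *: x)).
  move=> ch; apply: continuous_rV_measurable => x.
  by apply: (@continuous_comp _ _ _ (fun y => q *: y) h); [exact: cq|exact: ch].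
have cdU : continuous (fun x => dot (U x) (q *: x)).
  apply: dot_continuous2; first by move=> i; exact: gradient_continuous.
  move=> i x; apply: (@continuous_comp _ _ _ (fun y => q *: y) (fun y : 'rV[R]_n => y ord0 i)).
    exact: cq.
  exact: coord_continuous.
have cda : continuous (fun x => dot (a (U x)) (G (q *: x))).
  apply: dot_continuous2; first by move=> i; exact: (aU_continuous hH hB u_sol).
  move=> i x; apply: (@continuous_comp _ _ _ (fun y => q *: y) (fun y => G y ord0 i)).
    exact: cq.
  exact: cG.
apply: measurable_funB.
  apply: measurable_funD.
    apply: measurable_funM; first exact: cm.
    by apply: measurable_funD => //; exact: continuous_rV_measurable P_continuous.
  by apply: measurable_funM; exact: continuous_rV_measurable.
apply: measurable_funM; last first.
  by apply: measurable_funB => //; exact: continuous_rV_measurable F_continuous.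
apply: measurable_funD; last exact: (cm (fun y => dot (G y) y)).
by apply: measurable_funM => //; exact: cm.
Qed.

(** As [q] tends to 0 the integrand tends to [J x 0], where each term with the gradient of [psi] has
    a factor [dot _ 0]. *)
Lemma cutoff_limit : Int (fun x => psi 0 * (P x + X x - n%:R * (F x - Gam x))) = 0.
Proof.
have [C1 [C2 [C3 JC]]] := J_bounded.
pose q (k : nat) : R := k.+1%:R^-1.
have q0 k : 0 < q k by rewrite invr_gt0.
have L : Int (fun x => J x (q k *: x)) @[k --> \oo] --> Int (fun x => J x 0).
  apply: (@Rintegral_dct _ _ _ _ (fun x => C1 * F x + C2 * `|X x| + C3 * `|Gam x|)).
  - by move=> k; exact: J_measurable.
  - by apply: iD; [apply: iD|]; apply: iZ => //; exact: iN.
  - by move=> k x; exact: JC.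
  - move=> x; have qx : q k *: x @[k --> \oo] --> (0 : 'rV[R]_n).
      rewrite -[X in _ --> X](scale0r x); apply: cvgZr_tmp; exact: cvg_harmonic.
    apply: (@cvg_comp _ _ _ (fun k => q k *: x) (J x) _ (nbhs (0 : 'rV[R]_n))).
      exact: qx.
    exact: J_continuous.
have L0 : Int (fun x => J x (q k *: x)) @[k --> \oo] --> (0 : R).
  by under eq_fun do rewrite (J_local (q0 _)); exact: cvg_cst.
have <- : Int (fun x => J x 0) = 0 by exact: (cvg_unique (@Rhausdorff R) L L0).
by apply: eq_Rintegral => x _; rewrite /J !dot0r mul0r !addr0; ring.
Qed.

End cutoff.

Lemma pohozaev_Rintegral : Int (fun x => n%:R * Gam x + X x) = Int (fun x => n%:R * F x - P x).
Proof.
have [psi [psiC psi_ge0 psi_out psi0]] := @cutoff_exists R n.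
have i1 : mu.-integrable setT (EFin \o (fun x => n%:R * Gam x + X x)).
  by apply: iD => //; exact: iZ.
have i2 : mu.-integrable setT (EFin \o (fun x => n%:R * F x - P x)).
  by apply: iB => //; exact: iZ.
apply/eqP; rewrite -subr_eq0 -RintegralB//.
have := cutoff_limit psiC psi_ge0 psi_out.
rewrite (_ : (fun x => _) = (fun x => psi 0 * (n%:R * Gam x + X x - (n%:R * F x - P x)))).
  rewrite RintegralZl//; last exact: iB.
  by move/eqP; rewrite mulf_eq0 gt_eqF.
by apply/funext => x; congr (_ * _); ring.
Qed.

(** Integrability makes both extended integrals finite, so the equality of their real values
    suffices. *)
Lemma pohozaev : (\int[mu]_x (n%:R * Gam x + X x)%:E = \int[mu]_x (n%:R * F x - P x)%:E)%E.
Proof.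
have i1 : mu.-integrable setT (EFin \o (fun x => n%:R * Gam x + X x)).
  by apply: iD => //; exact: iZ.
have i2 : mu.-integrable setT (EFin \o (fun x => n%:R * F x - P x)).
  by apply: iB => //; exact: iZ.
rewrite -[LHS]fineK ?(integrable_fin_num measurableT i1)//.
rewrite -[RHS]fineK ?(integrable_fin_num measurableT i2)//.
by congr EFin; exact: pohozaev_Rintegral.
Qed.

End pohozaev.

Theorem theorem1p3 (R : realType) (N : nat) (beta : R)
  (g : 'rV[R]_N -> R -> R) (H : 'rV[R]_N -> R) (B : R -> R) (u : 'rV[R]_N -> R)
  (N_gt0 : (0 < N)%N) (beta01 : 0 < beta < 1)
  (g_C1 : class_C (@dir_rV_R R N) 1 setT (fun z => g z.1 z.2))
  (hH : hyp_H beta H) (hB : hyp_B beta 0 B)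
  (u_sol : weak_solution B H g u)
  (BH_L1 : (lebesgue_rV R N).-integrable setT
     (fun x => (B (H (gradient u x)))%:E))
  (G_L1 : (lebesgue_rV R N).-integrable setT
     (fun x => (primitive g x (u x))%:E))
  (xG_L1 : (lebesgue_rV R N).-integrable setT
     (fun x => (dot x (grad_x_primitive g x (u x)))%:E)) :
  (\int[lebesgue_rV R N]_x
     (N%:R * primitive g x (u x) + dot x (grad_x_primitive g x (u x)))%:E =
   \int[lebesgue_rV R N]_x
     (N%:R * B (H (gradient u x))
      - half_derive B (H (gradient u x)) * H (gradient u x))%:E)%E.
Proof.
(* A positive [N] is some [m.+1], the form of the dimension in which [H] was studied. *)
by case: N g H u N_gt0 g_C1 hH u_sol BH_L1 G_L1 xG_L1 => [//|m] g' H' u' _ g'_C1 hH' u'_sol *;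
  exact: pohozaev g'_C1 hH' hB u'_sol _ _ _.
Qed.
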